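(* Let $n\ge1$, let $\Lambda=\mathbb{Z}[D_{4n}]$, and let $J$, $W_2^T$ and $\mathbb{Z}^T$ be the $\Lambda$-modules defined in the context. Put $M=W_2^T\oplus\Lambda$. Then every $\Lambda$-module $K$ which is stably equivalent to $J$ and has the same $\mathbb{Z}$-rank as $J$ occurs in a short exact sequence of $\Lambda$-modules $$0\to M(a-1)\to K\to \mathbb{Z}\oplus\mathbb{Z}^T\oplus\mathbb{Z}^T\to 0,$$ and $$\operatorname{Ext}^1_{\Lambda}\bigl(\mathbb{Z}\oplus\mathbb{Z}^T\oplus\mathbb{Z}^T,\ M(a-1)\bigr)\cong(\mathbb{Z}/2n)^7\oplus(\mathbb{Z}/2)^2 .$$ In particular there are at most $512\,n^7$ isomorphism classes of such modules $K$.
   Context: $D_{4n}$ (subscript = order) is the dihedral group with presentation $\langle a,b\mid a^{2n}=b^2=e,\ aba=b\rangle$. Modules are right modules. $\mathbb{Z}$ has trivial action; $\mathbb{Z}^T$ is the module with underlying group $\mathbb{Z}$ on which $a$ acts trivially and $b$ acts as $-1$. For a right $\Lambda$-module $N$, $N(a-1)=\{x(a-1):x\in N\}$, which is a submodule. Two modules $L,N$ are stably equivalent if $L\oplus\Lambda^r\cong N\oplus\Lambda^s$ for some integers $r,s\ge0$. Let $\Sigma=\sum_{i=0}^{2n-1}a^i$. $J=\ker\partial_2$, where $\partial_2:\Lambda^3\to\Lambda^2$ is given on bases $E_1,E_2,E_3$ and $e_1,e_2$ by $\partial_2E_1=e_1\Sigma$, $\partial_2E_2=e_2(1+b)$, $\partial_2E_3=e_1(1+ba)+e_2(a-1)$.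 $W_2^T$ is the submodule of the free module $\Lambda^2$ with basis $f_1,f_2$ generated by $f_1\Sigma$, $f_2(1-b)$ and $f_1(1-ba)-f_2(a-1)$. The modules stably equivalent to $J$ and of the same rank as $J$ are the minimal elements of the stable class $\Omega_3(\mathbb{Z})$ of $J$. *)

(* Defs.v *)
From HB Require Import structures.
From mathcomp Require Import all_boot all_order all_algebra all_fingroup all_solvable.
From mathcomp Require Import boolp functions.
From mathcomp.multinomials Require Import freeg.
From mathcomp Require Import zify.

Set Implicit Arguments.
Unset Strict Implicit.
Unset Printing Implicit Defensive.

Import GRing.Theory.
Local Open Scope ring_scope.

(* [Dihedral i s] stands for a^i b^s.  For n >= 1 the type 'Z_(2 * n) is the
   ring of integers modulo 2n. *)
Record dihedral (n : nat) := Dihedral {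
  dih_rot : 'Z_(2 * n);
  dih_flip : bool
}.

Section Dihedral.
Variable n : nat.
Local Notation D := (dihedral n).

Definition dihedral_code (x : D) := (dih_rot x, dih_flip x).
Definition dihedral_decode (p : 'Z_(2 * n) * bool) : D := Dihedral p.1 p.2.

Lemma dihedral_codeK : cancel dihedral_code dihedral_decode.
Proof. by case. Qed.

HB.instance Definition _ := Finite.copy D (can_type dihedral_codeK).

Definition dihedral_mul (x y : D) : D :=
  Dihedral (dih_rot x + (-1) ^+ dih_flip x * dih_rot y)
           (dih_flip x (+) dih_flip y).
Definition dihedral_one : D := Dihedral 0 false.
Definition dihedral_inv (x : D) : D :=
  Dihedral (- ((-1) ^+ dih_flip x * dih_rot x)) (dih_flip x).

Lemma dihedral_mulA : associative dihedral_mul.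
Proof.
case=> [i s] [j t] [k u]; congr Dihedral; rewrite /= ?addbA //.
by rewrite signr_addb mulrDr mulrA addrA.
Qed.

Lemma dihedral_mul1 : left_id dihedral_one dihedral_mul.
Proof. by case=> i s; rewrite /dihedral_mul /= add0r mul1r. Qed.

Lemma dihedral_mulV : left_inverse dihedral_one dihedral_inv dihedral_mul.
Proof. by case=> i s; rewrite /dihedral_mul /= addNr addbb. Qed.

HB.instance Definition _ := Finite_isGroup.Build D
  dihedral_mulA dihedral_mul1 dihedral_mulV.

Definition da : D := Dihedral 1 false.
Definition db : D := Dihedral 0 true.

End Dihedral.

Lemma da_exp n i : (da n ^+ i)%g = Dihedral i%:R false.
Proof.
elim: i => [|i IH]; first by [].
by rewrite expgS IH; congr Dihedral; rewrite /= mul1r -natr1 addrC.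
Qed.

Lemma dihedralE n (x : dihedral n) :
  x = (da n ^+ dih_rot x * db n ^+ dih_flip x)%g.
Proof.
case: x => i s; rewrite da_exp; case: s; rewrite /= ?expg1 ?expg0 ?mulg1.
  by congr Dihedral; rewrite /= mulr0 addr0 natr_Zp.
by rewrite natr_Zp.
Qed.

Lemma card_dihedral_group n : (0 < n)%N -> #|[set: dihedral n]| = (4 * n)%N.
Proof.
move=> n0; rewrite -(card_imset _ (can_inj (@dihedral_codeK n))).
have ->: [set dihedral_code x | x in [set: dihedral n]]
         = [set: 'Z_(2 * n) * bool].
  apply/setP => -[i s]; rewrite inE; apply/imsetP.
  by exists (Dihedral i s).
by rewrite cardsT card_prod card_bool card_ord Zp_cast; lia.
Qed.

(* For n >= 1 this is the group with the presentation
   < a, b | a^2n = b^2 = 1, a b a = b >, with generators da and db. *)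
Lemma dihedral_presentation n : (0 < n)%N ->
  ([set: dihedral n] \isog
     Grp (a : b : a ^+ (2 * n), b ^+ 2, a * b * a = b))%g.
Proof.
move=> n0.
have q1 : (1 < 2 * n)%N by case: n n0 => // n _; rewrite mulnS.
have aq : (da n ^+ (2 * n) = 1)%g.
  by rewrite da_exp pchar_Zp.
have b2 : (db n ^+ 2 = 1)%g by congr Dihedral; rewrite /= mulr0 addr0.
have aba : (da n * db n * da n = db n)%g.
  by congr Dihedral; rewrite /= mulr0 addr0 mulr1 addrN.
have conjE (hT : finGroupType) (x y : hT) :
    (x ^ y == x^-1)%g = (x * y * x == y)%g.
  rewrite /conjg -(inj_eq (mulgI y)) mulKVg -(inj_eq (mulIg x)).
  by rewrite mulgKV.
have homD : ([set: dihedral n] \isog 'D_((2 * n).*2))%g.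
  have le4 : ((2 * n).*2 <= 4 * n)%N by lia.
  rewrite isogEcard card_dihedral // card_dihedral_group // le4 andbT.
  rewrite (Grp_dihedral q1); apply/existsP; exists (da n, db n).
  rewrite /= !xpair_eqE aq b2 !eqxx /=; apply/andP; split.
    rewrite eqEsubset subsetT; apply/subsetP => x _; rewrite (dihedralE x).
    by rewrite groupM ?groupX // mem_gen // inE cycle_id ?orbT.
  by rewrite conjE aba.
move=> rT H; rewrite (eq_homgr _ homD) (Grp_dihedral q1).
by apply/existsP/existsP=> [] [[x y]]; rewrite /= !xpair_eqE ?conjE => xyP;
  exists (x, y); rewrite /= !xpair_eqE ?conjE.
Qed.

Definition zgring (G : finGroupType) : Type := {ffun G -> int}.

Section GroupRing.
Variable G : finGroupType.
Local Notation L := (zgring G).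
Implicit Types u v w : L.

HB.instance Definition _ := GRing.Zmodule.copy L {ffun G -> int}.

Definition zg_mul u v : L := [ffun g => \sum_(h : G) u h * v (h^-1 * g)%g].

Definition zg (g : G) : L := [ffun h => (h == g)%:R].

Lemma zg_mulE u v g : zg_mul u v g = \sum_(h : G) u h * v (h^-1 * g)%g.
Proof. by rewrite ffunE. Qed.

Lemma zg_mulA : associative zg_mul.
Proof.
move=> u v w; apply/ffunP=> g; rewrite !zg_mulE.
under eq_bigr => h _ do rewrite zg_mulE mulr_sumr.
under [RHS]eq_bigr => h _ do rewrite zg_mulE mulr_suml.
rewrite [RHS]exchange_big /=; apply: eq_bigr => h _.
rewrite [RHS](reindex_inj (mulgI h)) /=; apply: eq_bigr => k _.
by rewrite mulrA mulKg invMg mulgA.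
Qed.

Lemma zg_mul1 : left_id (zg 1) zg_mul.
Proof.
move=> u; apply/ffunP=> g; rewrite zg_mulE (bigD1 1%g) //= big1 ?addr0.
  by rewrite ffunE eqxx mul1r invg1 mul1g.
by move=> h /negPf h1; rewrite ffunE h1 mul0r.
Qed.

Lemma zg_mulr1 : right_id (zg 1) zg_mul.
Proof.
move=> u; apply/ffunP=> g; rewrite zg_mulE (bigD1 g) //= big1 ?addr0.
  by rewrite ffunE mulVg eqxx mulr1.
by move=> h hg; rewrite ffunE -eq_mulVg1 (negPf hg) mulr0.
Qed.

Lemma zg_mulDl : left_distributive zg_mul +%R.
Proof.
move=> u v w; apply/ffunP=> g; rewrite [RHS]ffunE !zg_mulE -big_split /=.
by apply: eq_bigr => h _; rewrite ffunE mulrDl.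
Qed.

Lemma zg_mulDr : right_distributive zg_mul +%R.
Proof.
move=> u v w; apply/ffunP=> g; rewrite [RHS]ffunE !zg_mulE -big_split /=.
by apply: eq_bigr => h _; rewrite ffunE mulrDr.
Qed.

Lemma zg1_neq0 : zg 1 != 0.
Proof. by apply/eqP => /ffunP /(_ 1%g); rewrite !ffunE eqxx. Qed.

HB.instance Definition _ := GRing.Zmodule_isNzRing.Build L
  zg_mulA zg_mul1 zg_mulr1 zg_mulDl zg_mulDr zg1_neq0.

Lemma zgM g h : zg (g * h) = zg g * zg h.
Proof.
apply/ffunP => k; rewrite zg_mulE (bigD1 g) //= big1 ?addr0.
  by rewrite !ffunE eqxx mul1r -(inj_eq (mulgI g) (g^-1 * k)%g) mulKVg.
by move=> l /negPf lg; rewrite ffunE lg mul0r.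
Qed.

Lemma zg_sum u : u = \sum_g zg g *~ u g.
Proof.
have evalz v c k : (v *~ c) k = v k * c.
  have evaln m : (v *+ m) k = v k * m%:Z by rewrite ffunMnE -mulr_natr natz.
  by case: c => m; rewrite ?NegzE ?mulrNz -?pmulrn ?ffunE evaln ?mulrN.
apply/ffunP => k; rewrite sum_ffunE (bigD1 k) //= big1 ?addr0 => [|g gk].
  by rewrite evalz ffunE eqxx mul1r.
by rewrite evalz ffunE eq_sym (negPf gk) mul0r.
Qed.

Lemma zg_ind (Q : L -> Prop) :
  Q 0 -> (forall u v, Q u -> Q v -> Q (u + v)) -> (forall u, Q u -> Q (- u)) ->
  (forall g, Q (zg g)) -> forall u, Q u.
Proof.
move=> Q0 QD QN Qg u.
have Qn g k : Q (zg g *+ k).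
  by elim: k => [|k IH]; [rewrite mulr0n | rewrite mulrS; apply: QD].
have Qz g (c : int) : Q (zg g *~ c).
  case: c => k; first by rewrite -pmulrn; apply: Qn.
  by rewrite NegzE mulrNz -pmulrn; apply: QN; apply: Qn.
by rewrite (zg_sum u); apply: (big_ind Q).
Qed.

End GroupRing.

(* Right R-modules are left modules over the converse ring R^c. *)
Notation rmodType R := (lmodType R^c).

Definition ract (R : pzRingType) (N : rmodType R) (x : N) (l : R) : N :=
  (l : R^c) *: x.
Notation "x *> l" := (ract x l) (at level 40, left associativity) : ring_scope.

Lemma ractA (R : pzRingType) (N : rmodType R) (x : N) (l m : R) :
  x *> l *> m = x *> (l * m).
Proof. by rewrite /ract scalerA. Qed.

Lemma ractDr (R : pzRingType) (N : rmodType R) (x : N) (l m : R) :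
  x *> (l + m) = x *> l + x *> m.
Proof. by rewrite /ract scalerDl. Qed.

Lemma ractDl (R : pzRingType) (N : rmodType R) (x y : N) (l : R) :
  (x + y) *> l = x *> l + y *> l.
Proof. by rewrite /ract scalerDr. Qed.

Lemma ract0 (R : pzRingType) (N : rmodType R) (l : R) : (0 : N) *> l = 0.
Proof. by rewrite /ract scaler0. Qed.

Record submodule (R : pzRingType) (V : lmodType R) := Submodule {
  submod_pred : {pred V};
  submod_predP : submod_closed submod_pred
}.

Record submod_type (R : pzRingType) (V : lmodType R) (S : submodule V) :=
  SubmodType { submod_val : V; _ : submod_val \in submod_pred S }.

Coercion submod_type : submodule >-> Sortclass.

HB.instance Definition _ (R : pzRingType) (V : lmodType R) (S : submodule V) :=
  [isSub for @submod_val R V S].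
HB.instance Definition _ (R : pzRingType) (V : lmodType R) (S : submodule V) :=
  [Choice of submod_type S by <:].
HB.instance Definition _ (R : pzRingType) (V : lmodType R) (S : submodule V) :=
  GRing.SubChoice_isSubLmodule.Build R V (submod_pred S)
    (submod_type S) (submod_predP S).

Section SubModules.
Variables (R : pzRingType) (U V : lmodType R).

Lemma ker_closed (f : {linear U -> V}) :
  submod_closed [pred x : U | f x == 0].
Proof.
split=> [|c x y]; rewrite !inE ?linear0 //.
by rewrite linearP => /eqP -> /eqP ->; rewrite scaler0 addr0.
Qed.

Definition kernel (f : {linear U -> V}) : submodule U :=
  Submodule (ker_closed f).

(* For V a right module (scalars in R^c) this is the sum of the v_i c_i. *)
Definition lincomb k (v : 'I_k -> V) (c : 'rV[R]_k) : V :=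
  \sum_i c 0 i *: v i.

Lemma lincomb_linear k (v : 'I_k -> V) : linear (lincomb v).
Proof.
move=> c x y; rewrite /lincomb scaler_sumr -big_split /=.
by apply: eq_bigr => i _; rewrite !mxE scalerDl scalerA.
Qed.

HB.instance Definition _ k (v : 'I_k -> V) :=
  GRing.isLinear.Build R 'rV[R]_k V _ (lincomb v) (lincomb_linear v).

Lemma spanned_closed k (v : 'I_k -> V) :
  submod_closed [pred x : V | `[< exists c, x = lincomb v c >]].
Proof.
split=> [|c x y /asboolP[cx ->] /asboolP[cy ->]]; apply/asboolP.
  by exists 0; rewrite linear0.
by exists (c *: cx + cy); rewrite linearP.
Qed.

Definition spanned k (v : 'I_k -> V) : submodule V := Submodule (spanned_closed v).

End SubModules.

Definition zmod_iso (A B : zmodType) : Prop :=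
  exists f : {additive A -> B}, bijective f.

Section ModuleRelations.
Variable R : pzRingType.
Implicit Types U V W : lmodType R.

Definition lmod_iso U V : Prop := exists f : {linear U -> V}, bijective f.

(* 0 -> U -> V -> W -> 0 is exact *)
Definition short_exact U V W (i : {linear U -> V}) (p : {linear V -> W}) :=
  [/\ injective i, (forall z, exists y, p y = z)
    & forall y, p y = 0 <-> exists x, i x = y].

Definition stably_equivalent U V : Prop :=
  exists r s : nat, lmod_iso (U * 'rV[R]_r)%type (V * 'rV[R]_s)%type.

End ModuleRelations.

Definition zfree (A : zmodType) k (v : 'I_k -> A) : Prop :=
  forall c : 'I_k -> int, \sum_i v i *~ c i = 0 -> forall i, c i = 0.

(* A has Z-rank r: r is the largest size of a Z-linearly independent family. *)
Definition has_zrank (A : zmodType) (r : nat) : Prop :=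
  (exists v : 'I_r -> A, zfree v) /\ ~ (exists v : 'I_r.+1 -> A, zfree v).

Definition same_zrank (A B : zmodType) : Prop :=
  exists r, has_zrank A r /\ has_zrank B r.

Section Hom.
Variables (R : pzRingType) (U V : lmodType R).

Definition hom_pred : {pred U -> V} := fun f => `[< linear f >].

Lemma hom_pred_closed : zmod_closed hom_pred.
Proof.
split=> [|f g /asboolP lf /asboolP lg]; apply/asboolP => c x y.
  by rewrite scaler0 addr0.
change (f (c *: x + y) - g (c *: x + y)
        = c *: (f x - g x) + (f y - g y)).
by rewrite lf lg scalerBr opprD addrACA.
Qed.

HB.instance Definition _ :=
  GRing.isZmodClosed.Build (U -> V) hom_pred hom_pred_closed.

(* Hom_R(U, V); over a noncommutative R it is only an abelian group. *)
Record Hom := MkHom { hom_fun :> U -> V; _ : hom_fun \in hom_pred }.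

HB.instance Definition _ := [isSub for hom_fun].
HB.instance Definition _ := [Choice of Hom by <:].
HB.instance Definition _ := [SubChoice_isSubZmodule of Hom by <:].

End Hom.

Section Ext1.
Variables (R : nzRingType) (A B : lmodType R).

(* The free module on the set A and its canonical surjection onto A, which
   sends the basis element indexed by x to x. *)
Definition free_cover : lmodType R := {freeg A / R}.
Definition free_cover_map : free_cover -> A := fglift id.

Lemma free_cover_map_additive : zmod_morphism free_cover_map.
Proof. exact: lift_is_additive. Qed.

HB.instance Definition _ :=
  GRing.isZmodMorphism.Build free_cover A free_cover_map
    free_cover_map_additive.

Lemma free_cover_map_scalable : scalable free_cover_map.
Proof.
move=> c u; rewrite -{2}[u]freeg_sumE.
rewrite -[c *: u]/(fgscale c u) /fgscale 2!(raddf_sum free_cover_map).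
rewrite scaler_sumr /=.
by apply: eq_bigr => x _; rewrite /free_cover_map !liftU scalerA.
Qed.

HB.instance Definition _ :=
  GRing.isScalable.Build R free_cover A *:%R free_cover_map
    free_cover_map_scalable.

Definition syzygy : submodule free_cover := kernel free_cover_map.

(* Homomorphisms syzygy -> B that extend to the free module. *)
Definition extendable : {pred Hom syzygy B} :=
  fun f => `[< exists g : Hom free_cover B, forall x : syzygy, f x = g (val x) >].

Lemma extendable_closed : zmod_closed extendable.
Proof.
split=> [|f f' /asboolP[g fg] /asboolP[g' fg']]; apply/asboolP.
  by exists 0.
by exists (g - g') => x; rewrite [LHS]/(f x - f' x) fg fg'.
Qed.

HB.instance Definition _ :=
  GRing.isZmodClosed.Build (Hom syzygy B) extendable extendable_closed.

(* The cokernel of the restriction map Hom(F, B) -> Hom(S, B), for the free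
   presentation 0 -> S -> F -> A -> 0. *)
Definition Ext1 : zmodType := Quotient.quot extendable.

End Ext1.

Record zcharacter (G : finGroupType) := ZCharacter {
  zchar :> G -> int;
  zchar1 : zchar 1%g = 1;
  zcharM : forall g h, zchar (g * h)%g = zchar g * zchar h
}.

(* The right Z[G]-module with underlying group Z on which g acts as chi g. *)
Definition Ztwist (G : finGroupType) (chi : zcharacter G) : Type := int.

Section Ztwist.
Variables (G : finGroupType) (chi : zcharacter G).
Local Notation Zchi := (Ztwist chi).

HB.instance Definition _ := GRing.Zmodule.copy Zchi int.

Definition zchar_ext (l : zgring G) : int := \sum_g l g * chi g.

Lemma zchar_ext1 : zchar_ext 1 = 1.
Proof.
rewrite /zchar_ext (bigD1 1%g) //= big1 => [|g /negPf g1].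
  by rewrite ffunE eqxx mul1r zchar1 addr0.
by rewrite ffunE g1 mul0r.
Qed.

Lemma zchar_extD : {morph zchar_ext : l m / l + m}.
Proof.
move=> l m; rewrite /zchar_ext -big_split.
by apply: eq_bigr => g _; rewrite ffunE mulrDl.
Qed.

Lemma zchar_extM : {morph zchar_ext : l m / l * m}.
Proof.
move=> l m; rewrite /zchar_ext mulr_suml.
under eq_bigr => g _ do rewrite zg_mulE mulr_suml.
rewrite exchange_big /=; apply: eq_bigr => h _.
rewrite (reindex_inj (mulgI h)) mulr_sumr; apply: eq_bigr => g _ /=.
by rewrite mulKg zcharM mulrACA.
Qed.

Definition Ztwist_scale (l : (zgring G)^c) (x : Zchi) : Zchi :=
  (x : int) * zchar_ext l.

Lemma Ztwist_scaleA l m x :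
  Ztwist_scale l (Ztwist_scale m x) = Ztwist_scale (l * m) x.
Proof. by rewrite /Ztwist_scale zchar_extM mulrA. Qed.

Lemma Ztwist_scale1 : left_id 1 Ztwist_scale.
Proof. by move=> x; rewrite /Ztwist_scale zchar_ext1 mulr1. Qed.

Lemma Ztwist_scaleDr : right_distributive Ztwist_scale +%R.
Proof. by move=> l x y; apply: mulrDl. Qed.

Lemma Ztwist_scaleDl x : {morph Ztwist_scale^~ x : l m / l + m}.
Proof. by move=> l m; rewrite /Ztwist_scale zchar_extD; apply: mulrDr. Qed.

HB.instance Definition _ := GRing.Zmodule_isLmodule.Build (zgring G)^c Zchi
  Ztwist_scaleA Ztwist_scale1 Ztwist_scaleDr Ztwist_scaleDl.

Lemma Ztwist_zg (x : Zchi) g : x *> zg g = ((x : int) * chi g : Zchi).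
Proof.
rewrite /ract [LHS]/(Ztwist_scale _ _) /Ztwist_scale /zchar_ext.
rewrite (bigD1 g) //= big1 => [|h /negPf hg]; rewrite ffunE ?eqxx ?hg ?mul0r //.
by rewrite mul1r addr0.
Qed.

End Ztwist.

Definition triv_char (G : finGroupType) : zcharacter G :=
  @ZCharacter G (fun=> 1) erefl (fun _ _ => erefl).

Lemma sign_char1 n : (-1) ^+ dih_flip (1%g : dihedral n) = 1 :> int.
Proof. by []. Qed.

Lemma sign_charM n (g h : dihedral n) :
  (-1) ^+ dih_flip (g * h)%g = (-1) ^+ dih_flip g * (-1) ^+ dih_flip h :> int.
Proof. exact: signr_addb. Qed.

(* a |-> 1, b |-> -1 *)
Definition sign_char n : zcharacter (dihedral n) :=
  ZCharacter (sign_char1 n) (@sign_charM n).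

Notation Lam n := (zgring (dihedral n)).

Section DihedralModules.
Variable n : nat.
Local Notation Lam := (Lam n).
Local Notation a := (zg (da n) : Lam).
Local Notation b := (zg (db n) : Lam).

Definition Ztriv : rmodType Lam := Ztwist (triv_char (dihedral n)).
Definition ZT : rmodType Lam := Ztwist (sign_char n).

Definition Sig : Lam := \sum_(0 <= i < 2 * n) a ^+ i.

Definition fbasis k (i : 'I_k) : 'rV[Lam^c]_k := delta_mx 0 i.

Definition e1 : 'rV[Lam^c]_2 := fbasis 0.
Definition e2 : 'rV[Lam^c]_2 := fbasis 1.

(* The images of the basis E_1, E_2, E_3 under d2. *)
Definition d2_val : 'I_3 -> 'rV[Lam^c]_2 :=
  tnth [tuple e1 *> Sig; e2 *> (1 + b); e1 *> (1 + b * a) + e2 *> (a - 1)].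

Definition d2 : {linear 'rV[Lam^c]_3 -> 'rV[Lam^c]_2} := lincomb d2_val.

Definition J : rmodType Lam := kernel d2.

Definition W2T_gen : 'I_3 -> 'rV[Lam^c]_2 :=
  tnth [tuple e1 *> Sig; e2 *> (1 - b); e1 *> (1 - b * a) - e2 *> (a - 1)].

Definition W2T : rmodType Lam := spanned W2T_gen.

(* This is why N (a - 1) is a submodule of every right module N. *)
Lemma a_sub1_comm (l : Lam) : exists m : Lam, (a - 1) * l = m * (a - 1).
Proof.
pose P (l : Lam) := exists m : Lam, (a - 1) * l = m * (a - 1).
have P0 : P 0 by exists 0; rewrite mulr0 mul0r.
have PD x y : P x -> P y -> P (x + y).
  by case=> [mx hx] [my hy]; exists (mx + my); rewrite mulrDr hx hy mulrDl.
have PN x : P x -> P (- x).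
  by case=> [mx hx]; exists (- mx); rewrite mulrN hx mulNr.
have PM x y : P x -> P y -> P (x * y).
  by case=> [mx hx] [my hy]; exists (mx * my); rewrite mulrA hx -!mulrA hy.
have P1 : P 1 by exists 1; rewrite mulr1 mul1r.
have Pa : P a by exists a; rewrite mulrBl mulrBr mul1r mulr1.
have aba : (da n * db n * da n)%g = db n.
  by congr Dihedral; rewrite /= mulr0 addr0 mulr1 addrN.
have Pb : P b.
  exists (- (a * b)); rewrite mulNr mulrBr mulr1 -!zgM aba opprB.
  by rewrite mulrBl -zgM mul1r.
have PX x k : P x -> P (x ^+ k).
  move=> Px; elim: k => [|k IH]; first by rewrite expr0.
  by rewrite exprS; apply: PM.
have zgX (g : dihedral n) k : zg (g ^+ k)%g = (zg g : Lam) ^+ k.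
  by elim: k => [|k IH] //; rewrite expgS exprS zgM IH.
have Pg (g : dihedral n) : P (zg g).
  by rewrite (dihedralE g) zgM !zgX; apply: PM; apply: PX.
exact: (zg_ind P0 PD PN Pg l).
Qed.

Section MulASub1.
Variable N : rmodType Lam.

Lemma mul_a_sub1_closed :
  submod_closed [pred x : N | `[< exists y, x = y *> (a - 1) >]].
Proof.
split=> [|l x y /asboolP[u ->] /asboolP[v ->]]; apply/asboolP.
  by exists 0; rewrite ract0.
have [m hm] := a_sub1_comm l.
by exists (u *> m + v); rewrite ractDl ractA -hm -ractA.
Qed.

Definition mul_a_sub1 : rmodType Lam := Submodule mul_a_sub1_closed.

End MulASub1.
End DihedralModules.

(* Main.v *)
Require Import Defs.
From mathcomp Require Import all_boot all_order all_algebra all_fingroup.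
From HB Require Import structures.
From mathcomp Require Import zify boolp.

(** Let s be the sum of the rotations.  It is central in Lam, and every module K
    is an extension of its image K s by its annihilator, the elements killed by
    s.  Both are functors of K which commute with direct sums, and the theorem
    follows by computing them.

    A module K stably equivalent to J and of the same rank satisfies
    K + Lam^r = J + Lam^r for one and the same r (stable_rank_eq).  The
    annihilator of Lam is the ideal Gam generated by a - 1.  Solving the
    equations which define J shows that its annihilator is Gam + P + P', where P
    and P' are the elements of Gam antifixed by b and by ba, and M (a - 1) is the
    same sum (annS_kernel_iso, mul_a_sub1_M_iso).  So the annihilator of K plus
    copies of Gam is M (a - 1) plus as many copies of Gam, and these must be
    cancelled.  Every endomorphism of Gam is multiplication by an element of Lam,
    the finite quotients of Lam have stable range one (finite_ring_sr1), and an
    integer multiple of the identity of Gam factors through P + P', because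
    a - 1 is a combination of 1 - b and 1 - ba.  This makes the cancellation
    possible (cancel_summand).

    On the image K s the rotations act trivially, and b acts as an involution.
    By cancellation of free abelian groups its fixed and antifixed points have
    the same ranks as those of J s = Q = Z + ZT + ZT, namely one and two; and some
    fixed point is not a norm, because this holds for Q while every fixed point
    is a norm for Lam s.  These properties characterise Q (imgS_assemble), which
    gives the exact sequence.

    Since Q is free over Z on eigenvectors, Ext1 (Q, B) is the sum, over these
    eigenvectors with character chi, of the groups of crossed homomorphisms
    E (g h) = E g h + chi g (E h) from the group to B modulo the principal ones
    (ext1_characters).  For B = Gam, P or P' inside Lam, every crossed
    homomorphism has the form m g - chi g m with m in Lam unique up to integer
    multiples of the eigenvector N of Lam, whose coefficients are the values of
    chi.  Its class is the sum of the coefficients of m on the rotations modulo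
    2n, except for P and P' and the trivial character, where (1 + t) m is a
    multiple k N and the class is the parity of k.  The trivial character
    contributes Z/2n and twice Z/2, each of the two sign characters three times
    Z/2n, whence the group.  Extensions with the same class have isomorphic
    middle terms (realizes_iso), and the group has 512 n^7 elements. *)

Set Implicit Arguments.
Unset Strict Implicit.
Unset Printing Implicit Defensive.

Import Order.TTheory GRing.Theory Num.Theory.

Local Open Scope ring_scope.

(** * Stable range one of finite rings *)

Section StableRange.
Variable S : finNzRingType.
Implicit Types a b c e f x y z u : S.

(** Membership in the corner ring e S e of an idempotent e. *)
Definition corner e x := e * x = x /\ x * e = x.

Definition corner_unit e x :=
  exists u, [/\ corner e u, x * u = e & u * x = e].

(** Stable range one for the corner ring e S e.  The element b c of the whole
    ring need not lie in the corner: only the sum a x + b c does, and this is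
    the form in which a decomposition of e passes the property on. *)
Definition corner_sr1 e := forall a x b c, corner e a ->
  a * x + b * c = e -> exists y, corner_unit e (e * (a + b * y) * e).

(** The powers of z are eventually periodic, so some power is idempotent. *)
Lemma finite_idempotent_power z : exists k, z ^+ k.+1 * z ^+ k.+1 = z ^+ k.+1.
Proof.
have [i [p [p0 per]]] : exists i p, (0 < p)%N /\ z ^+ (i + p) = z ^+ i.
  have /injectivePn[i [j ij eqz]] :
      ~~ injectiveb (fun i : 'I_(#|S|).+1 => z ^+ i).
    apply/negP=> /injectiveP /leq_card; rewrite card_ord ltnn //.
  wlog lt_ij : i j ij eqz / (i < j)%N.
    move=> H; case: (ltngtP i j) => [l|l|l]; first exact: (H i j).
      by apply: (H j i) => //; rewrite eq_sym.
    by case/eqP: ij; apply: val_inj.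
  exists i, (j - i)%N; rewrite subn_gt0; split=> //.
  by rewrite subnKC ?eqz // ltnW.
have perm t q : z ^+ (i + q + p * t) = z ^+ (i + q).
  elim: t => [|t IH]; first by rewrite muln0 addn0.
  have -> : (i + q + p * t.+1 = (i + p) + (q + p * t))%N by lia.
  by rewrite exprD per -exprD addnA IH.
exists ((p * i.+1).-1); rewrite prednK ?muln_gt0 ?p0 // -exprD.
have le : (i <= p * i.+1)%N by apply: leq_trans (leq_pmull _ p0).
by rewrite -{1}(subnKC le) perm subnKC.
Qed.

Lemma cornerM e x y : corner e x -> corner e y -> corner e (x * y).
Proof. by move=> [ex _] [_ ye]; split; rewrite ?mulrA ?ex // -mulrA ye. Qed.

Lemma corner_mid e x : e * e = e -> corner e (e * x * e).
Proof. by move=> ee; split; [rewrite !mulrA ee | rewrite -mulrA ee]. Qed.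

Lemma cornerX e x k : corner e x -> corner e (x ^+ k.+1).
Proof.
by move=> cx; elim: k => [|k IH] //; rewrite exprS; apply: cornerM.
Qed.

(** A corner without proper idempotents is a local ring: a power of a x e is
    0 or e.  In the first case e - a x e = b c e is invertible in the corner,
    and y is chosen to make a + b y equal to e; in the second a is a unit. *)
Lemma corner_sr1_local e : e * e = e ->
  (forall f, corner e f -> f * f = f -> f = 0 \/ f = e) -> corner_sr1 e.
Proof.
move=> ee loc a x b c [ea ae] eq1.
pose z := a * x * e.
have cz : corner e z by split; rewrite /z -?mulrA ?ee // mulrA ea.
have [k zk] := finite_idempotent_power z.
have bcE : b * c * e = e - z by rewrite -[in RHS]ee -[in X in X * _ - _]eq1 mulrDl [_ - z]addrAC subrr add0r.
have [z0|z1] := loc _ (cornerX k cz) zk.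
  have [w we] : exists w, (e - z) * w = e.
    exists (e * (\sum_(i < k.+1) z ^+ i)).
    have -> : e - z = (1 - z) * e by rewrite mulrBl mul1r cz.2.
    have ze : (1 - z) * e = e * (1 - z).
      by rewrite mulrBl mulrBr mul1r mulr1 cz.1 cz.2.
    rewrite -mulrA (mulrA e e) ee mulrA ze -mulrA.
    by rewrite -[1 - z]opprB mulNr -subrX1 z0 sub0r opprK mulr1.
  exists (c * e * w * (e - a)).
  have -> : e * (a + b * (c * e * w * (e - a))) * e = e.
    rewrite !mulrA bcE we mulrBr ee ea addrC subrK ee ee //.
  by exists e.
have ar : a * (e * x * e * z ^+ k) = e.
  by rewrite !mulrA ae -/z -exprS.
set r := e * x * e * z ^+ k in ar.
have cr : corner e (r * e).
  by split; [rewrite /r !mulrA ee | rewrite -mulrA ee].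
have are : a * (r * e) = e by rewrite mulrA ar ee.
exists 0; rewrite mulr0 addr0 ea ae; exists (r * e); split=> //.
have [] := loc (r * e * a); first exact: cornerM.
- by rewrite -mulrA (mulrA a) are (mulrA _ e) -(mulrA r) ee.
- move=> ra0; have e0 : e = 0.
    have : a * (r * e * a) * (r * e) = e.
      by rewrite (mulrA a) are -mulrA are ee.
    by rewrite ra0 mulr0 mul0r.
  by rewrite ra0 e0.
by [].
Qed.

Lemma corner_unitM e x y : e * e = e ->
  corner_unit e x -> corner e x -> corner_unit e y -> corner e y ->
  corner_unit e (x * y).
Proof.
move=> ee [u [cu xu ux]] cx [v [cv yv vy]] cy; exists (v * u); split.
- exact: cornerM.
- by rewrite mulrA -(mulrA x) yv cx.2.
- by rewrite mulrA -(mulrA v) ux cv.2.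
Qed.

Lemma corner_unit_unipotent e t : e * e = e -> corner e t -> t * t = 0 ->
  corner_unit e (e + t) /\ corner e (e + t).
Proof.
move=> ee [et te] tt; split; last by split; rewrite ?mulrDl ?mulrDr ee ?et ?te.
exists (e - t); split.
- by split; rewrite ?mulrBl ?mulrBr ee ?et ?te.
- by rewrite mulrDl !mulrBr ee et te tt subr0 subrK.
- by rewrite mulrBl !mulrDr ee et te tt addr0 addrK.
Qed.

Section Peirce.
Variables e e1 e2 : S.
Hypothesis eE : e = e1 + e2.
Hypotheses (i1 : e1 * e1 = e1) (i2 : e2 * e2 = e2).
Hypotheses (o12 : e1 * e2 = 0) (o21 : e2 * e1 = 0).

Let r11 x : x * e1 * e1 = x * e1. Proof. by rewrite -mulrA i1. Qed.
Let r22 x : x * e2 * e2 = x * e2. Proof. by rewrite -mulrA i2. Qed.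
Let r12 x : x * e1 * e2 = 0. Proof. by rewrite -mulrA o12 mulr0. Qed.
Let r21 x : x * e2 * e1 = 0. Proof. by rewrite -mulrA o21 mulr0. Qed.
Let peirceE := (r11, r22, r12, r21, i1, i2, o12, o21,
  mul0r, mulr0, addr0, add0r, subr0).

Let ee : e * e = e. Proof. by rewrite eE mulrDl !mulrDr !peirceE. Qed.
Let e1e : e1 * e = e1. Proof. by rewrite eE mulrDr !peirceE. Qed.
Let e2e : e2 * e = e2. Proof. by rewrite eE mulrDr !peirceE. Qed.
Let ee1 : e * e1 = e1. Proof. by rewrite eE mulrDl !peirceE. Qed.
Let ee2 : e * e2 = e2. Proof. by rewrite eE mulrDl !peirceE. Qed.

Lemma corner_unit_diag p q : corner e1 p -> corner e2 q ->
  corner_unit e1 p -> corner_unit e2 q ->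
  corner_unit e (p + q) /\ corner e (p + q).
Proof.
move=> [p1 p2] [q1 q2] [u [[u1 u2] pu up]] [v [[v1 v2] qv vq]].
have z x y : e1 * x = x -> y * e2 = y -> y * x = 0.
  by move=> <- <-; rewrite !mulrA r21 mul0r.
have z' x y : e2 * x = x -> y * e1 = y -> y * x = 0.
  by move=> <- <-; rewrite !mulrA r12 mul0r.
split.
  exists (u + v); split.
  - by split; rewrite eE mulrDl !mulrDr ?u1 ?u2 ?v1 ?v2
       ?(z u e2) ?(z' v e1) ?(z e1 v) ?(z' e2 u) // addr0 add0r.
  - by rewrite mulrDl !mulrDr pu qv (z' v p) // (z u q) // addr0 add0r.
  - by rewrite mulrDl !mulrDr up vq (z' q u) // (z p v) // addr0 add0r.
by split; rewrite eE mulrDl !mulrDr ?p1 ?p2 ?q1 ?q2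
  ?(z p e2) ?(z' q e1) ?(z e1 q) ?(z' e2 p) // addr0 add0r.
Qed.

(** Stable range one is inherited from orthogonal corners, by reducing a two by
    two matrix row.  The moves allowed are a -> a U + b y and
    (a, b) -> (L a R, L b) with U, L, R units of the corner of e; they preserve
    both the hypothesis and the conclusion.  Stable range one of the first
    corner makes the entry e1 a e1 a unit, row and column operations then clear
    the off-diagonal entries, and stable range one of the second corner treats
    the remaining diagonal entry. *)
Lemma corner_sr1_add : corner_sr1 e1 -> corner_sr1 e2 -> corner_sr1 e.
Proof.
move=> P1 P2.
(* Writing Good a b for the conclusion, with b = e b. *)
pose Hyp a b := exists x c, a * x + b * c = e.
pose Good a b := exists y, corner_unit e (e * (a + b * y) * e).
have stepU a b U U' y : corner e a -> e * b = b -> corner e U -> corner e U' ->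
    U * U' = e -> U' * U = e ->
    (Hyp a b -> Hyp (e * (a * U + b * y) * e) b) /\
    (Good (e * (a * U + b * y) * e) b -> Good a b).
  move=> [ea ae] eb cU cU' UU' U'U; split.
    move=> [x [c eq1]]; exists (U' * x), (c - y * U' * x).
    have -> : e * (a * U + b * y) * e * (U' * x) = a * x + b * y * U' * x.
      rewrite mulrA -(mulrA _ e U') cU'.1 mulrDr !mulrA ea eb !mulrDl.
      by rewrite -(mulrA a) UU' ae.
    by rewrite mulrBr !mulrA [b * c - _]addrC addrA addrK eq1.
  move=> [y' gy]; exists ((y + y') * U').
  have -> : e * (a + b * ((y + y') * U')) * e =
            (e * (e * (a * U + b * y) * e + b * y') * e) * U'.
    have -> : e * (a * U + b * y) * e = a * U + b * y * e.
      by rewrite mulrDr mulrDl !mulrA ea eb -(mulrA a) cU.2.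
    rewrite -[RHS]mulrA cU'.1 !(mulrDl, mulrDr, mulrA) ea eb ae.
    rewrite -!(mulrA _ U' e) cU'.2 -(mulrA _ e U') cU'.1 -(mulrA a) UU' ae.
    by rewrite addrA.
  apply: corner_unitM => //; first exact: corner_mid.
  by exists U.
have stepLR a b L L' R R' : corner e a -> e * b = b ->
    corner e L -> corner e L' -> corner e R -> corner e R' ->
    L * L' = e -> L' * L = e -> R * R' = e -> R' * R = e ->
    (Hyp a b -> Hyp (L * a * R) (L * b)) /\
    (Good (L * a * R) (L * b) -> Good a b).
  move=> [ea ae] eb cL cL' cR cR' LL' L'L RR' R'R; split.
    move=> [x [c eq1]]; exists (R' * x * L'), (c * L').
    rewrite !mulrA -(mulrA _ R) RR' -(mulrA L a e) ae -!(mulrA L) -mulrDr.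
    by rewrite -mulrDl eq1 mulrA cL.2 LL'.
  move=> [y gy]; exists (y * R').
  have -> : e * (a + b * (y * R')) * e =
            L' * (e * (L * a * R + L * b * y) * e) * R'.
    rewrite !(mulrDl, mulrDr, mulrA) ea eb cL'.2 L'L ea eb ae.
    rewrite -!(mulrA _ e R') !cR'.1 -(mulrA _ R' e) cR'.2.
    by rewrite -(mulrA a) RR' ae.
  have cM : corner e (e * (L * a * R + L * b * y) * e).
    exact: corner_mid.
  have uL : corner_unit e L' by exists L.
  have uR : corner_unit e R' by exists R.
  by apply: corner_unitM => //; [apply: corner_unitM|apply: cornerM].
have corn i j x : e * i = i -> j * e = j -> corner e (i * x * j).
  by move=> ei je; split; rewrite ?mulrA ?ei // -mulrA je.
have good_diag a b : corner e a -> e * b = b -> Hyp a b ->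
    e1 * a * e2 = 0 -> e2 * a * e1 = 0 -> corner_unit e1 (e1 * a * e1) ->
    Good a b.
  move=> [ea ae] eb [x [c eq1]] a12 a21 u1.
  have [||y uy] := P2 (e2 * a * e2) (x * e2) (e2 * b) (c * e2).
  - exact: corner_mid.
  - have -> : e2 * a * e2 = e2 * a.
      by rewrite -[in RHS]ae eE mulrA mulrDr a21 add0r.
    by rewrite -!mulrA -mulrDr !mulrA -mulrDl eq1 mulrA e2e i2.
  set q := _ * e2 in uy.
  exists (y * e2).
  have aE : a = e1 * a * e1 + e2 * a * e2.
    rewrite -[LHS]ea -[in LHS]ae eE !(mulrDl, mulrDr, mulrA) a12 a21.
    by rewrite addr0 add0r.
  have cq : corner e2 q by exact: corner_mid.
  have cp : corner e1 (e1 * a * e1) by exact: corner_mid.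
  have [ud cd] := corner_unit_diag cp cq u1 uy.
  have [u [[e1u ue1] pu up]] := u1.
  have [ut ct] : corner_unit e (e + u * e1 * b * y * e2) /\
                 corner e (e + u * e1 * b * y * e2).
    apply: corner_unit_unipotent => //.
      by split; rewrite ?mulrA -?mulrA ?e2e // -[in RHS]e1u -[in LHS]e1u !mulrA ee1.
    by rewrite -{2}e1u !mulrA r21 !mul0r.
  have -> : e * (a + b * (y * e2)) * e =
     (e1 * a * e1 + q) * (e + u * e1 * b * y * e2).
    have pt : e1 * a * e1 * (u * e1 * b * y * e2) = e1 * b * y * e2.
      by rewrite !mulrA pu i1.
    have qt : q * (u * e1 * b * y * e2) = 0.
      by rewrite -e1u !mulrA /q r21 !mul0r.
    have qE : q = e2 * a * e2 + e2 * b * y * e2.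
      by rewrite /q !(mulrDl, mulrDr, mulrA) !peirceE.
    have bE : b * y * e2 = e1 * b * y * e2 + e2 * b * y * e2.
      by rewrite -[in LHS]eb eE !mulrDl.
    rewrite [RHS]mulrDr cd.2 [in RHS]mulrDl pt qt addr0 mulrDr mulrDl ea ae.
    rewrite !mulrA eb -(mulrA _ e2 e) e2e qE bE [in LHS]aE.
    by rewrite -!addrA; congr (_ + (_ + _)); rewrite addrC.
  exact: corner_unitM.
have good_unit a b : corner e a -> e * b = b -> Hyp a b ->
    corner_unit e1 (e1 * a * e1) -> Good a b.
  move=> ca eb hyp [u [[e1u ue1] pu up]].
  have uu1 : e2 * u = 0 by rewrite -e1u mulrA o21 mul0r.
  have uu2 : u * e2 = 0 by rewrite -ue1 r12.
  have eu : e * u = u by rewrite eE mulrDl e1u uu1 addr0.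
  have ue : u * e = u by rewrite eE mulrDr ue1 uu2 addr0.
  pose tL := e2 * a * u; pose tR := u * a * e2.
  have ctL : corner e tL by rewrite /tL; apply: corn.
  have ctR : corner e tR by rewrite /tR; apply: corn.
  have tLL : tL * tL = 0 by rewrite /tL !mulrA -(mulrA _ u e2) uu2 mulr0 !mul0r.
  have tRR : tR * tR = 0 by rewrite /tR !mulrA -(mulrA _ e2 u) uu1 mulr0 !mul0r.
  have unip t : corner e t -> t * t = 0 ->
      [/\ corner e (e - t), corner e (e + t), (e - t) * (e + t) = e
        & (e + t) * (e - t) = e].
    move=> [et te] tt; split.
    - by split; rewrite ?mulrBl ?mulrBr ee ?et ?te.
    - by split; rewrite ?mulrDl ?mulrDr ee ?et ?te.
    - by rewrite mulrBl !mulrDr ee et te tt addr0 addrK.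
    - by rewrite mulrDl !mulrBr ee et te tt subr0 subrK.
  have [cL cL' LL' L'L] := unip _ ctL tLL.
  have [cR cR' RR' R'R] := unip _ ctR tRR.
  have L1 : e1 * (e - tL) = e1.
    by rewrite mulrBr e1e /tL !mulrA o12 !mul0r subr0.
  have L2 : e2 * (e - tL) = e2 - e2 * a * u.
    by rewrite mulrBr e2e /tL !mulrA i2.
  have R1 : (e - tR) * e1 = e1 by rewrite mulrBl ee1 /tR r21 subr0.
  have R2 : (e - tR) * e2 = e2 - u * a * e2 by rewrite mulrBl ee2 /tR r22.
  have au : e1 * a * u = e1 by rewrite -{1}e1u mulrA pu.
  have ua : u * a * e1 = e1 by rewrite -{1}ue1 -[RHS]up !mulrA.
  have [h g] := stepLR a b _ _ _ _ ca eb cL cL' cR cR' LL' L'L RR' R'R.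
  apply: g; apply: good_diag.
  - by apply: cornerM => //; apply: cornerM.
  - by rewrite mulrA cL.1.
  - exact: h.
  - by rewrite !mulrA L1 -mulrA R2 mulrBr !mulrA au subrr.
  - rewrite !mulrA L2 -mulrA R1 !mulrBl -(mulrA _ u) -(mulrA _ (u * a)) ua.
    by rewrite subrr.
  - by rewrite !mulrA L1 -mulrA R1; exists u.
move=> a x b c [ea ae] eq1.
have hyp : a * x + e * b * c = e.
  by have := congr1 ( *%R e) eq1; rewrite mulrDr !mulrA ea ee.
have eb : e * (e * b) = e * b by rewrite mulrA ee.
suff [y gy] : Good a (e * b).
  exists y; move: gy; rewrite !(mulrDr, mulrDl) !mulrA ee.
  by rewrite -!mulrDl.
have [||y uy] := P1 (e1 * a * e1) (x * e1) (e1 * (a * e2 * x + e * b * c) * e1) e1.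
- exact: corner_mid.
- rewrite mulrA -(mulrA _ e1 e1) i1 -mulrDl; set w := _ + _.
  have -> : w = e1 * (a * x + e * b * c).
    rewrite /w !mulrDr !mulrA addrA; congr (_ + _).
    by rewrite -[in RHS](ae) eE !(mulrDl, mulrDr, mulrA).
  by rewrite hyp e1e i1.
pose t := e2 * (x * e1 * y) * e1.
have [et te] : corner e t by apply: corn.
have tt : t * t = 0 by rewrite /t !mulrA r12 !mul0r.
have [h g] : (Hyp a (e * b) -> Hyp (e * (a * (e + t) + e * b * (c * e1 * y * e1)) * e) (e * b)) /\
    (Good (e * (a * (e + t) + e * b * (c * e1 * y * e1)) * e) (e * b) -> Good a (e * b)).
  apply: (@stepU _ _ _ (e - t)) => //.
  - by split; rewrite ?mulrDl ?mulrDr ee ?et ?te.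
  - by split; rewrite ?mulrBl ?mulrBr ee ?et ?te.
  - by rewrite mulrDl !mulrBr ee et te tt subr0 subrK.
  - by rewrite mulrBl !mulrDr ee et te tt addr0 addrK.
apply: g; apply: good_unit => //.
- exact: corner_mid.
- by apply: h; exists x, c.
move: uy; congr (corner_unit e1 _).
have -> : a * (e + t) = a + a * t by rewrite mulrDr ae.
rewrite !mulrA e1e -(mulrA _ e e1) ee1 /t !(mulrDl, mulrDr, mulrA) e1e.
by rewrite !peirceE e1e addrA.
Qed.

End Peirce.

(** Induction on the size of e S, splitting e into orthogonal idempotents until
    the corners are local. *)
Lemma corner_sr1_idempotent e : e * e = e -> corner_sr1 e.
Proof.
have [m] := ubnP #|[set x | e * x == x]|; elim: m e => // m IH e le ee.
case: (pselect (forall f, corner e f -> f * f = f -> f = 0 \/ f = e)) => [loc|].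
  exact: corner_sr1_local.
move=> /existsNP[f] /not_implyP[[ef fe]] /not_implyP[ff] /not_orP[f0 fne].
have lt h k : e * h = h -> h * k = 0 -> e * k = k -> k <> 0 -> corner e h ->
    (#|[set x | (h * x == x)%R]| < #|[set x | (e * x == x)%R]|)%N.
  move=> eh hk ek k0 _; apply: proper_card; apply/properP; split.
    apply/subsetP => x; rewrite !inE => /eqP hx.
    by rewrite -{1}hx mulrA eh hx.
  exists k; rewrite inE ?ek //; rewrite hk eq_sym; exact/eqP.
have fK : f * (e - f) = 0 by rewrite mulrBr fe ff subrr.
have Kf : (e - f) * f = 0 by rewrite mulrBl ef ff subrr.
have KK : (e - f) * (e - f) = e - f by rewrite mulrBr Kf subr0 mulrBl ee fe.
have eK : e * (e - f) = e - f by rewrite mulrBr ee ef.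
have K0 : e - f <> 0 by move/subr0_eq => /esym.
apply: (@corner_sr1_add e f (e - f)) => //.
- by rewrite addrC subrK.
- apply: IH => //; apply: leq_trans (lt f (e - f) _ _ _ _ _) le => //.
- apply: IH => //; apply: leq_trans (lt (e - f) f _ _ _ _ _) le => //.
  by split=> //; rewrite mulrBl ee fe.
Qed.

(** The case e = 1, where the corner is the whole ring. *)
Theorem finite_ring_sr1 a x b : a * x + b = 1 ->
  exists y u, (a + b * y) * u = 1.
Proof.
rewrite -[b in a * x + b]mulr1 => eq1.
have c1 : corner 1 a by split; rewrite ?mul1r ?mulr1.
have [y [u [_ yu _]]] := corner_sr1_idempotent (mulr1 1) c1 eq1.
by exists y, u; rewrite mul1r mulr1 in yu.
Qed.

End StableRange.

(** * Group rings and their finite quotients *)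

Section GroupRingCoefficients.
Variable G : finGroupType.
Implicit Types (u v : zgring G) (g h : G).

Lemma zgmE u v g : (u * v) g = \sum_h u h * v (h^-1 * g)%g.
Proof. exact: zg_mulE. Qed.

Lemma zgmEr u v g : (u * v) g = \sum_h u (g * h^-1)%g * v h.
Proof.
rewrite zgmE (reindex_inj (inj_comp (mulgI g) (@invg_inj _))) /=.
by apply: eq_bigr => h _; rewrite invMg invgK mulgKV.
Qed.

Lemma zg_mull h v g : (zg h * v) g = v (h^-1 * g)%g.
Proof.
rewrite zgmE (bigD1 h) //= big1 => [|k /negPf kh]; rewrite ffunE ?eqxx ?kh ?mul0r //.
by rewrite mul1r addr0.
Qed.

Lemma zg_mulr u h g : (u * zg h) g = u (g * h^-1)%g.
Proof.
rewrite zgmEr (bigD1 h) //= big1 => [|k /negPf kh]; rewrite ffunE ?eqxx ?kh ?mulr0 //.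
by rewrite mulr1 addr0.
Qed.

Lemma zgDE u v g : (u + v) g = u g + v g. Proof. exact: ffunE. Qed.
Lemma zgNE u g : (- u) g = - u g. Proof. exact: ffunE. Qed.
Lemma zg0E g : (0 : zgring G) g = 0. Proof. exact: ffunE. Qed.
Lemma zgE h g : (zg h) g = (g == h)%:R. Proof. exact: ffunE. Qed.

Lemma zg1E g : (1 : zgring G) g = (g == 1%g)%:R. Proof. exact: zgE. Qed.

Lemma zgMnE u k g : (u *+ k) g = u g *+ k.
Proof. by elim: k => [|k IH]; rewrite ?mulr0n ?zg0E // !mulrS zgDE IH. Qed.

Lemma zgMzE u (k : int) g : (u *~ k) g = u g * k.
Proof.
by case: k => k; rewrite ?NegzE ?mulrNz -?pmulrn ?zgNE zgMnE ?mulrN -mulr_natr natz.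
Qed.

Lemma zg_sumE (I : Type) (r : seq I) (P : pred I) (F : I -> zgring G) g :
  (\sum_(i <- r | P i) F i) g = \sum_(i <- r | P i) F i g.
Proof. exact: sum_ffunE. Qed.

End GroupRingCoefficients.

Section CharacterExtension.
Variables (G : finGroupType) (chi : zcharacter G).
Implicit Types (l : zgring G) (g : G).

Lemma zchar_ext0 : zchar_ext chi 0 = 0.
Proof. by rewrite /zchar_ext big1 // => g _; rewrite zg0E mul0r. Qed.

Lemma zchar_extN l : zchar_ext chi (- l) = - zchar_ext chi l.
Proof. by rewrite /zchar_ext -sumrN; apply: eq_bigr => g _; rewrite zgNE mulNr. Qed.

Lemma zchar_ext_zg g : zchar_ext chi (zg g) = chi g.
Proof.
rewrite /zchar_ext (bigD1 g) //= big1 => [|h /negPf hg]; rewrite zgE ?eqxx ?hg ?mul0r //.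
by rewrite mul1r addr0.
Qed.

End CharacterExtension.

Section ModularGroupRing.
Variables (G : finGroupType) (N : nat).

(** The group ring over the integers modulo N, as a finite ring. *)
Definition zgmod : Type := {ffun G -> 'Z_N}.
Local Notation F := zgmod.
Implicit Types u v w : F.
Implicit Types x y : zgring G.

HB.instance Definition _ := Finite.copy F {ffun G -> 'Z_N}.
HB.instance Definition _ := GRing.Zmodule.copy F {ffun G -> 'Z_N}.

Definition zgmod_mul u v : F := [ffun g => \sum_(h : G) u h * v (h^-1 * g)%g].
Definition zgmod1 : F := [ffun h => (h == 1%g)%:R].

Definition zg_reduce (u : zgring G) : F := [ffun g => (u g)%:~R].

Definition zg_lift (u : F) : zgring G := [ffun g => (u g : nat)%:Z].

Lemma zg_liftK : cancel zg_lift zg_reduce.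
Proof. by move=> u; apply/ffunP=> g; rewrite !ffunE; apply: natr_Zp. Qed.

Lemma zg_reduceD x y : zg_reduce (x + y) = zg_reduce x + zg_reduce y.
Proof. by apply/ffunP=> g; rewrite !ffunE intrD. Qed.

Lemma zg_reduceM x y : zg_reduce (x * y) = zgmod_mul (zg_reduce x) (zg_reduce y).
Proof.
apply/ffunP=> g; rewrite !ffunE rmorph_sum.
by apply: eq_bigr => h _; rewrite !ffunE rmorphM.
Qed.

Lemma zg_reduce1 : zg_reduce 1 = zgmod1.
Proof. by apply/ffunP=> g; rewrite !ffunE; case: (g == 1%g). Qed.

Lemma zgmod_mulA : associative zgmod_mul.
Proof.
move=> u v w; rewrite -(zg_liftK u) -(zg_liftK v) -(zg_liftK w).
by rewrite -!zg_reduceM mulrA.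
Qed.

Lemma zgmod_mul1 : left_id zgmod1 zgmod_mul.
Proof. by move=> u; rewrite -(zg_liftK u) -zg_reduce1 -zg_reduceM mul1r. Qed.

Lemma zgmod_mulr1 : right_id zgmod1 zgmod_mul.
Proof. by move=> u; rewrite -(zg_liftK u) -zg_reduce1 -zg_reduceM mulr1. Qed.

Lemma zgmod_mulDl : left_distributive zgmod_mul +%R.
Proof.
move=> u v w; rewrite -(zg_liftK u) -(zg_liftK v) -(zg_liftK w).
by rewrite -!(zg_reduceM, zg_reduceD) mulrDl.
Qed.

Lemma zgmod_mulDr : right_distributive zgmod_mul +%R.
Proof.
move=> u v w; rewrite -(zg_liftK u) -(zg_liftK v) -(zg_liftK w).
by rewrite -!(zg_reduceM, zg_reduceD) mulrDr.
Qed.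

Lemma zgmod1_neq0 : zgmod1 != 0.
Proof. by apply/eqP => /ffunP /(_ 1%g); rewrite !ffunE eqxx. Qed.

HB.instance Definition _ := GRing.Zmodule_isNzRing.Build F
  zgmod_mulA zgmod_mul1 zgmod_mulr1 zgmod_mulDl zgmod_mulDr zgmod1_neq0.

Lemma zg_reduce_inj x y : (1 < N)%N -> zg_reduce x = zg_reduce y ->
  exists w : zgring G, x = y + w *+ N.
Proof.
move=> N1 /ffunP eqxy.
have dv g : (N %| x g - y g)%Z.
  have : (x g - y g)%:~R = 0 :> 'Z_N.
    by move: (eqxy g); rewrite !ffunE intrB => ->; rewrite subrr.
  case: (x g - y g) => k; rewrite ?NegzE ?mulrNz -?pmulrn.
    by move/eqP; rewrite -val_eqE /= val_Zp_nat.
  by move/eqP; rewrite oppr_eq0 -val_eqE /= val_Zp_nat // dvdzE abszN.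
exists [ffun g => ((x g - y g) %/ N)%Z]; apply/ffunP => g.
rewrite zgDE zgMnE ffunE -[X in _ + X]mulr_natr natz divzK ?dv //.
by rewrite addrC subrK.
Qed.

End ModularGroupRing.

(** Stable range one for the finite ring Z/N[G], read off in Z[G]. *)
Lemma zgring_sr1 (G : finGroupType) (N : nat) (a x b : zgring G) :
  (1 < N)%N -> a * x + b = 1 ->
  exists y u w, (a + b * y) * u = 1 + w *+ N.
Proof.
move=> N1 eq1.
have [|y [u yu]] :=
    @finite_ring_sr1 (zgmod G N) (zg_reduce N a) (zg_reduce N x) (zg_reduce N b).
  have := congr1 (zg_reduce N) eq1.
  by rewrite zg_reduceD zg_reduceM zg_reduce1.
have [|w wE] := @zg_reduce_inj G N ((a + b * zg_lift y) * zg_lift u) 1 N1.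
  by rewrite zg_reduceM zg_reduceD zg_reduceM !zg_liftK zg_reduce1.
by exists (zg_lift y), (zg_lift u), w; rewrite wE.
Qed.

Section Determinant.
Variable G : finGroupType.

(** The matrix of left multiplication by z. *)
Definition zg_mx (z : zgring G) : 'M[int]_#|G| :=
  \matrix_(i, j) z (enum_val i * (enum_val j)^-1)%g.

Lemma zg_mx_mul (z t : zgring G) g :
  (z * t) g = \sum_j zg_mx z (enum_rank g) j * t (enum_val j).
Proof.
rewrite zgmEr (reindex _ (onW_bij _ (enum_val_bij G))) /=.
by apply: eq_bigr => j _; rewrite mxE enum_rankK.
Qed.

(** An element congruent to 1 modulo m > 1 divides the determinant of its
    multiplication, which is congruent to 1 and hence nonzero: the cofactors
    give the quotient. *)
Lemma zgring_cong1_dvd_int (m : nat) (z w : zgring G) : (1 < m)%N ->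
  z = 1 + w *+ m -> exists N t, (1 < N)%N /\ z * t = N%:R.
Proof.
move=> m1 zE; set d := \det (zg_mx z).
have d0 : d != 0.
  apply/eqP => d0.
  have := congr1 (intr : int -> 'Z_m) d0; rewrite -det_map_mx.
  have -> : map_mx intr (zg_mx z) = 1%:M :> 'M['Z_m]_#|G|.
    apply/matrixP => i j; rewrite !mxE zE zgDE zgMnE zg1E -[_ *+ m]mulr_natr.
    have mz : (m%:R : int)%:~R = 0 :> 'Z_m by rewrite natz -pmulrn pchar_Zp.
    rewrite intrD intrM mz mulr0 addr0 -eq_mulgV1.
    by rewrite (inj_eq enum_val_inj); case: (i == j).
  by rewrite det1 => /eqP; rewrite oner_eq0.
pose t : zgring G := [ffun g => \adj (zg_mx z) (enum_rank g) (enum_rank 1%g)].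
have zt : z * t = 1 *~ d.
  apply/ffunP => g; rewrite zg_mx_mul zgMzE zg1E.
  have /matrixP/(_ (enum_rank g) (enum_rank 1%g)) := mul_mx_adj (zg_mx z).
  rewrite !mxE (inj_eq enum_rank_inj) -/d => eqd.
  rewrite -[RHS]mulrC mulr_natr -eqd; apply: eq_bigr => j _.
  by rewrite ffunE enum_valK.
have d2 : (0 < `|d|)%N by rewrite absz_gt0.
(* twice the determinant, so that N > 1 *)
exists (2 * `|d|)%N, (t *~ (sgz d * 2)); split; first by lia.
rewrite mulrzAr zt -mulrzA [RHS](pmulrn 1) ; congr (1 *~ _).
by rewrite PoszM abszEsg; move: (sgz d) => s; lia.
Qed.
End Determinant.

(** * Homomorphisms and natural submodules *)

Definition mklin (R : pzRingType) (U V : lmodType R) (f : U -> V)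
  (lf : linear f) : {linear U -> V} :=
  HB.pack f (GRing.isLinear.Build R U V _ f lf).

Definition mkadd (A B : zmodType) (f : A -> B) (af : zmod_morphism f) :
  {additive A -> B} := HB.pack f (GRing.isZmodMorphism.Build A B f af).

Lemma inj_surj_bij (A B : Type) (f : A -> B) : injective f ->
  (forall y, exists x, f x = y) -> bijective f.
Proof.
move=> finj /choice[g fg]; exists g => // x.
by apply: finj; rewrite fg.
Qed.

Lemma morph_Mz (A B : zmodType) (f : A -> B) : zmod_morphism f ->
  forall x z, f (x *~ z) = f x *~ z.
Proof. by move=> fB x z; exact: (raddfMz (mkadd fB)). Qed.

Lemma morph_sum (A B : zmodType) (f : A -> B) : zmod_morphism f ->
  forall (I : Type) (r : seq I) (P : pred I) (F : I -> A),
    f (\sum_(i <- r | P i) F i) = \sum_(i <- r | P i) f (F i).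
Proof. by move=> fB I r P F; exact: (raddf_sum (mkadd fB)). Qed.

Section AdditiveIsomorphisms.
Implicit Types A B C V : zmodType.

Lemma zmod_iso_fun A B (f : A -> B) : zmod_morphism f -> injective f ->
  (forall y, exists x, f x = y) -> zmod_iso A B.
Proof. by move=> af finj fsurj; exists (mkadd af); apply: inj_surj_bij. Qed.

Lemma zmod_iso_refl A : zmod_iso A A.
Proof. by apply: (@zmod_iso_fun _ _ id) => // x; exists x. Qed.

Lemma zmod_iso_sym A B : zmod_iso A B -> zmod_iso B A.
Proof.
move=> [f [g fg gf]]; apply: (@zmod_iso_fun _ _ g).
- by move=> x y; apply: (can_inj fg); rewrite raddfB !gf.
- exact: can_inj gf.
- by move=> x; exists (f x).
Qed.

Lemma zmod_iso_trans A B C : zmod_iso A B -> zmod_iso B C -> zmod_iso A C.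
Proof.
move=> [f fb] [g gb]; exists (mkadd (raddfB (g \o f))).
exact: bij_comp gb fb.
Qed.

Lemma zmod_iso_prod A B A' B' : zmod_iso A B -> zmod_iso A' B' ->
  zmod_iso (A * A')%type (B * B')%type.
Proof.
move=> [f [f' ff ff']] [g [g' gg gg']].
apply: (@zmod_iso_fun _ _ (fun x => (f x.1, g x.2))).
- by move=> x y; rewrite !raddfB.
- by move=> [x y] [x' y'] [/(can_inj ff) -> /(can_inj gg) ->].
- by move=> [x y]; exists (f' x, g' y); rewrite /= ff' gg'.
Qed.

Lemma zmod_iso_row0 A V : zmod_iso A (A * 'rV[V]_0)%type.
Proof.
apply: (@zmod_iso_fun _ _ (fun x => (x, 0))).
- by move=> x y; congr pair; rewrite /= subr0.
- by move=> x y [].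
- by move=> [x y]; exists x; congr pair; apply/rowP; case.
Qed.

Lemma zmod_iso_rowS A V r :
  zmod_iso (A * 'rV[V]_r.+1)%type ((A * 'rV[V]_r) * V)%type.
Proof.
apply: zmod_iso_sym.
apply: (@zmod_iso_fun _ _ (fun x : (A * 'rV[V]_r) * V =>
   (x.1.1, row_mx (\row__ x.2) x.1.2 : 'rV[V]_(1 + r)))).
- move=> x y /=; congr pair; apply/rowP => i; rewrite !mxE.
  by case: split => j; rewrite !mxE.
- move=> [[x y] z] [[x' y'] z'] /= [-> /eq_row_mx[/rowP/(_ 0)]].
  by rewrite !mxE => -> ->.
- move=> [u v]; exists ((u, rsubmx (v : 'rV_(1 + r))), (v : 'rV_(1 + r)) 0 0).
  congr pair; rewrite /= -[RHS](@hsubmxK _ 1 1 r v); congr row_mx.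
  by apply/rowP => i; rewrite !mxE (ord1 i); congr (v _ _); apply: val_inj.
Qed.

End AdditiveIsomorphisms.

Section Isomorphisms.
Variable R : pzRingType.
Implicit Types U V W : lmodType R.

Lemma lmod_iso_fun U V (f : U -> V) : linear f -> injective f ->
  (forall y, exists x, f x = y) -> lmod_iso U V.
Proof.
by move=> lf finj fsurj; exists (mklin lf); apply: inj_surj_bij.
Qed.

Lemma lmod_iso_refl U : lmod_iso U U.
Proof. by apply: (@lmod_iso_fun _ _ id) => // x; exists x. Qed.

Lemma same_image_iso U V W (f : {linear U -> W}) (g : {linear V -> W}) :
  injective f -> injective g ->
  (forall w, (exists u, f u = w) <-> (exists v, g v = w)) -> lmod_iso U V.
Proof.
move=> finj ginj im.
have /choice[h hP] : forall u, exists v, g v = f u.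
  by move=> u; apply/im; exists u.
apply: (@lmod_iso_fun _ _ h).
- by move=> c x y; apply: ginj; rewrite linearP !hP linearP.
- by move=> x y eq; apply: finj; rewrite -!hP eq.
- move=> v; have [|u uv] := (im (g v)).2; first by exists v.
  by exists u; apply: ginj; rewrite hP.
Qed.

Lemma same_kernel_iso U V W (f : {linear U -> V}) (g : {linear U -> W}) :
  (forall v, exists u, f u = v) -> (forall w, exists u, g u = w) ->
  (forall u, f u = 0 <-> g u = 0) -> lmod_iso V W.
Proof.
move=> /choice[s fs] gsurj ker.
have gs u : g (s (f u)) = g u.
  apply/eqP; rewrite -subr_eq0 -linearB; apply/eqP/ker.
  by rewrite linearB /= fs subrr.
apply: (@lmod_iso_fun _ _ (g \o s)).
- move=> c x y; rewrite /= -linearP -[RHS]gs linearP /= !fs //.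
- move=> x y /= eq; rewrite -(fs x) -(fs y); apply/eqP; rewrite -subr_eq0.
  by rewrite -linearB; apply/eqP/ker; rewrite linearB /= eq subrr.
- by move=> w; have [u <-] := gsurj w; exists (f u); rewrite /= gs.
Qed.

Lemma lmod_iso_trans U V W : lmod_iso U V -> lmod_iso V W -> lmod_iso U W.
Proof.
move=> [f fb] [g gb]; exists (mklin (linearP (g \o f))).
exact: bij_comp gb fb.
Qed.

Lemma lmod_iso_sym U V : lmod_iso U V -> lmod_iso V U.
Proof.
move=> [f [g fg gf]]; apply: (@same_kernel_iso U V U f (mklin (linearP idfun))).
- by move=> v; exists (g v).
- by move=> u; exists u.
- move=> u; split=> /= [fu|->]; last exact: linear0.
  by rewrite -(fg u) fu -(linear0 f) fg.
Qed.

Lemma lmod_iso_prod U V U' V' : lmod_iso U V -> lmod_iso U' V' ->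
  lmod_iso (U * U')%type (V * V')%type.
Proof.
move=> [f [f' ff ff']] [g [g' gg gg']].
apply: (@lmod_iso_fun _ _ (fun x => (f x.1, g x.2))).
- by move=> c x y; rewrite !linearP.
- by move=> [x y] [x' y'] [/(can_inj ff) -> /(can_inj gg) ->].
- by move=> [x y]; exists (f' x, g' y); rewrite /= ff' gg'.
Qed.

Lemma lmod_iso_zmod U V : lmod_iso U V -> zmod_iso U V.
Proof. by move=> [f fb]; exists f. Qed.

Lemma lmod_iso_rowS U r : lmod_iso (U * 'rV[R]_r.+1)%type ((U * 'rV[R]_r) * R^o)%type.
Proof.
apply: lmod_iso_sym.
apply: (@lmod_iso_fun _ _ (fun x : (U * 'rV[R]_r) * R^o =>
   (x.1.1, row_mx (\row__ x.2) x.1.2 : 'rV[R]_(1 + r)))).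
- move=> c x y /=; congr pair; apply/rowP => i; rewrite !mxE.
  by case: split => j; rewrite !mxE.
- move=> [[x y] z] [[x' y'] z'] /= [-> /eq_row_mx[/rowP/(_ 0)]].
  by rewrite !mxE => -> ->.
- move=> [u v]; exists ((u, rsubmx (v : 'rV_(1 + r))), (v : 'rV_(1 + r)) 0 0).
  congr pair; rewrite /= -[RHS](@hsubmxK _ 1 1 r v); congr row_mx.
  by apply/rowP => i; rewrite !mxE (ord1 i); congr (v _ _); apply: val_inj.
Qed.

End Isomorphisms.

Section RegularModule.
Variable L : nzRingType.
Implicit Types k x : L.

Lemma lmul_linear k : linear (fun x : L^c^o => (k * (x : L) : L^c^o)).
Proof.
by move=> c x y; rewrite mulrDr; congr (_ + _); rewrite [LHS]mulrA.
Qed.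

(** Endomorphisms of the right regular module. *)
Definition lmul k : {linear L^c^o -> L^c^o} := mklin (@lmul_linear k).

Lemma lmulE k (x : L^c^o) : lmul k x = k * (x : L).
Proof. by []. Qed.

Lemma regular_ract (x : L^c^o) k : x *> k = (x : L) * k.
Proof. by []. Qed.

Lemma lin_ract (U V : lmodType L^c) (f : {linear U -> V}) (u : U) k :
  f (u *> k) = f u *> k.
Proof. exact: linearZ. Qed.

Lemma sub_ract (V : lmodType L^c) (T : submodule V) (x : T) k :
  val (x *> k) = val x *> k.
Proof. by []. Qed.

Lemma sub_regular_ract (T : submodule (L^c^o)) (x : T) k :
  (val (x *> k) : L) = (val x : L) * k.
Proof. exact: (@sub_ract L^c^o T x k). Qed.

Lemma ract0r (V : lmodType L^c) (v : V) : v *> (0 : L) = 0.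
Proof. exact: scale0r. Qed.
Lemma ract1r (V : lmodType L^c) (v : V) : v *> (1 : L) = v.
Proof. exact: scale1r. Qed.
Lemma ractNr (V : lmodType L^c) (v : V) k : v *> (- k) = - (v *> k).
Proof. exact: scaleNr. Qed.
Lemma ractNl (V : lmodType L^c) (v : V) k : (- v) *> k = - (v *> k).
Proof. exact: scalerN. Qed.
Lemma ractMzl (V : lmodType L^c) (v : V) (z : int) k : (v *~ z) *> k = (v *> k) *~ z.
Proof. exact: (raddfMz (mkadd (raddfB ( *:%R (k : L^c))))). Qed.

Lemma ractBr (V : lmodType L^c) (v : V) (k l : L) : v *> (k - l) = v *> k - v *> l.
Proof. by rewrite ractDr ractNr. Qed.

Lemma ract1Mz (V : lmodType L^c) (v : V) (z : int) : v *> (1 *~ z : L) = v *~ z.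
Proof.
have rB : zmod_morphism (fun l : L => v *> l) by move=> x y; exact: ractBr.
by apply: etrans (morph_Mz rB 1 z) _; rewrite ract1r.
Qed.

End RegularModule.

Section SubmoduleValues.
Variables (R : pzRingType) (V : lmodType R) (T : submodule V).

Lemma submod_valZ (c : R) (x : T) : val (c *: x) = c *: val x.
Proof. by []. Qed.

Lemma submod_valD (x y : T) : val (x + y) = val x + val y.
Proof. by []. Qed.

Lemma submod_val_linear : linear (val : T -> V).
Proof. by []. Qed.

Definition submod_incl : {linear T -> V} := mklin submod_val_linear.

Lemma submod_incl_inj : injective submod_incl.
Proof. exact: val_inj. Qed.

End SubmoduleValues.

Section NaturalSubmodules.
Variable R : pzRingType.

(** A subfunctor of the identity of the category of modules: such a functor
    preserves isomorphisms and finite direct sums. *)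
Record subfunctor := Subfunctor {
  subf :> forall V : lmodType R, submodule V;
  subf_nat : forall (U V : lmodType R) (f : {linear U -> V}) x,
    x \in submod_pred (subf U) -> f x \in submod_pred (subf V)
}.

Variable S : subfunctor.
Implicit Types U V : lmodType R.

Lemma subf_iso U V : lmod_iso U V -> lmod_iso (S U) (S V).
Proof.
move=> [f [g fg gf]].
have gl : linear g.
  by move=> c x y; apply: (can_inj fg); rewrite gf linearP !gf.
apply: (@lmod_iso_fun _ _ _
  (fun x : S U => (SubmodType (subf_nat f (valP x)) : S V))).
- by move=> c x y; apply: val_inj; rewrite /= linearP.
- by move=> x y /(congr1 val) /= /(can_inj fg) /val_inj.
- move=> y; exists (SubmodType (subf_nat (mklin gl) (valP y)) : S U).
  by apply: val_inj; rewrite /= gf.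
Qed.

Lemma fst_linear U V : linear (fst : U * V -> U). Proof. by []. Qed.
Lemma snd_linear U V : linear (snd : U * V -> V). Proof. by []. Qed.
Lemma inl_linear U V : linear (fun x : U => (x, 0) : U * V).
Proof. by move=> c x y; congr pair; rewrite /= scaler0 addr0. Qed.
Lemma inr_linear U V : linear (fun x : V => (0, x) : U * V).
Proof. by move=> c x y; congr pair; rewrite /= scaler0 addr0. Qed.

Lemma subf_prodE U V (x : U * V) :
  (x \in submod_pred (S (U * V)%type)) =
  (x.1 \in submod_pred (S U)) && (x.2 \in submod_pred (S V)).
Proof.
apply/idP/andP => [xS|[xU xV]].
  split; first exact: (subf_nat (mklin (@fst_linear U V)) xS).
  exact: (subf_nat (mklin (@snd_linear U V)) xS).
have := submod_predP (S (U * V)%type); case=> _ cl.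
have -> : x = 1 *: mklin (@inl_linear U V) x.1 + mklin (@inr_linear U V) x.2.
  rewrite scale1r /=; case: x {xU xV} => u v.
  by congr pair; rewrite /= ?addr0 ?add0r.
by apply: cl; apply: subf_nat.
Qed.

Lemma subf_prod U V : lmod_iso (S (U * V)%type) (S U * S V)%type.
Proof.
apply: lmod_iso_sym.
have cl (x : S U * S V) : (val x.1, val x.2) \in submod_pred (S (U * V)%type).
  by rewrite subf_prodE !(valP x.1, valP x.2).
apply: (@lmod_iso_fun _ _ _ (fun x => (SubmodType (cl x) : S (U * V)%type))).
- by move=> c x y; apply: val_inj.
- by move=> [x y] [x' y'] /(congr1 val) [/val_inj -> /val_inj ->].
- move=> x; have := valP x; rewrite /= subf_prodE => /andP[xU xV].
  exists (SubmodType xU : S U, SubmodType xV : S V); apply: val_inj => /=.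
  by case: (submod_val x).
Qed.

End NaturalSubmodules.

(** * Cancellation of a summand *)

Section Cancellation.
Variable L : nzRingType.

(** Stable range one of all the quotients L / N L. *)
Definition sr1_mod : Prop := forall (N : nat) (a x b : L),
  (1 < N)%N -> a * x + b = 1 -> exists y u w, (a + b * y) * u = 1 + w *+ N.
(** Elements congruent to 1 modulo an integer divide some integer. *)
Definition cong1_dvd_int : Prop := forall (m : nat) (z w : L), (1 < m)%N ->
  z = 1 + w *+ m -> exists N t, (1 < N)%N /\ z * t = N%:R.

Hypotheses (sr1 : sr1_mod) (dvd_int : cong1_dvd_int).
Variables G Z : lmodType L^c.

(* every endomorphism of G is the action of an element of L *)
Variable act : L -> G -> G.
Hypothesis act_lin : forall l, linear (act l).
Hypothesis actD : forall l k x, act (l + k) x = act l x + act k x.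
Hypothesis actM : forall l k x, act (l * k) x = act l (act k x).
Hypothesis act1 : forall x, act 1 x = x.
Hypothesis act_surj : forall f : {linear G -> G}, exists l, forall x, f x = act l x.

(* multiplication by m factors through Z *)
Variables (i : {linear Z -> G}) (j : {linear G -> Z}) (m : nat).
Hypotheses (m_gt1 : (1 < m)%N) (ijE : forall x, i (j x) = x *+ m).

Local Notation W := (G * G * Z)%type.
Definition actL l : {linear G -> G} := mklin (act_lin l).

(** The homomorphism from G + G + Z to G with components l, u and c. *)
Definition row (l u : L) (c : Z -> G) (w : W) : G :=
  act l w.1.1 + act u w.1.2 + c w.2.

Definition kernel_is_GZ (phi : W -> G) : Prop :=
  exists f : {linear (G * Z)%type -> W}, injective f /\
    forall w, phi w = 0 <-> exists x, f x = w.

Lemma act0 x : act 0 x = 0.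
Proof. by apply/eqP; have := actD 0 0 x; rewrite addr0 => /eqP; rewrite -subr_eq subrr eq_sym. Qed.

Lemma actN l x : act (- l) x = - act l x.
Proof. by apply/eqP; rewrite -addr_eq0 -actD addNr act0. Qed.

Lemma actMn l k x : act (l *+ k) x = act l x *+ k.
Proof. by elim: k => [|k IH]; rewrite ?mulr0n ?act0 // !mulrS actD IH. Qed.

Lemma actDr l x y : act l (x + y) = act l x + act l y.
Proof. exact: (linearD (actL l)). Qed.
Lemma actr0 l : act l 0 = 0.
Proof. exact: (linear0 (actL l)). Qed.

(** Composing with an automorphism th of G + G + Z moves the kernel, so that
    unimodular rows may be simplified by column operations. *)
Lemma kernel_aut (phi psi : W -> G) (th th' : W -> W) :
  linear th -> cancel th th' -> cancel th' th ->
  (forall w, psi w = phi (th w)) -> kernel_is_GZ psi -> kernel_is_GZ phi.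
Proof.
move=> lth thK thK' eq [f [finj fP]].
exists (mklin (linearP (mklin lth \o f))); split.
  by move=> x y /= /(can_inj thK) /finj.
move=> w; rewrite -{1}(thK' w) -eq fP; split=> [[x xE]|[x xE]]; exists x => /=.
  by rewrite xE thK'.
by rewrite -xE thK.
Qed.

Lemma row_op1 l u c l' (x : L) (y : {linear G -> Z}) : linear c ->
  (forall g, act l' g = act l g + act u (act x g) + c (y g)) ->
  kernel_is_GZ (row l' u c) -> kernel_is_GZ (row l u c).
Proof.
move=> lc eq; pose c' := mklin lc.
have cD z z' : c (z + z') = c z + c z' by exact: (linearD c').
apply: (@kernel_aut _ _ (fun w => (w.1.1, w.1.2 + act x w.1.1, w.2 + y w.1.1))
                        (fun w => (w.1.1, w.1.2 - act x w.1.1, w.2 - y w.1.1))).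
- move=> k w w'; congr (_, _, _); rewrite /= ?linearP ?act_lin ?scalerDr addrACA //.
- by move=> [[g h] z]; rewrite /= !addrK.
- by move=> [[g h] z]; rewrite /= !subrK.
- move=> [[g h] z]; rewrite /row /= eq actDr cD.
  by rewrite [act u h + _]addrC [c z + _]addrC !addrA; congr (_ + _); rewrite addrAC.
Qed.

Lemma row_op2 l u c u' (x : L) (y : {linear G -> Z}) : linear c ->
  (forall g, act u' g = act u g + act l (act x g) + c (y g)) ->
  kernel_is_GZ (row l u' c) -> kernel_is_GZ (row l u c).
Proof.
move=> lc eq; pose c' := mklin lc.
have cD z z' : c (z + z') = c z + c z' by exact: (linearD c').
apply: (@kernel_aut _ _ (fun w => (w.1.1 + act x w.1.2, w.1.2, w.2 + y w.1.2))
                        (fun w => (w.1.1 - act x w.1.2, w.1.2, w.2 - y w.1.2))).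
- move=> k w w'; congr (_, _, _); rewrite /= ?linearP ?act_lin ?scalerDr addrACA //.
- by move=> [[g h] z]; rewrite /= !addrK.
- by move=> [[g h] z]; rewrite /= !subrK.
- move=> [[g h] z]; rewrite /row /= eq actDr cD.
  rewrite [c z + _]addrC !addrA; congr (_ + _ + _).
  exact: addrAC.
Qed.

Lemma row_op3 l u c c' (x y : {linear Z -> G}) :
  (forall z, c' z = c z + act l (x z) + act u (y z)) ->
  kernel_is_GZ (row l u c') -> kernel_is_GZ (row l u c).
Proof.
move=> eq.
apply: (@kernel_aut _ _ (fun w => (w.1.1 + x w.2, w.1.2 + y w.2, w.2))
                        (fun w => (w.1.1 - x w.2, w.1.2 - y w.2, w.2))).
- move=> k w w'; congr (_, _, _); rewrite /= ?linearP ?scalerDr addrACA //.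
- by move=> [[g h] z]; rewrite /= !addrK.
- by move=> [[g h] z]; rewrite /= !subrK.
- move=> [[g h] z]; rewrite /row /= eq !actDr.
  rewrite -[c z + _ + _]addrA [c z + _]addrC addrA; congr (_ + c z).
  exact: addrACA.
Qed.

Lemma kernel_row1 u c : linear c -> kernel_is_GZ (row 1 u c).
Proof.
move=> lc; pose c' := mklin lc.
have lf : linear (fun x : G * Z => (- (act u x.1 + c x.2), x.1, x.2) : W).
  move=> k x y; congr (_, _, _) => /=.
  by rewrite act_lin lc addrACA -scalerDr opprD scalerN.
exists (mklin lf); split; first by move=> [g z] [g' z'] [_ -> ->].
move=> [[g h] z]; rewrite /row /= act1; split.
  by move=> /eqP; rewrite -addrA addr_eq0 => /eqP ->; exists (h, z).
by case=> [[h' z'] [<- -> ->]]; rewrite -addrA addNr.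
Qed.

(** Column operations turn a unimodular row (l, u, c) into (1, u, i), whose
    kernel is visibly G + Z.  Stable range one modulo m makes l invertible
    modulo m, so that l divides an integer N; stable range one modulo N then
    makes u invertible modulo N, hence modulo the right ideal of l.  So the pair
    (l, u) alone is unimodular, and both entries may be taken congruent to 1
    modulo m; this allows c to be replaced by i, and the multiples of m in
    l - 1 are finally absorbed by i, since i j = m. *)
Lemma kernel_unimodular_row l u c (s1 s2 : L) (s3 : {linear G -> Z}) : linear c ->
  (forall g, act l (act s1 g) + act u (act s2 g) + c (s3 g) = g) ->
  kernel_is_GZ (row l u c).
Proof.
move=> lc uni; pose c' := mklin lc.
have cD z z' : c (z + z') = c z + c z' by exact: (linearD c').
have cN z : c (- z) = - c z by exact: (linearN c').
have zlin : linear (fun _ : G => 0 : Z) by move=> k x y; rewrite scaler0 addr0.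
have c0 : c 0 = 0 by exact: (linear0 c').
(* make l invertible modulo m *)
have [y [v [w l1v]]] : exists y v w, (l + (1 - l * s1) * y) * v = 1 + w *+ m.
  by apply: (@sr1 m l s1 (1 - l * s1)) => //; rewrite addrC subrK.
set b := 1 - l * s1 in l1v; set l1 := l + b * y in l1v.
have bE g : act b g = act u (act s2 g) + c (s3 g).
  rewrite /b actD actN act1 actM; apply/eqP; rewrite subr_eq; apply/eqP.
  by rewrite -{1}(uni g) -addrA addrC.
have bs : b = 1 - l * s1 by [].
clearbody b.
have l1E : l1 = l + b * y by [].
clearbody l1.
apply: (@row_op1 _ _ _ l1 (s2 * y) (mklin (linearP (s3 \o actL y)))) => //.
    by move=> g; rewrite l1E actD !actM bE /= addrA.
have [N [t [N1 tN]]] := dvd_int m_gt1 l1v.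
(* make u invertible modulo the integer N, a multiple of l *)
pose r := 1 - y * s1.
have uni1 g : act l1 (act s1 g) + act u (act s2 (act r g)) + c (s3 (act r g)) = g.
  have := bE (act r g); rewrite -addrA => <-; rewrite -!actM -actD.
  have -> : l1 * s1 + b * r = 1.
    by rewrite /r l1E mulrDl mulrBr mulr1 -mulrA addrA addrAC addrK bs addrC subrK.
  exact: act1.
have [y2 [u2 [w2 u1u2]]] :
    exists y v w, (u + (1 - u * (s2 * r)) * y) * v = 1 + w *+ N.
  by apply: (@sr1 N u (s2 * r) _) => //; rewrite addrC subrK.
set b2 := 1 - _ in u1u2; set u1 := u + b2 * y2 in u1u2.
have b2E g : act b2 g = act l1 (act s1 g) + c (s3 (act r g)).
  rewrite /b2 actD actN act1 !actM; apply/eqP; rewrite subr_eq; apply/eqP.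
  by rewrite -{1}(uni1 g) addrAC.
have b2s : b2 = 1 - u * (s2 * r) by [].
clearbody b2.
have u1E : u1 = u + b2 * y2 by [].
clearbody u1.
apply: (@row_op2 _ _ _ u1 (s1 * y2) (mklin (linearP (s3 \o actL (r * y2))))) => //.
  by move=> g; rewrite u1E actD !actM b2E /= !actM addrA.
(* make (l, u) congruent to (1, 1) modulo m *)
pose u3 := u1 + l1 * (v * (1 - u1)).
have u3E : u3 = 1 + (w * (1 - u1)) *+ m.
  by rewrite /u3 mulrA l1v mulrDl mul1r mulrnAl addrA [u1 + (1 - _)]addrC subrK.
apply: (@row_op2 _ _ _ u3 (v * (1 - u1)) (mklin zlin)) => //.
  by move=> g; rewrite /u3 actD !actM /= c0 addr0.
pose l3 := l1 + u3 * (1 - l1).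
have l3E : l3 = 1 + (w * (1 - u1) * (1 - l1)) *+ m.
  by rewrite /l3 u3E mulrDl mul1r mulrnAl addrA [l1 + (1 - _)]addrC subrK.
apply: (@row_op1 _ _ _ l3 (1 - l1) (mklin zlin)) => //.
  by move=> g; rewrite /l3 actD !actM /= c0 addr0.
(* the pair (l, u) alone is unimodular, so c may be replaced by i *)
have [p [q pq]] : exists p q, l3 * p + u3 * q = 1.
  have e1 : l1 * (- (v * t * w2)) + u1 * u2 = 1.
    by rewrite u1u2 mulrN !mulrA tN mulr_natl addrC addrK.
  pose p := - (v * t * w2) - v * (1 - u1) * u2.
  have e2 : l1 * p + u3 * u2 = 1.
    rewrite /p /u3 mulrBr mulrDl -(mulrA l1 _ u2).
    by rewrite [u1 * u2 + _]addrC addrA subrK.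
  exists p, (u2 - (1 - l1) * p).
  rewrite /l3 [u3 * (u2 - _)]mulrBr mulrDl -(mulrA u3 _ p) -[RHS]e2 -addrA; congr (_ + _).
  by rewrite addrC subrK.
pose d (z : Z) := i z - c z.
have ld : linear d.
  by move=> k x z; rewrite /d linearP lc scalerBr opprD addrACA.
apply: (@row_op3 _ _ _ i (mklin (linearP (actL p \o mklin ld)))
                         (mklin (linearP (actL q \o mklin ld)))).
  move=> z; rewrite /= -addrA -!actM -actD pq act1 /d addrC subrK //.
(* finally i j = m clears l - 1 *)
pose x := - (w * (1 - u1) * (1 - l1)).
apply: (@row_op1 _ _ _ 1 0 (mklin (linearP (j \o actL x)))) => //.
- exact: linearP.
- move=> g; rewrite /= ijE act0 actr0 addr0 -actMn -actD l3E /x mulNrn addrK //.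
- by apply: kernel_row1; exact: linearP.
Qed.

(** Cancellation of G from K + G = G + Z + G, when some multiple of the identity
    of G factors through Z: the projection of the right hand side onto the
    summand G of the left hand side is a unimodular row, with kernel K. *)
Theorem cancel_summand (K : lmodType L^c) :
  lmod_iso (K * G)%type (G * Z * G)%type -> lmod_iso K (G * Z)%type.
Proof.
move=> [psi psib]; have [psi' psiK psiK'] := psib.
have lpsi' : linear psi'.
  by move=> c x y; apply: (can_inj psiK); rewrite psiK' linearP !psiK'.
pose Psi' := mklin lpsi'.
pose sg (w : W) : G * Z * G := (w.1.2, w.2, w.1.1).
pose sg' (w : G * Z * G) : W := (w.2, w.1.1, w.1.2).
have lsg : linear sg by [].
have lsg' : linear sg' by [].
have sgK : cancel sg' sg by move=> [[]].
have sgK' : cancel sg sg' by move=> [[]].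
pose Sg := mklin lsg; pose Sg' := mklin lsg'.
pose phi := mklin (linearP (mklin (@snd_linear _ K G) \o (Psi' \o Sg))).
have l1 : linear (fun g : G => (g, 0, 0) : W).
  by move=> k g h; congr (_, _, _); rewrite /= scaler0 addr0.
have l2 : linear (fun g : G => (0, g, 0) : W).
  by move=> k g h; congr (_, _, _); rewrite /= scaler0 addr0.
have l3 : linear (fun z : Z => (0, 0, z) : W).
  by move=> k g h; congr (_, _, _); rewrite /= scaler0 addr0.
have [l lE] := act_surj (mklin (linearP (phi \o mklin l1))).
have [u uE] := act_surj (mklin (linearP (phi \o mklin l2))).
pose c := mklin (linearP (phi \o mklin l3)).
have phiE w : phi w = row l u c w.
  case: w => [[g h] z]; rewrite /row -lE -uE [(g, h, z).1.1]/= [_.1.2]/= [_.2]/=.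
  have -> : (g, h, z) = mklin l1 g + mklin l2 h + mklin l3 z.
    by congr (_, _, _); rewrite /= ?addr0 ?add0r.
  by rewrite !(linearD phi).
pose s := mklin (linearP (Sg' \o (psi \o mklin (@inr_linear _ K G)))).
have phis g : phi (s g) = g by rewrite /= sgK psiK.
have p1 : linear (fun w : W => w.1.1) by [].
have p2 : linear (fun w : W => w.1.2) by [].
have p3 : linear (fun w : W => w.2) by [].
have [s1 s1E] := act_surj (mklin (linearP (mklin p1 \o s))).
have [s2 s2E] := act_surj (mklin (linearP (mklin p2 \o s))).
have [f [finj fP]] : kernel_is_GZ (row l u c).
  apply: (@kernel_unimodular_row _ _ _ s1 s2 (mklin (linearP (mklin p3 \o s)))).
    exact: linearP.
  by move=> g; rewrite -s1E -s2E -[RHS](phis g) phiE.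
apply: (@same_image_iso _ _ _ W
  (mklin (linearP (Sg' \o (psi \o mklin (@inl_linear _ K G))))) f) => //.
- by move=> x y /= /(can_inj sgK) /(can_inj psiK) [].
- move=> w; rewrite -fP -phiE /=; split=> [[k <-]|w0].
    by rewrite sgK psiK.
  exists (psi' (sg w)).1; apply: (can_inj sgK'); rewrite sgK.
  by apply: (can_inj psiK'); rewrite psiK [RHS]surjective_pairing w0.
Qed.

End Cancellation.

(** * Ranks of stably isomorphic modules *)

Section Rank.
Implicit Types A B : zmodType.

Lemma zfree_embed A B (f : {additive A -> B}) k (v : 'I_k -> A) :
  injective f -> zfree v -> zfree (f \o v).
Proof.
move=> finj fr c; under eq_bigr do rewrite /= -raddfMz.
by rewrite -raddf_sum -(raddf0 f) => /finj /fr.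
Qed.

Lemma zfree_sub A k (v : 'I_k.+1 -> A) : zfree v -> exists u : 'I_k -> A, zfree u.
Proof.
move=> fr; exists (fun i => v (lift ord0 i)) => c c0 i.
pose d (i : 'I_k.+1) := if unlift ord0 i is Some j then c j else 0.
have := fr d; rewrite big_ord_recl /d unlift_none mulr0z add0r.
under eq_bigr do rewrite liftK.
by move=> /(_ c0 (lift ord0 i)); rewrite liftK.
Qed.

Lemma zfree_le A k l (v : 'I_k -> A) : (l <= k)%N -> zfree v ->
  exists u : 'I_l -> A, zfree u.
Proof.
elim: k v => [|k IH] v; first by rewrite leqn0 => /eqP ->; exists v.
rewrite leq_eqVlt => /orP[/eqP ->|]; first by exists v.
by rewrite ltnS => le /zfree_sub[u /IH]; apply.
Qed.

Lemma has_zrank_uniq A k l : has_zrank A k -> has_zrank A l -> k = l.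
Proof.
move=> [[v vf] nk] [[u uf] nl]; apply/eqP; rewrite eqn_leq.
apply/andP; split; rewrite leqNgt; apply/negP => lt.
  by apply: nl; apply: zfree_le lt vf.
by apply: nk; apply: zfree_le lt uf.
Qed.

Lemma has_zrank_iso A B k : zmod_iso A B -> has_zrank A k -> has_zrank B k.
Proof.
move=> [f [g fg gf]] [[v vf] nk]; split.
  by exists (f \o v); apply: zfree_embed vf; apply: can_inj fg.
have ga : zmod_morphism g.
  by move=> x y; apply: (can_inj fg); rewrite raddfB !gf.
case=> u uf; apply: nk.
pose g' : {additive B -> A} := HB.pack g (GRing.isZmodMorphism.Build B A g ga).
by exists (g' \o u); apply: zfree_embed uf; apply: can_inj gf.
Qed.

(** An independent family of length k + 2 in A + Z gives one of length k + 1 in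
    A: eliminate the second coordinate with a member p where it is nonzero. *)
Lemma has_zrank_prod_int A k : has_zrank A k -> has_zrank (A * int)%type k.+1.
Proof.
move=> [[v vf] nk].
have sum1 m (u : 'I_m -> A * int) (c : 'I_m -> int) :
    (\sum_i u i *~ c i).1 = \sum_i (u i).1 *~ c i.
  by rewrite (raddf_sum fst); apply: eq_bigr => i _; exact: (raddfMz fst).
have sum2 m (u : 'I_m -> A * int) (c : 'I_m -> int) :
    (\sum_i u i *~ c i).2 = \sum_i (u i).2 * c i.
  rewrite (raddf_sum snd); apply: eq_bigr => i _.
  by rewrite [LHS](raddfMz snd) mulrzz.
split.
  exists (fun i => if unlift ord0 i is Some j then (v j, 0) else (0, 1)).
  move=> c c0.
  have c00 : c ord0 = 0.
    have := congr1 snd c0; rewrite sum2 big_ord_recl unlift_none /= mul1r.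
    by rewrite big1 ?addr0 // => i _; rewrite liftK mul0r.
  have := congr1 fst c0; rewrite sum1 big_ord_recl unlift_none /= mul0rz add0r.
  under eq_bigr do rewrite liftK /=.
  move=> /vf cl i; case: (unliftP ord0 i) => [j ->|-> //]; exact: cl.
move=> [u uf]; apply: nk.
case: (pselect (exists p, (u p).2 <> 0)) => [[p zp]|nz].
  exists (fun j => (u (lift p j)).1 *~ (u p).2 - (u p).1 *~ (u (lift p j)).2).
  move=> c c0 j.
  pose d (i : 'I_k.+2) := if unlift p i is Some j then (u p).2 * c j
    else - \sum_j (u (lift p j)).2 * c j.
  have dl j' : d (lift p j') = (u p).2 * c j' by rewrite /d liftK.
  have dp : d p = - \sum_j (u (lift p j)).2 * c j by rewrite /d unlift_none.
  suff d0 : \sum_i u i *~ d i = 0.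
    by have /eqP := uf d d0 (lift p j); rewrite dl mulf_eq0 => /orP[/eqP //|/eqP].
  apply/eqP; rewrite -pair_eqE /= sum1 sum2 !(bigD1_ord p) //= dp.
  apply/andP; split; apply/eqP.
    rewrite -[RHS]c0 mulrNz addrC.
    rewrite [X in _ - X](_ : _ = \sum_j0 (u p).1 *~ ((u (lift p j0)).2 * c j0)).
      rewrite -sumrB; apply: eq_bigr => j' _.
      by rewrite dl mulrzBl !mulrzA.
    elim/big_rec2: _ => [|j' x y _ <-]; first by rewrite mulr0z.
    by rewrite mulrzDr.
  rewrite mulrN mulr_sumr addrC -sumrB big1 // => j' _.
  by rewrite dl mulrCA mulrA subrr.
have nz' p : (u p).2 = 0 by apply: contrapT => h; apply: nz; exists p.
have fr : zfree (fun i => (u i).1).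
  move=> c c0; apply: uf; apply/eqP; rewrite -pair_eqE /= sum1 sum2 c0 eqxx /=.
  by rewrite big1 // => i _; rewrite nz' mul0r.
exact: zfree_sub fr.
Qed.

Lemma has_zrank_prod_row A k m : has_zrank A k -> has_zrank (A * 'rV[int]_m)%type (k + m)%N.
Proof.
move=> rk; elim: m => [|m IH].
  by rewrite addn0; apply: has_zrank_iso rk; apply: zmod_iso_row0.
have := has_zrank_prod_int IH; rewrite addnS; apply: has_zrank_iso.
by apply: zmod_iso_sym; apply: zmod_iso_rowS.
Qed.

Lemma has_zrank_prod_zgring A (gT : finGroupType) k r : has_zrank A k ->
  has_zrank (A * 'rV[zgring gT]_r)%type (k + r * #|gT|)%N.
Proof.
move=> rk; elim: r => [|r IH].
  by rewrite addn0; apply: has_zrank_iso rk; apply: zmod_iso_row0.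
have := has_zrank_prod_row #|gT| IH; rewrite -addnA -mulSnr.
apply: has_zrank_iso; apply: zmod_iso_sym.
apply: zmod_iso_trans (zmod_iso_rowS _ _ _) _.
apply: zmod_iso_prod; first exact: zmod_iso_refl.
apply: (@zmod_iso_fun _ _ (fun u : zgring gT => \row_i u (enum_val i))).
- by move=> u v; apply/rowP => i; rewrite !mxE zgDE zgNE.
- move=> u v /rowP eq; apply/ffunP => g.
  by have := eq (enum_rank g); rewrite !mxE enum_rankK.
- move=> w; exists [ffun g => w 0 (enum_rank g)].
  by apply/rowP => i; rewrite mxE ffunE enum_valK.
Qed.

(** Comparing ranks: each free summand contributes the order of the group. *)
Lemma stable_rank_eq (gT : finGroupType) (U V : lmodType (zgring gT)^c) r s :
  same_zrank U V ->
  lmod_iso (U * 'rV[(zgring gT)^c]_r)%type (V * 'rV[(zgring gT)^c]_s)%type ->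
  r = s.
Proof.
move=> [k [ku kv]] /lmod_iso_zmod iso.
have := has_zrank_uniq (has_zrank_iso iso (@has_zrank_prod_zgring U gT k r ku))
                       (@has_zrank_prod_zgring V gT k s kv).
move=> /addnI /eqP; rewrite eqn_pmul2r; first by move/eqP.
by apply/card_gt0P; exists 1%g.
Qed.

End Rank.

(** * The annihilator of the sum of the rotations *)

(** The properties of the group ring of the dihedral group of order 2m on which
    the module theory below rests; s stands for the sum of the rotations.  The
    elements killed by s are the multiples of a - 1, and among them those
    antifixed by a reflection t are the (1 - t) v with v killed by s.  The ring
    is kept abstract so that unification never unfolds its elements. *)
Record dihedral_ring (L : nzRingType) (a b s : L) (m : nat) : Prop := DihedralRing {
  dr_m : (1 < m)%N;
  dr_sC : forall x : L, x * s = s * x;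
  dr_bb : b * b = 1;
  dr_aba : a * b * a = b;
  dr_as : (a - 1) * s = 0;
  dr_ss : s * s = s *+ m;
  dr_s0l : forall x : L, x * s = 0 -> exists y, x = (a - 1) * y;
  dr_s0r : forall x : L, x * s = 0 -> exists y, x = y * (a - 1);
  dr_antib : forall x : L, (1 + b) * x = 0 -> x * s = 0 ->
    exists v, x = (1 - b) * v /\ v * s = 0;
  dr_antiba : forall x : L, (1 + b * a) * x = 0 -> x * s = 0 ->
    exists v, x = (1 - b * a) * v /\ v * s = 0;
  dr_sr1 : sr1_mod L;
  dr_dvd : cong1_dvd_int L
}.

Section RingIdentities.
Variables (L : nzRingType) (a b : L).

Lemma sqr_flip_mul : b * b = 1 -> a * b * a = b -> (b * a) * (b * a) = 1.
Proof. by move=> bb aba; rewrite mulrA -(mulrA b) -mulrA aba bb. Qed.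

Lemma antifixed_mul (t x : L) : t * t = 1 -> (1 + t) * ((1 - t) * x) = 0.
Proof.
move=> tt; rewrite mulrA mulrDl !mulrBr !mul1r mulr1 tt.
by rewrite addrA subrK subrr mul0r.
Qed.

Lemma flip_decomposition (y : L) :
  (1 - b) * (a * y) + (1 - b * a) * (- y) = (a - 1) * y.
Proof.
rewrite mulrN mulrA -mulrBl; congr (_ * y).
by rewrite mulrBl mul1r opprB addrA subrK.
Qed.

Lemma decomposition_mul (p q u v s k : L) m :
  p * u + q * v = m%:R - s -> s * k = 0 -> p * (u * k) + q * (v * k) = k *+ m.
Proof.
by move=> e sk; rewrite !mulrA -mulrDl e mulrBl sk subr0 mulr_natl.
Qed.

End RingIdentities.

Section Annihilator.
Variables (L : nzRingType) (s : L).
Hypothesis sC : forall x : L, x * s = s * x.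
Local Notation R := (L^c).

Lemma rmulS_linear (V : lmodType R) : linear (fun x : V => x *> s).
Proof.
move=> c x y; rewrite ractDl; congr (_ + _).
by rewrite -[c *: x]/(x *> c) -[RHS]/(x *> s *> c) !ractA sC.
Qed.

Definition rmulS (V : lmodType R) : {linear V -> V} := mklin (@rmulS_linear V).

Lemma annS_nat (U V : lmodType R) (f : {linear U -> V}) x :
  x \in submod_pred (kernel (rmulS U)) -> f x \in submod_pred (kernel (rmulS V)).
Proof. by rewrite !inE /= -lin_ract => /eqP ->; rewrite linear0. Qed.

Definition annS : subfunctor R := Subfunctor annS_nat.

Lemma annSE (V : lmodType R) (x : V) : (x \in submod_pred (annS V)) = (x *> s == 0).
Proof. by rewrite inE. Qed.

Lemma annS_val (V : lmodType R) (x : annS V) : val x *> s = 0.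
Proof. by apply/eqP; rewrite -annSE; apply: valP. Qed.

Lemma mem_annS (V : lmodType R) (x : V) : x *> s = 0 -> exists y : annS V, val y = x.
Proof.
move=> xs; have xS : x \in submod_pred (annS V) by rewrite annSE xs.
by exists (SubmodType xS).
Qed.

Lemma annS_submodule_iso (V W : lmodType R) (T : submodule V) (g : {linear W -> V}) :
  injective g ->
  (forall v, (exists x, g x = v) <-> v \in submod_pred T /\ v *> s = 0) ->
  lmod_iso (annS T) W.
Proof.
move=> ginj gP.
pose f := mklin (linearP (submod_incl T \o submod_incl (annS T))).
apply: (@same_image_iso _ _ _ _ f g) => //.
  by move=> x y h; apply/submod_incl_inj/submod_incl_inj/h.
move=> v; apply: iff_trans (iff_sym (gP v)); split=> [[x <-]|[vT vs]].
  split; first exact: (valP (submod_incl _ x)).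
  rewrite -lin_ract; have -> : x *> s = 0 by apply: val_inj; exact: annS_val.
  exact: linear0.
pose z : T := SubmodType vT.
have zs : z *> s = 0 by apply: (@submod_incl_inj _ _ T); rewrite lin_ract linear0.
by have [y yE] := mem_annS zs; exists y; rewrite /= yE.
Qed.

Notation Gam := (annS (R^o)).

Lemma Gam_val (x : Gam) : (val x : L) * s = 0.
Proof. exact: (annS_val x). Qed.

Lemma lmul_annS (l : L) (x : Gam) : lmul l (val x) \in submod_pred Gam.
Proof. by rewrite annSE -lin_ract annS_val linear0. Qed.

Definition lact (l : L) (x : Gam) : Gam := SubmodType (lmul_annS l x).

Lemma val_lact l x : val (lact l x) = lmul l (val x).
Proof. by []. Qed.

Lemma lact_linear l : linear (lact l).
Proof.
move=> c x y; apply: val_inj.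
by rewrite submod_valD submod_valZ !val_lact submod_valD submod_valZ linearP.
Qed.

Lemma lactD l k x : lact (l + k) x = lact l x + lact k x.
Proof. by apply: val_inj; rewrite submod_valD !val_lact !lmulE mulrDl. Qed.
Lemma lactM l k x : lact (l * k) x = lact l (lact k x).
Proof. by apply: val_inj; rewrite !val_lact !lmulE -mulrA. Qed.
Lemma lact1 x : lact 1 x = x.
Proof. by apply: val_inj; rewrite val_lact lmulE mul1r. Qed.

Lemma antifixed_closed (t : L) :
  submod_closed [pred x : R^o | ((x : L) * s == 0) && ((1 + t) * (x : L) == 0)].
Proof.
split=> [|c x y]; rewrite !inE; first by rewrite mul0r mulr0 eqxx.
move=> /andP[/eqP xS /eqP xt] /andP[/eqP yS /eqP yt].
rewrite -[c *: x]/((x : L) * c) mulrDl -mulrA (sC c) mulrA xS mul0r yS.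
by rewrite mulrDr mulrA xt mul0r yt addr0 eqxx.
Qed.

(** The elements of Gam antifixed by left multiplication by t. *)
Definition antifixed (t : L) : submodule (R^o) := Submodule (antifixed_closed t).

Lemma antifixedP (t : L) (x : antifixed t) :
  (val x : L) * s = 0 /\ (1 + t) * (val x : L) = 0.
Proof. by have := valP x; rewrite inE => /andP[/eqP -> /eqP ->]. Qed.

Lemma mem_antifixed (t x : L) : x * s = 0 -> (1 + t) * x = 0 ->
  exists y : antifixed t, val y = x.
Proof.
move=> xs xt; have xS : (x : R^o) \in submod_pred (antifixed t).
  by rewrite inE xs xt eqxx.
by exists (SubmodType xS).
Qed.

Lemma antifixed_annS (t : L) (x : antifixed t) : val x \in submod_pred Gam.
Proof. by rewrite annSE regular_ract (antifixedP x).1. Qed.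

Definition antifixed_incl (t : L) (x : antifixed t) : Gam :=
  SubmodType (antifixed_annS x).

Lemma val_antifixed_incl t (x : antifixed t) : val (antifixed_incl x) = val x.
Proof. by []. Qed.

Lemma antifixed_incl_linear t : linear (@antifixed_incl t).
Proof.
move=> c x y; apply: val_inj.
by rewrite submod_valD submod_valZ !val_antifixed_incl submod_valD submod_valZ.
Qed.

Section Antifix.
Variables (t : L) (tt : t * t = 1) (l : L).

Lemma antifix_mem (x : Gam) :
  lmul (1 - t) (lmul l (val x)) \in submod_pred (antifixed t).
Proof.
rewrite inE; apply/andP; split; apply/eqP; last exact: antifixed_mul.
by rewrite !lmulE -!mulrA Gam_val !mulr0.
Qed.

Definition antifix (x : Gam) : antifixed t := SubmodType (antifix_mem x).

Lemma val_antifix x : val (antifix x) = lmul (1 - t) (lmul l (val x)).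
Proof. by []. Qed.

Lemma antifix_linear : linear antifix.
Proof.
move=> c x y; apply: val_inj.
by rewrite submod_valD submod_valZ !val_antifix submod_valD submod_valZ !linearP.
Qed.

End Antifix.
End Annihilator.

Section KernelPart.
Variables (L : nzRingType) (a b s : L) (m : nat).
Hypothesis dr : dihedral_ring a b s m.
Local Notation R := (L^c).
Local Notation sC := (dr_sC dr).
Local Notation Gam := (annS sC (R^o)).
Local Notation P := (antifixed sC b).
Local Notation P' := (antifixed sC (b * a)).

Lemma dr_cc : (b * a) * (b * a) = 1.
Proof. exact: sqr_flip_mul (dr_bb dr) (dr_aba dr). Qed.

(** Gam is the cyclic module generated by a - 1, and it is also the left ideal
    generated by a - 1. *)
Lemma lact_surj (f : {linear Gam -> Gam}) : exists l, forall x, f x = lact l x.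
Proof.
have [d dE] : exists d : Gam, val d = a - 1.
  by apply: mem_annS; rewrite regular_ract; exact: (dr_as dr).
have [l lE] : exists l, val (f d) = l * (a - 1) :> L.
  by apply: (dr_s0r dr); exact: Gam_val.
exists l => x.
have [y yE] : exists y, val x = (a - 1) * y :> L.
  by apply: (dr_s0l dr); exact: Gam_val.
have -> : x = d *> y by apply: val_inj; rewrite sub_regular_ract dE.
rewrite lin_ract; apply: val_inj.
by rewrite sub_regular_ract lE val_lact lmulE sub_regular_ract dE mulrA.
Qed.

(** m - s is a multiple (a - 1) y, and a - 1 is a combination of 1 - b and
    1 - ba: so multiplication by m on Gam factors through P + P'. *)
Lemma antifix_decomposition : exists u v, forall x : Gam,
  antifixed_incl (antifix (dr_bb dr) u x) +
  antifixed_incl (antifix dr_cc v x) = x *+ m.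
Proof.
have [|y yE] := @dr_s0l _ _ _ _ _ dr (m%:R - s).
  by rewrite mulrBl mulr_natl (dr_ss dr) subrr.
exists (a * y), (- y) => x; apply: val_inj; rewrite raddfMn submod_valD.
rewrite !val_antifixed_incl !val_antifix !lmulE.
apply: decomposition_mul (_ : s * (val x : L) = 0); last by rewrite -sC Gam_val.
by rewrite flip_decomposition yE.
Qed.

(** The integer m factors through P + P', as cancellation of Gam requires. *)
Lemma cancel_Gam (K Y : lmodType R) :
  lmod_iso (K * Gam)%type ((Gam * (P * P' * Y)) * Gam)%type ->
  lmod_iso K (Gam * (P * P' * Y))%type.
Proof.
have [u [v uv]] := antifix_decomposition.
pose i1 := mklin (@antifixed_incl_linear _ _ sC b).
pose i2 := mklin (@antifixed_incl_linear _ _ sC (b * a)).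
pose i0 (z : P * P' * Y) : Gam := i1 z.1.1 + i2 z.1.2.
have li : linear i0.
  by move=> c x y; rewrite /i0 !linearP scalerDr addrACA.
pose j1 := mklin (@antifix_linear _ _ sC _ (dr_bb dr) u).
pose j2 := mklin (@antifix_linear _ _ sC _ dr_cc v).
pose j0 (x : Gam) : P * P' * Y := (j1 x, j2 x, 0).
have lj : linear j0.
  by move=> c x y; rewrite /j0 !linearP; congr (_, _, _); rewrite /= scaler0 addr0.
apply: (@cancel_summand _ (dr_sr1 dr) (dr_dvd dr) _ _ (@lact _ _ sC)
   (@lact_linear _ _ sC) (@lactD _ _ sC) (@lactM _ _ sC) (@lact1 _ _ sC)
   lact_surj (mklin li) (mklin lj) m).
  exact: (dr_m dr).
exact: uv.
Qed.

End KernelPart.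

(** * Parametrisations of the annihilators *)

Section RowCoordinates.
Variable L : nzRingType.
Local Notation R := (L^c).

Lemma lmod_iso_row0 (U : lmodType R) : lmod_iso (U * 'rV[R]_0)%type U.
Proof.
apply: (@lmod_iso_fun _ _ _ fst) => //.
- by move=> [x u] [y v] /= ->; congr pair; apply/rowP; case.
- by move=> x; exists (x, 0).
Qed.

Definition co k (x : 'rV[R]_k) (i : 'I_k) : L := x 0 i.

Lemma coD k (x y : 'rV[R]_k) i : co (x + y) i = co x i + co y i.
Proof. by rewrite /co mxE. Qed.
Lemma coN k (x : 'rV[R]_k) i : co (- x) i = - co x i.
Proof. by rewrite /co mxE. Qed.
Lemma co0 k i : co (0 : 'rV[R]_k) i = 0.
Proof. by rewrite /co mxE. Qed.
Lemma coR k (x : 'rV[R]_k) (l : L) i : co (x *> l) i = co x i * l.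
Proof. by rewrite /co mxE. Qed.
Lemma coZ k (x : 'rV[R]_k) (l : R) i : co (l *: x) i = co x i * (l : L).
Proof. exact: coR. Qed.

Lemma co_inj k (x y : 'rV[R]_k) : (forall i, co x i = co y i) -> x = y.
Proof. by move=> eq; apply/rowP. Qed.

Definition row2 (x y : L) : 'rV[R]_2 := \row_i (tnth [tuple x; y] i).
Definition row3 (x y z : L) : 'rV[R]_3 := \row_i (tnth [tuple x; y; z] i).

Lemma co2 x y i : co (row2 x y) i = tnth [tuple x; y] i.
Proof. by rewrite /co mxE. Qed.
Lemma co3 x y z i : co (row3 x y z) i = tnth [tuple x; y; z] i.
Proof. by rewrite /co mxE. Qed.

Lemma row2P (u v : 'rV[R]_2) : co u 0 = co v 0 -> co u 1 = co v 1 -> u = v.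
Proof.
move=> e0 e1; apply: co_inj; case=> -[|[|//]] lt.
  by have -> : Ordinal lt = 0 by exact: val_inj.
by have -> : Ordinal lt = 1 by exact: val_inj.
Qed.

Lemma row3P (u v : 'rV[R]_3) :
  co u 0 = co v 0 -> co u 1 = co v 1 -> co u 2%:R = co v 2%:R -> u = v.
Proof.
move=> e0 e1 e2; apply: co_inj; case=> -[|[|[|//]]] lt.
- by have -> : Ordinal lt = 0 by exact: val_inj.
- by have -> : Ordinal lt = 1 by exact: val_inj.
- by have -> : Ordinal lt = 2%:R by exact: val_inj.
Qed.

End RowCoordinates.

Section StableKernel.
Variables (L : nzRingType) (a b s : L) (m : nat).
Hypothesis dr : dihedral_ring a b s m.
Local Notation R := (L^c).
Local Notation sC := (dr_sC dr).
Local Notation Gam := (annS sC (R^o)).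
Local Notation P := (antifixed sC b).
Local Notation P' := (antifixed sC (b * a)).
Local Notation GPP := (Gam * (P * P'))%type.

(** The functor annS turns the free summands of a stable isomorphism into
    copies of Gam, which are cancelled one at a time. *)
Lemma annS_stable (K V : lmodType R) r :
  lmod_iso (annS sC V) GPP ->
  lmod_iso (K * 'rV[R]_r)%type (V * 'rV[R]_r)%type ->
  lmod_iso (annS sC K) GPP.
Proof.
move=> isoV /(subf_iso (annS sC)) iso.
suff step : forall r, lmod_iso (annS sC (K * 'rV[R]_r)%type)
    (annS sC (V * 'rV[R]_r)%type) -> lmod_iso (annS sC K) (annS sC V).
  by apply: lmod_iso_trans isoV; apply: step iso.
elim=> [|q IH] {iso} iso.
  apply: lmod_iso_trans (subf_iso _ (lmod_iso_row0 V)).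
  apply: lmod_iso_trans iso.
  exact/lmod_iso_sym/subf_iso/lmod_iso_row0.
apply: IH.
have splitS (W : lmodType R) : lmod_iso (annS sC (W * 'rV[R]_q.+1)%type)
    (annS sC (W * 'rV[R]_q)%type * Gam)%type.
  apply: lmod_iso_trans (subf_prod _ _ _).
  exact/subf_iso/lmod_iso_rowS.
pose Y : lmodType R := annS sC 'rV[R]_q.
have isoVq : lmod_iso (annS sC (V * 'rV[R]_q)%type) (Gam * (P * P' * Y))%type.
  apply: lmod_iso_trans (subf_prod _ _ _) _.
  apply: lmod_iso_trans (lmod_iso_prod isoV (lmod_iso_refl _)) _.
  apply: (@lmod_iso_fun _ _ _ (fun x : GPP * Y => (x.1.1, (x.1.2, x.2)) : Gam * (P * P' * Y))) => //.
  - by move=> [[x y] z] [[x' y'] z'] /= [-> -> ->].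
  - by move=> [x [y z]]; exists ((x, y), z).
apply: lmod_iso_trans (lmod_iso_sym isoVq); apply: cancel_Gam.
apply: lmod_iso_trans (lmod_iso_sym (splitS K)) _.
apply: lmod_iso_trans iso _; apply: lmod_iso_trans (splitS V) _.
exact: lmod_iso_prod isoVq (lmod_iso_refl _).
Qed.

(** The parametrisation of the elements of the kernel of d2 killed by s. *)
Definition J_param (x : GPP) : 'rV[R]_3 :=
  row3 (val x.1 : L) ((val x.2.1 : L) + (val x.2.2 : L)) (val x.2.2 : L).

Lemma J_param_linear : linear J_param.
Proof.
move=> c x y; apply: row3P; rewrite coD coZ !co3 /=.
- by [].
- by rewrite mulrDl addrACA.
- by [].
Qed.

Lemma J_param_inj : injective J_param.
Proof.
move=> [g [p r]] [g' [p' r']] /rowP eq.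
have e0 := eq 0; have e1 := eq 1; have e2 := eq 2%:R.
move: e0 e1 e2; rewrite !mxE !(tnth_nth 0) /= => eg ep er.
have -> : g = g' by exact: val_inj.
have rr : r = r' by exact: val_inj.
rewrite rr; have -> // : p = p'.
by apply: val_inj; apply: (@addIr _ (submod_val r)); rewrite [in RHS]rr.
Qed.

Lemma J_paramP (v : 'rV[R]_3) : (exists x, J_param x = v) <->
  [/\ v *> s = 0, s * co v 0 + (1 + b * a) * co v 2%:R = 0
    & (1 + b) * (co v 1 - co v 2%:R) = 0].
Proof.
split.
  move=> [[g [p r]] <-].
  have gs := Gam_val g; have [ps pb] := antifixedP p; have [rs rb] := antifixedP r.
  split.
  - by apply: row3P; rewrite coR co3 co0 /=; rewrite ?mulrDl ?gs ?ps ?rs ?addr0.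
  - by rewrite !co3 /= -sC gs add0r rb.
  - by rewrite !co3 /= addrK pb.
case=> vs e1 e2.
have v0s : co v 0 * s = 0 by rewrite -coR vs co0.
have v1s : co v 1 * s = 0 by rewrite -coR vs co0.
have v2s : co v 2%:R * s = 0 by rewrite -coR vs co0.
have [g gE] : exists g : Gam, val g = co v 0 by apply: mem_annS; rewrite regular_ract.
have [p pE] : exists p : P, val p = co v 1 - co v 2%:R.
  by apply: mem_antifixed => //; rewrite mulrBl v1s v2s subr0.
have [r rE] : exists r : P', val r = co v 2%:R.
  by apply: mem_antifixed => //; rewrite -[RHS]e1 -sC v0s add0r.
exists (g, (p, r)); apply: row3P; rewrite co3 /=.
- by rewrite gE.
- by rewrite pE rE subrK.
- by rewrite rE.
Qed.

(** The parametrisation of M (a - 1). *)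
Definition M_param (x : GPP) : 'rV[R]_2 * R^o :=
  (row2 (val x.2.2 : L) ((val x.2.1 : L) + b * (val x.2.2 : L)), (val x.1 : L)).

Lemma M_param_linear : linear M_param.
Proof.
move=> c x y; congr pair.
apply: row2P; rewrite coD coZ !co2 /=.
- by [].
- by rewrite mulrDl mulrDr addrACA -[in RHS]mulrA.
Qed.

Lemma M_param_inj : injective M_param.
Proof.
move=> [g [p r]] [g' [p' r']] [/rowP eq] eg.
have e0 := eq 0; have e1 := eq 1.
move: e0 e1; rewrite !mxE !(tnth_nth 0) /= => er ep.
have -> : g = g' by exact: val_inj.
have rr : r = r' by exact: val_inj.
rewrite rr; have -> // : p = p'.
by apply: val_inj; apply: (@addIr _ (b * submod_val r)); rewrite [in RHS]rr.
Qed.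

(** The multiples of a - 1 in the submodule generated by the relations: since
    s (a - 1) = 0 only the last two relations contribute, and
    a - 1 = - b (1 - ba) - (1 - b) expresses them through antifixed elements. *)
Lemma M_paramP (v : 'rV[R]_2 * R^o) : (exists x, M_param x = v) <->
  exists (c : 'rV[R]_3) (l : L),
    [/\ co v.1 0 = (s * co c 0 + (1 - b * a) * co c 2%:R) * (a - 1),
        co v.1 1 = ((1 - b) * co c 1 - (a - 1) * co c 2%:R) * (a - 1)
      & v.2 = l * (a - 1)].
Proof.
have sa : s * (a - 1) = 0 by rewrite -sC (dr_as dr).
have key (w : L) : (a - 1) * w = - (b * ((1 - b * a) * w)) - (1 - b) * w.
  rewrite (mulrA b) -mulNr -mulrBl; congr (_ * w).
  by rewrite mulrBr mulr1 mulrA (dr_bb dr) mul1r !opprB addrA subrK.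
split.
  move=> [[g [p r]] <-].
  have gs := Gam_val g; have [ps pb] := antifixedP p; have [rs rb] := antifixedP r.
  have [v1 [pE v1s]] := dr_antib dr pb ps; have [v2 [rE v2s]] := dr_antiba dr rb rs.
  have [l lE] := dr_s0r dr gs.
  have [k kE] := dr_s0r dr v2s; have [k' k'E] := dr_s0r dr v1s.
  exists (row3 0 (k' - k) k), l; rewrite !co3 !co2 /=; split=> //.
  - by rewrite mulr0 add0r -mulrA -kE.
  - rewrite mulrBl -!mulrA [(k' - k) * _]mulrBl -kE -k'E key mulrBr -pE -rE opprB opprK addrA.
    by rewrite subrK.
case=> c [l [e0 e1 e2]].
have ls : l * (a - 1) * s = 0 by rewrite -mulrA (dr_as dr) mulr0.
have [g gE] : exists g : Gam, val g = l * (a - 1) by apply: mem_annS; rewrite regular_ract.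
pose w := co c 2%:R * (a - 1); pose u := co c 1 * (a - 1).
have ws : w * s = 0 by rewrite /w -mulrA (dr_as dr) mulr0.
have us : u * s = 0 by rewrite /u -mulrA (dr_as dr) mulr0.
have [r rE] : exists r : P', val r = (1 - b * a) * w.
  by apply: mem_antifixed; [rewrite -mulrA ws mulr0|apply: antifixed_mul (dr_cc dr)].
have [p pE] : exists p : P, val p = (1 - b) * (u + w).
  apply: mem_antifixed; last exact: antifixed_mul (dr_bb dr).
  by rewrite -mulrA [(u + w) * s]mulrDl us ws addr0 mulr0.
exists (g, (p, r)); rewrite [RHS]surjective_pairing e2; congr pair; last first.
  by rewrite /= gE.
apply: row2P; rewrite co2 /= ?pE ?rE ?e0 ?e1.
- by rewrite [RHS]mulrDl -(sC (co c 0)) -(mulrA (co c 0)) sa mulr0 add0r mulrA.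
- by rewrite [RHS]mulrBl -!mulrA -/w -/u (key w) [(1 - b) * (u + w)]mulrDr opprB opprK addrA.
Qed.

End StableKernel.

(** * The group ring of a dihedral group *)

Section DihedralElements.
Variable n : nat.
Hypothesis n_gt0 : (0 < n)%N.
Local Notation D := (dihedral n).
Local Notation Lam := (Lam n).
Local Notation rot i := (Dihedral i false : D).
Local Notation flp i := (Dihedral i true : D).
Local Notation A := (zg (da n) : Lam).
Local Notation B := (zg (db n) : Lam).
Local Notation S := (Sig n).
Implicit Types (i j : 'Z_(2 * n)) (g h : D) (x y u v : Lam).

Lemma two_n_gt1 : (1 < 2 * n)%N. Proof. by lia. Qed.

Lemma natr_2n : (2 * n)%:R = 0 :> 'Z_(2 * n).
Proof. exact: pchar_Zp two_n_gt1. Qed.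

Lemma rotM i j : (rot i * rot j)%g = rot (i + j).
Proof. by congr Dihedral; rewrite /= mul1r. Qed.
Lemma rotfM i j : (rot i * flp j)%g = flp (i + j).
Proof. by congr Dihedral; rewrite /= mul1r. Qed.
Lemma flprM i j : (flp i * rot j)%g = flp (i - j).
Proof. by congr Dihedral; rewrite /= mulN1r. Qed.
Lemma flpM i j : (flp i * flp j)%g = rot (i - j).
Proof. by congr Dihedral; rewrite /= mulN1r. Qed.
Lemma rotV i : (rot i)^-1%g = rot (- i).
Proof. by congr Dihedral; rewrite /= mul1r. Qed.
Lemma flpV i : (flp i)^-1%g = flp i.
Proof. by congr Dihedral; rewrite /= mulN1r opprK. Qed.
Lemma big_dihedral (R : nmodType) (F : D -> R) :
  \sum_g F g = \sum_(i : 'Z_(2 * n)) (F (rot i) + F (flp i)).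
Proof.
rewrite (reindex (@dihedral_decode n)) /=; last first.
  by apply: onW_bij; exists (@dihedral_code n) => [[]|[]].
rewrite -(pair_bigA_idem _ (fun i s => F (Dihedral i s))) //=.
  by apply: eq_bigr => i _; rewrite big_bool addrC.
by rewrite addr0.
Qed.

Lemma SigE g : S g = (~~ dih_flip g)%:R.
Proof.
rewrite /Sig zg_sumE big_mkord.
have aX k : A ^+ k = zg (rot k%:R).
  elim: k => [|k IH]; first by [].
  by rewrite exprS IH -zgM rotM -natr1 addrC.
under eq_bigr do rewrite aX zgE.
case: g => i [] /=; first by rewrite big1 // => k _; case: eqP.
have lt : (i < 2 * n)%N by have := ltn_ord i; rewrite [X in (_ < X)%N]Zp_cast ?two_n_gt1.
rewrite (bigD1 (Ordinal lt)) //= natr_Zp eqxx big1 ?addr0 // => k ne.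
case: eqP => // -[ik]; case/eqP: ne; apply: val_inj => /=.
rewrite ik val_Zp_nat ?two_n_gt1 // modn_small //.
Qed.

Lemma mulzgSig g : zg g * S = S * zg g.
Proof.
apply/ffunP => h; rewrite zg_mull zg_mulr !SigE; congr ((~~ _)%:R).
by case: g h => [i []] [j []].
Qed.

Lemma Sig_central x : x * S = S * x.
Proof.
elim/zg_ind: x => [|x y hx hy|x hx|g]; rewrite ?mul0r ?mulr0 //.
- by rewrite mulrDl mulrDr hx hy.
- by rewrite mulNr mulrN hx.
- exact: mulzgSig.
Qed.

Lemma mulSigE x g : (S * x) g =
  \sum_(i : 'Z_(2 * n)) x (Dihedral i (dih_flip g)).
Proof.
rewrite zgmE big_dihedral.
case: g => k s /=; under eq_bigr => i _ do rewrite !SigE /= mul1r mul0r addr0.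
rewrite (reindex_inj (inj_comp (addrI k) oppr_inj)) /=; apply: eq_bigr => i _.
by congr (x _); case: s; rewrite rotV (rotM, rotfM) opprB subrK.
Qed.

Lemma b_sqr : B * B = 1. Proof. by rewrite -zgM flpM subrr. Qed.
Lemma a_b_a : A * B * A = B.
Proof.
by rewrite -!zgM; congr zg; congr Dihedral; rewrite /= mulr0 addr0 mulr1 addrN.
Qed.
Lemma subA1_Sig : (A - 1) * S = 0.
Proof.
apply/ffunP => g; rewrite mulrBl mul1r zgDE zgNE zg_mull zg0E !SigE.
by case: g => i []; rewrite rotV (rotM, rotfM) /= subrr.
Qed.

Lemma Sig_subA1 : S * (A - 1) = 0.
Proof. by rewrite -Sig_central subA1_Sig. Qed.

Lemma SigA : S * A = S.
Proof. by apply/eqP; rewrite -subr_eq0 -[X in _ - X]mulr1 -mulrBr Sig_subA1. Qed.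

Lemma Sig_Sig : S * S = S *+ (2 * n).
Proof.
rewrite {1}/Sig mulr_suml (eq_bigr (fun=> S)) => [|k _].
  by rewrite big_mkord sumr_const card_ord.
elim: k => [|k IH]; first by rewrite mul1r.
by rewrite exprSr -mulrA (Sig_central A) SigA.
Qed.

(** The quotient has as coefficients the negated cumulative sums of those of x
    along the rotations, and along the reflections. *)
Lemma Sig0_mull x : x * S = 0 -> exists y, x = (A - 1) * y.
Proof.
move=> xS.
pose y : Lam := [ffun g : D => - \sum_(j : 'Z_(2 * n) | (j <= dih_rot g)%N)
                           x (Dihedral j (dih_flip g))].
exists y; apply/ffunP => -[i s].
rewrite mulrBl mul1r zgDE zgNE zg_mull !ffunE opprK.
have -> : ((da n)^-1 * Dihedral i s)%g = Dihedral (i - 1) s.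
  by case: s; rewrite rotV (rotM, rotfM) addrC.
rewrite /= addrC.
have x0 : \sum_j x (Dihedral j s) = 0.
  have := congr1 (fun z : Lam => z (Dihedral 0 s)) xS.
  by rewrite Sig_central mulSigE zg0E.
have ltm (j : 'Z_(2 * n)) : (j < 2 * n)%N.
  by have := ltn_ord j; rewrite [X in (_ < X)%N]Zp_cast ?two_n_gt1.
have [->|i0] := eqVneq i 0.
  rewrite [X in _ - X](_ : _ = 0) ?subr0; last first.
    rewrite -[RHS]x0; apply: eq_bigl => j; apply/idP.
    have m1E : nat_of_ord (0 - 1 : 'Z_(2 * n)) = (2 * n).-1.
      have e : (2 * n).-1%:R = -1 :> 'Z_(2 * n).
        by apply/eqP; rewrite -addr_eq0 natr1 prednK ?muln_gt0 // natr_2n.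
      by rewrite add0r -e val_Zp_nat ?two_n_gt1 // modn_small // prednK ?muln_gt0.
    by rewrite [X in (_ <= X)%N]m1E -ltnS prednK ?muln_gt0.
  rewrite (bigD1 0) //= big1 ?addr0 // => j; rewrite leqn0 => /andP[/eqP j0 /eqP[]].
  exact: val_inj.
have iE : nat_of_ord (i - 1) = i.-1.
  have ip : (0 < i)%N by rewrite lt0n; apply: contraNneq i0 => i0; apply/eqP/val_inj.
  rewrite -{1}(natr_Zp i) -(prednK ip) -natr1 addrK val_Zp_nat ?two_n_gt1 //.
  by rewrite modn_small // (leq_ltn_trans (leq_pred _) (ltm i)).
rewrite (bigD1 i) //= -addrA -[LHS]addr0; congr (_ + _).
apply/esym/eqP; rewrite subr_eq0; apply/eqP; apply: eq_bigl => j.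
have ip : (0 < i)%N by rewrite lt0n; apply: contraNneq i0 => i0; apply/eqP/val_inj.
have -> : (j <= (i - 1)%R)%N = (j <= i.-1)%N by rewrite iE.
by rewrite -val_eqE /=; lia.
Qed.

Lemma Sig0_mulr x : x * S = 0 -> exists y, x = y * (A - 1).
Proof. by move=> /Sig0_mull[y ->]; apply: a_sub1_comm. Qed.

Definition rot_part x : Lam := [ffun g : D => if dih_flip g then 0 else x g].

Lemma flip_sqr (t : D) : dih_flip t -> zg t * zg t = 1 :> Lam.
Proof. by case: t => k [] // _; rewrite -zgM flpM subrr. Qed.

Lemma rot_part_Sig x : x * S = 0 -> rot_part x * S = 0.
Proof.
move=> xS; apply/ffunP => g; rewrite Sig_central mulSigE zg0E.
case: g => k s; under eq_bigr do rewrite ffunE /=.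
case: s => /=; first by rewrite big1.
by rewrite -(mulSigE x (rot k)) -Sig_central xS zg0E.
Qed.

(** Left multiplication by t exchanges the rotations and the reflections, so the
    coefficients of x on the rotations determine x. *)
Lemma flip_antifixed (t : D) x : dih_flip t -> (1 + zg t) * x = 0 ->
  x = (1 - zg t) * rot_part x.
Proof.
case: t => k [] // _ tx; apply/ffunP => g.
have := congr1 (fun z : Lam => z g) tx.
rewrite mulrDl mulrBl !mul1r !zgDE zgNE zg0E !zg_mull !ffunE flpV.
case: g => l [] /=; last by rewrite subr0.
by rewrite flpM sub0r => /eqP; rewrite addr_eq0 => /eqP.
Qed.

Lemma dihedral_ring_zgring : dihedral_ring A B S (2 * n).
Proof.
have anti (t : D) x : dih_flip t -> (1 + zg t) * x = 0 -> x * S = 0 ->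
    exists v, x = (1 - zg t) * v /\ v * S = 0.
  move=> ft tx xS; exists (rot_part x); split; first exact: flip_antifixed.
  exact: rot_part_Sig.
split.
- exact: two_n_gt1.
- exact: Sig_central.
- exact: b_sqr.
- exact: a_b_a.
- exact: subA1_Sig.
- exact: Sig_Sig.
- exact: Sig0_mull.
- exact: Sig0_mulr.
- by move=> x; apply: anti.
- by move=> x; rewrite -zgM; apply: anti.
- exact: zgring_sr1.
- exact: zgring_cong1_dvd_int.
Qed.

End DihedralElements.

(** * Identification of the annihilators *)

Section Lincomb.
Variable L : nzRingType.
Local Notation R := (L^c).

Lemma sum_ord3 (V : nmodType) (F : 'I_3 -> V) :
  \sum_i F i = F 0 + F 1 + F 2%:R.
Proof.
by rewrite 2!big_ord_recl big_ord1 addrA; congr (F _ + F _ + F _); apply: val_inj.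
Qed.

Lemma co_lincomb3 k (v0 v1 v2 : 'rV[R]_k) (c : 'rV[R]_3) i :
  co (lincomb (tnth [tuple v0; v1; v2]) c) i =
  co v0 i * co c 0 + co v1 i * co c 1 + co v2 i * co c 2%:R.
Proof. by rewrite /lincomb sum_ord3 !(tnth_nth 0) /= !coD !coZ. Qed.

Lemma co_delta k (i j : 'I_k) : co (delta_mx 0 i : 'rV[R]_k) j = (j == i)%:R.
Proof. by rewrite /co mxE eqxx. Qed.

Variables (a b s : L).
Hypothesis bb : b * b = 1.
Let u0 : 'rV[R]_2 := delta_mx 0 0.
Let u1 : 'rV[R]_2 := delta_mx 0 1.

Lemma boundary_rows (c : 'rV[R]_3) :
  let v := lincomb (tnth [tuple u0 *> s; u1 *> (1 + b);
                       u0 *> (1 + b * a) + u1 *> (a - 1)]) c in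
  co v 0 = s * co c 0 + (1 + b * a) * co c 2%:R /\
  co v 1 = (1 + b) * co c 1 + (a - 1) * co c 2%:R.
Proof.
move=> v; rewrite /v !co_lincomb3 !coD !coR !co_delta /=.
by rewrite !(mul0r, mul1r, addr0, add0r).
Qed.

Lemma relation_rows (c : 'rV[R]_3) :
  let v := lincomb (tnth [tuple u0 *> s; u1 *> (1 - b);
                       u0 *> (1 - b * a) - u1 *> (a - 1)]) c in
  co v 0 = s * co c 0 + (1 - b * a) * co c 2%:R /\
  co v 1 = (1 - b) * co c 1 - (a - 1) * co c 2%:R.
Proof.
move=> v; rewrite /v !co_lincomb3 !coD !coN !coR !co_delta /=.
by rewrite !(mul0r, mul1r, addr0, add0r, subr0, oppr0, sub0r) mulNr.
Qed.

(** Since a - 1 + (1 + b) = b (1 + ba), the second equation defining the kernel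
    of the boundary decouples from the first. *)
Lemma boundary_kernel (c : 'rV[R]_3) :
  lincomb (tnth [tuple u0 *> s; u1 *> (1 + b);
                       u0 *> (1 + b * a) + u1 *> (a - 1)]) c = 0 <->
  s * co c 0 + (1 + b * a) * co c 2%:R = 0 /\
  (1 + b) * (co c 1 - co c 2%:R) = b * (s * co c 0).
Proof.
have [e0 e1] := boundary_rows c; set v := lincomb _ c in e0 e1 *.
have e1' : co v 1 = (1 + b) * (co c 1 - co c 2%:R) + b * ((1 + b * a) * co c 2%:R).
  have -> : b * ((1 + b * a) * co c 2%:R) = (b + a) * co c 2%:R.
    by rewrite mulrA mulrDr mulr1 mulrA bb mul1r.
  rewrite e1 mulrBr -addrA; congr (_ + _); rewrite -mulNr -mulrDl; congr (_ * _).
  by rewrite opprD addrA subrK addrC.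
split=> [v0|[h0 h1]].
  move: e0 e1'; rewrite v0 !co0 => /esym e0 /esym/eqP b0; split=> //.
  have h : (1 + b * a) * co c 2%:R = - (s * co c 0).
    by apply/eqP; rewrite -addr_eq0 addrC e0.
  by move: b0; rewrite h mulrN subr_eq0 => /eqP.
apply: row2P; rewrite co0.
  by rewrite e0 h0.
by rewrite e1' h1 -mulrDr h0 mulr0.
Qed.

End Lincomb.

Section AbstractKernels.
Variables (L : nzRingType) (a b s : L) (m : nat).
Hypothesis dr : dihedral_ring a b s m.
Local Notation R := (L^c).
Local Notation sC := (dr_sC dr).
Local Notation Gam := (annS sC (R^o)).
Local Notation GPP := (Gam * (antifixed sC b * antifixed sC (b * a)))%type.
Local Notation u0 := (delta_mx 0 0 : 'rV[R]_2).
Local Notation u1 := (delta_mx 0 1 : 'rV[R]_2).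

Definition boundary_family : 'I_3 -> 'rV[R]_2 :=
  tnth [tuple u0 *> s; u1 *> (1 + b); u0 *> (1 + b * a) + u1 *> (a - 1)].

Definition relation_family : 'I_3 -> 'rV[R]_2 :=
  tnth [tuple u0 *> s; u1 *> (1 - b); u0 *> (1 - b * a) - u1 *> (a - 1)].

Local Notation d := (lincomb boundary_family : {linear 'rV[R]_3 -> 'rV[R]_2}).

Lemma mem_kernel_boundary (c : 'rV[R]_3) : c \in submod_pred (kernel d) <->
  s * co c 0 + (1 + b * a) * co c 2%:R = 0 /\
  (1 + b) * (co c 1 - co c 2%:R) = b * (s * co c 0).
Proof.
rewrite inE; apply: iff_trans (boundary_kernel a s (dr_bb dr) c).
by split => [/eqP|h]; [exact|apply/eqP].
Qed.

Lemma annS_kernel_iso : lmod_iso (annS sC (kernel d)) GPP.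
Proof.
apply: (@annS_submodule_iso _ _ _ _ _ _ (mklin (J_param_linear (dr := dr)))).
  exact: J_param_inj.
move=> v; apply: iff_trans (J_paramP dr v) (iff_sym _); split.
  move=> [/mem_kernel_boundary[h0 h1] vs].
  have v0s : s * co v 0 = 0 by rewrite -sC -coR vs co0.
  by split=> //; rewrite h1 v0s mulr0.
case=> vs h0 h1; split=> //.
have v0s : s * co v 0 = 0 by rewrite -sC -coR vs co0.
by apply/mem_kernel_boundary; rewrite h0 h1 v0s mulr0.
Qed.

Local Notation M := (spanned relation_family * R^o)%type.

Lemma mul_sub1_iso (T : submodule M) :
  (forall x, x \in submod_pred T <-> exists y, x = y *> (a - 1)) -> lmod_iso T GPP.
Proof.
move=> TP.
have lg : linear (fun x : M => (val x.1, x.2) : 'rV[R]_2 * R^o) by [].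
pose f := mklin (linearP (mklin lg \o submod_incl T)).
apply: (@same_image_iso _ _ _ _ f (mklin (M_param_linear (dr := dr)))).
- move=> x y /= [/val_inj e1 e2]; apply: val_inj.
  by rewrite [LHS]surjective_pairing /= e1 e2 -surjective_pairing.
- exact: M_param_inj.
move=> v; apply: iff_trans (iff_sym (M_paramP dr v)); split.
  move=> [x <-] /=.
  have /TP[y yE] := valP x.
  have /asboolP[c cE] := valP y.1.
  have [e0 e1] := relation_rows a b s c.
  exists c, y.2; rewrite yE /= -e0 -e1 -!coR -cE //.
move=> [c [l [e0 e1 e2]]].
have cS : lincomb relation_family c \in submod_pred (spanned relation_family).
  by apply/asboolP; exists c.
pose y : M := (SubmodType cS, l).
have yT : y *> (a - 1) \in submod_pred T by apply/TP; exists y.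
exists (SubmodType yT); rewrite /= [RHS]surjective_pairing e2; congr pair.
have [f0 f1] := relation_rows a b s c.
by apply: row2P; rewrite -[_ *: _]/(_ *> (a - 1)) coR ?e0 ?e1 ?f0 ?f1.
Qed.

End AbstractKernels.

Section Concrete.
Variable n : nat.
Hypothesis n_gt0 : (0 < n)%N.
Local Notation Lam := (Lam n).
Local Notation R := (Lam^c).
Local Notation dr := (dihedral_ring_zgring n_gt0).
Local Notation a := (zg (da n) : Lam).
Local Notation b := (zg (db n) : Lam).
Local Notation s := (Sig n).

Lemma d2E : d2 n = lincomb (boundary_family a b s).
Proof. reflexivity. Qed.

Lemma mul_a_sub1_mem (N : rmodType Lam) (x : N) :
  x \in submod_pred (Submodule (@mul_a_sub1_closed n N)) <-> exists y, x = y *> (a - 1).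
Proof. by rewrite inE; split => [/asboolP|h]; [|apply/asboolP]. Qed.

Lemma W2T_genE : @W2T_gen n = relation_family a b s.
Proof. reflexivity. Qed.

Lemma mul_a_sub1_M_iso : lmod_iso (mul_a_sub1 (W2T n * R^o)%type)
  (annS (dr_sC dr) (R^o) * (antifixed (dr_sC dr) b * antifixed (dr_sC dr) (b * a)))%type.
Proof.
rewrite /W2T W2T_genE.
exact: (mul_sub1_iso dr (@mul_a_sub1_mem _)).
Qed.

(** Both modules are the sum of Gam and of its parts antifixed by b and ba: the
    one by the explicit parametrisation of M (a - 1), the other by that of J and
    cancellation. *)
Lemma annS_minimal_iso (K : rmodType Lam) :
  stably_equivalent K (J n) -> same_zrank K (J n) ->
  lmod_iso (mul_a_sub1 (W2T n * R^o)%type) (annS (dr_sC dr) K).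
Proof.
move=> [r [r' iso]] rk; have rr := stable_rank_eq rk iso; subst r'.
have isoJ := annS_kernel_iso dr; rewrite -d2E in isoJ.
apply: lmod_iso_trans (lmod_iso_sym (annS_stable isoJ iso)).
exact: mul_a_sub1_M_iso.
Qed.

End Concrete.

(** * The image of J under the sum of the rotations *)

Lemma zg_additive_linear (G : finGroupType) (U V : rmodType (zgring G)) (f : U -> V) :
  zmod_morphism f -> (forall x g, f (x *> zg g) = f x *> zg g) -> linear f.
Proof.
move=> fa fg; pose F := mkadd fa.
have f0 : f 0 = 0 by exact: (raddf0 F).
have fD x y : f (x + y) = f x + f y by exact: (raddfD F).
have fN x : f (- x) = - f x by exact: (raddfN F).
have fl x (l : zgring G) : f (x *> l) = f x *> l.
  elim/zg_ind: l => [|l l' hl hl'|l hl|g]; last exact: fg.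
  - by rewrite !ract0r f0.
  - by rewrite !ractDr fD hl hl'.
  - by rewrite !ractNr fN hl.
by move=> c x y; rewrite fD; congr (_ + _); exact: (fl x c).
Qed.

Section Witness.
Variables (L : nzRingType) (a b s : L) (m : nat).
Hypothesis dr : dihedral_ring a b s m.

(** Elements of the kernel of d2 with prescribed image under J_proj below. *)
Lemma J_witness (k e e' : int) :
  let x0 := (1 + b) *~ k in let x2 := (1 - b * a) *~ e - s *~ k in
  let u := (1 - b) *~ e' + s *~ k in
  s * x0 + (1 + b * a) * x2 = 0 /\ (1 + b) * u = b * (s * x0).
Proof.
have sas : a * s = s.
  by apply/eqP; rewrite -subr_eq0 -[X in _ - X]mul1r -mulrBl (dr_as dr).
have anti (t : L) (tt : t * t = 1) : (1 + t) * (1 - t) = 0.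
  by have := @antifixed_mul _ t 1 tt; rewrite mulr1.
move=> x0 x2 u; rewrite /x0 /x2 /u; split.
  rewrite mulrBr !mulrzAr anti ?(dr_cc dr) // mul0rz sub0r -mulrzBl.
  by rewrite mulrDl mulrDr mul1r mulr1 -mulrA sas (dr_sC dr) subrr mul0rz.
rewrite mulrDr !mulrzAr anti ?(dr_bb dr) // mul0rz add0r; congr (_ *~ k).
by rewrite -(dr_sC dr) mulrA mulrDr mulr1 (dr_bb dr) addrC.
Qed.

End Witness.

Section Projection.
Variable n : nat.
Hypothesis n_gt0 : (0 < n)%N.
Local Notation D := (dihedral n).
Local Notation Lam := (Lam n).
Local Notation R := (Lam^c).
Local Notation dr := (dihedral_ring_zgring n_gt0).
Local Notation a := (zg (da n) : Lam).
Local Notation b := (zg (db n) : Lam).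
Local Notation s := (Sig n).
Implicit Types (x y l : Lam) (t : bool).

Definition csum t l : int := \sum_(i : 'Z_(2 * n)) l (Dihedral i t).

Lemma csumD t x y : csum t (x + y) = csum t x + csum t y.
Proof. by rewrite /csum -big_split; apply: eq_bigr => i _; rewrite zgDE. Qed.
Lemma csumN t x : csum t (- x) = - csum t x.
Proof. by rewrite /csum -sumrN; apply: eq_bigr => i _; rewrite zgNE. Qed.
Lemma csumMz t x k : csum t (x *~ k) = csum t x * k.
Proof. by rewrite /csum mulr_suml; apply: eq_bigr => i _; rewrite zgMzE. Qed.
Lemma csum0 t : csum t 0 = 0.
Proof. by rewrite /csum big1 // => i _; rewrite zg0E. Qed.

Lemma csum_mulr t x g : csum t (x * zg g) = csum (t (+) dih_flip g) x.
Proof.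
rewrite /csum; under eq_bigr do rewrite zg_mulr.
case: g => k []; rewrite ?flpV ?rotV /= ?addbT ?addbF.
  rewrite (reindex_inj (addIr (if t then k else - k))) /=.
  by apply: eq_bigr => i _; case: t; rewrite ?rotfM ?flpM ?addrK ?addrNK.
rewrite (reindex_inj (addIr (if t then - k else k))) /=.
by apply: eq_bigr => i _; case: t; rewrite ?flprM ?rotM ?opprK ?addrK ?addrNK.
Qed.

Lemma csum_mull t x g : csum t (zg g * x) = csum (t (+) dih_flip g) x.
Proof.
rewrite /csum; under eq_bigr do rewrite zg_mull.
case: g => k []; rewrite ?flpV ?rotV /= ?addbT ?addbF.
  rewrite (reindex_inj (inj_comp (addrI k) oppr_inj)) /=.
  by apply: eq_bigr => i _; case: t; rewrite ?flprM ?flpM opprD opprK addrA subrr add0r.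
rewrite (reindex_inj (addrI k)) /=.
by apply: eq_bigr => i _; case: t; rewrite ?rotfM ?rotM addrA addNr add0r.
Qed.

Lemma csum1 t : csum t 1 = (~~ t)%:R.
Proof.
rewrite /csum; under eq_bigr do rewrite zg1E.
case: t => /=; first by rewrite big1 // => i _; case: eqP.
rewrite (bigD1 0) // (_ : _ == _); last exact: eqxx.
by rewrite big1 // => i i0; case: eqP => // -[/eqP]; rewrite (negPf i0).
Qed.

Lemma mulSE x g : (s * x) g = csum (dih_flip g) x.
Proof. exact: mulSigE. Qed.

Lemma csum_mulS t x : csum t (s * x) = csum t x * (2 * n)%:Z.
Proof.
rewrite {1}/csum; under eq_bigr do rewrite mulSE /=.
rewrite sumr_const card_ord Zp_cast ?two_n_gt1 // -mulr_natr natz //.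
Qed.

(** The coefficients of x s are the two sums of coefficients of x. *)
Lemma mulS_eq0 x : x * s = 0 <-> (forall t, csum t x = 0).
Proof.
rewrite Sig_central //; split=> [xs t|h]; last first.
  by apply/ffunP => g; rewrite mulSE h zg0E.
by rewrite -(mulSE x (Dihedral 0 t)) xs zg0E.
Qed.

Section Sums.
Variable v : 'rV[R]_3.
Hypothesis vJ : v \in submod_pred (kernel (d2 n)).
Local Notation x0 := (co v 0).
Local Notation x1 := (co v 1).
Local Notation x2 := (co v 2%:R).

Lemma J_equations :
  s * x0 + (1 + b * a) * x2 = 0 /\ (1 + b) * (x1 - x2) = b * (s * x0).
Proof. by move: vJ; rewrite (d2E n) => /(mem_kernel_boundary dr). Qed.

Lemma csum_1flip t g x : dih_flip g -> csum t ((1 + zg g) * x) = csum t x + csum (~~ t) x.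
Proof. by move=> fg; rewrite mulrDl mul1r csumD csum_mull fg addbT. Qed.

(** The equations defining the kernel of d2 determine the sums over the
    reflections of an element from the sums over the rotations. *)
Lemma J_sums : [/\ csum true x0 = csum false x0,
  csum true x2 = - (csum false x2 + csum false x0 * (2 * n)%:Z)
  & csum true x1 = - csum false x1].
Proof.
have [e0 e1] := J_equations.
have h0 t : csum t x0 * (2 * n)%:Z + (csum t x2 + csum (~~ t) x2) = 0.
  by rewrite -csum_mulS -(csum_1flip _ (g := (db n * da n)%g)) // -csumD zgM e0 csum0.
have h1 t : csum t x1 - csum t x2 + (csum (~~ t) x1 - csum (~~ t) x2)
    = csum (~~ t) x0 * (2 * n)%:Z.
  have := congr1 (csum t) e1.
  rewrite csum_1flip // csum_mull addbT csum_mulS => <-.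
  by rewrite !csumD !csumN.
have n0 : (2 * n)%:Z != 0 by lia.
have k0 : csum true x0 = csum false x0.
  apply: (mulIf n0); apply: (@addIr _ (csum true x2 + csum false x2)).
  by rewrite (h0 true) [_ + csum false x2]addrC (h0 false).
have := h0 false; have := h1 false; rewrite /= k0.
by move: (csum false x0 * _) => k; split=> //; lia.
Qed.

End Sums.

(** The quotient of J by the elements killed by s.  Reflections act on the second
    sum of coefficients with a shift by 2n times the first; adding n times the
    first sum turns this into a change of sign. *)
Definition J_proj_row (v : 'rV[R]_3) : (Ztriv n * ZT n * ZT n)%type :=
  ((csum false (co v 0) : Ztriv n),
   (csum false (co v 2%:R) + csum false (co v 0) * n%:Z : ZT n),
   (csum false (co v 1) : ZT n)).

Lemma J_proj_row_additive : zmod_morphism J_proj_row.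
Proof.
move=> x y; rewrite /J_proj_row !coD !coN !csumD !csumN; congr (_, _, _).
by rewrite [LHS](_ : _ = (csum false (co x 2%:R) + csum false (co x 0) * n%:Z)
  - (csum false (co y 2%:R) + csum false (co y 0) * n%:Z)) //; lia.
Qed.

Lemma J_proj_row_zg v g : v \in submod_pred (kernel (d2 n)) ->
  J_proj_row (v *> zg g) = J_proj_row v *> zg g.
Proof.
move=> /J_sums[k0 k2 k1]; rewrite /J_proj_row !coR !csum_mulr.
rewrite -[RHS]/((((csum false (co v 0) : Ztriv n) *> zg g),
  (csum false (co v 2%:R) + csum false (co v 0) * n%:Z : ZT n) *> zg g),
  (csum false (co v 1) : ZT n) *> zg g).
rewrite !Ztwist_zg; congr (_, _, _); case: g => i [] /=; lia.
Qed.

Definition J_proj (x : J n) := J_proj_row (submod_incl (kernel (d2 n)) x).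

Lemma J_proj_linear : linear J_proj.
Proof.
apply: zg_additive_linear => [x y|x g]; rewrite /J_proj.
  by rewrite linearB J_proj_row_additive.
by rewrite lin_ract J_proj_row_zg //; exact: (valP x).
Qed.

Lemma J_proj_surj q : exists x : J n, J_proj x = q.
Proof.
case: q => [[k c'] c].
pose e : int := (c' : int) + (k : int) * n%:Z.
pose e' : int := (c : int) - e.
pose x0 : Lam := (1 + b) *~ k.
pose x2 : Lam := (1 - b * a) *~ e - s *~ k.
pose u : Lam := (1 - b) *~ e' + s *~ k.
have [h0 h1] : s * x0 + (1 + b * a) * x2 = 0 /\ (1 + b) * u = b * (s * x0).
  exact: (J_witness dr).
have [x0E x2E uE] : [/\ x0 = (1 + b) *~ k, x2 = (1 - b * a) *~ e - s *~ k
  & u = (1 - b) *~ e' + s *~ k] by [].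
clearbody x0 x2 u.
pose v := row3 x0 (u + x2) x2.
have vJ : v \in submod_pred (kernel (d2 n)).
  rewrite d2E; apply/(mem_kernel_boundary dr); rewrite !co3 /= addrK.
  by split; [exact: h0|exact: h1].
exists (SubmodType vJ); rewrite /J_proj /= /J_proj_row !co3 /=.
have b1 : csum false b = 0 by rewrite -[b]mulr1 csum_mull csum1.
have c1 : csum false (b * a) = 0 by rewrite -zgM -[zg _]mulr1 csum_mull csum1.
have s1 : csum false s = (2 * n)%:Z by rewrite -[s]mulr1 csum_mulS csum1 mul1r.
have k0 : csum false x0 = k by rewrite x0E csumMz csumD csum1 b1 addr0 mul1r.
have k2 : csum false x2 = e - (2 * n)%:Z * (k : int).
  by rewrite x2E csumD csumN !csumMz csumD csumN csum1 c1 s1 subr0 mul1r.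
have ku : csum false u = e' + (2 * n)%:Z * (k : int).
  by rewrite uE csumD !csumMz csumD csumN csum1 b1 s1 subr0 mul1r.
have c'E : e - (2 * n)%:Z * (k : int) + (k : int) * n%:Z = c' by rewrite /e; lia.
have cE : e' + (2 * n)%:Z * (k : int) + (e - (2 * n)%:Z * (k : int)) = c.
  by rewrite /e'; lia.
by rewrite csumD k0 k2 ku; congr (_, _, _); [exact: c'E|exact: cE].
Qed.

Lemma J_proj_ker (x : J n) : J_proj x = 0 <-> x *> s = 0.
Proof.
pose v := submod_incl (kernel (d2 n)) x.
have vJ : v \in submod_pred (kernel (d2 n)) by exact: (valP x).
have [k0 k2 k1] := J_sums vJ.
have xs : x *> s = 0 <-> v *> s = 0.
  rewrite /v -lin_ract; split=> [->|h]; first exact: linear0.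
  by apply: (@submod_incl_inj _ _ (kernel (d2 n))); rewrite h linear0.
apply: iff_trans (iff_sym xs).
rewrite /J_proj -/v /J_proj_row; split=> [[e0 e2 e1]|vs].
  have h0 : csum false (co v 0) = 0 by exact: e0.
  have h2 : csum false (co v 2%:R) = 0 by move: e2; rewrite h0 mul0r addr0.
  have h1 : csum false (co v 1) = 0 by exact: e1.
  apply: row3P; rewrite coR co0; apply/mulS_eq0 => // -[] //.
  - by rewrite k0 h0.
  - by rewrite k1 h1 oppr0.
  - by rewrite k2 h2 h0 mul0r addr0 oppr0.
have h i : forall t, csum t (co v i) = 0.
  by apply: (iffLR (@mulS_eq0 (co v i))); rewrite -coR vs co0.
by rewrite !h.
Qed.

End Projection.

(** * Cancellation of free abelian groups *)

(** Cancellation of free abelian groups, from the Smith normal form of the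
    projection onto the cancelled summand. *)
Lemma zmod_cancel_row (A : zmodType) k r :
  zmod_iso (A * 'rV[int]_r)%type ('rV[int]_k * 'rV[int]_r)%type ->
  zmod_iso A 'rV[int]_k.
Proof.
move=> [f [f' fK fK']].
have f'B : zmod_morphism f' by move=> x y; apply: (can_inj fK); rewrite raddfB !fK'.
pose g (x : 'rV[int]_(r + k)) : 'rV[int]_r := (f' (rsubmx x, lsubmx x)).2.
have gB : zmod_morphism g.
  by move=> x y; rewrite /g !raddfB -[LHS]/((f' ((rsubmx x, lsubmx x) - (rsubmx y, lsubmx y))).2) f'B.
pose h (y : 'rV[int]_r) : 'rV[int]_(r + k) := row_mx (f (0, y)).2 (f (0, y)).1.
have hB : zmod_morphism h.
  move=> x y; rewrite /h.
  have -> : (0, x - y) = (0, x) - (0, y) :> A * 'rV[int]_r by congr pair; rewrite subr0.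
  by rewrite raddfB /= opp_row_mx add_row_mx.
have lin m q (u : 'rV[int]_m -> 'rV[int]_q) : zmod_morphism u -> linear u.
  move=> uB c x y; have := raddfD (mkadd uB) (c *: x) y => /= ->.
  by congr (_ + _); exact: (raddf_int_scalable (mkadd uB)).
have glin := lin _ _ _ gB; have hlin := lin _ _ _ hB.
pose M := lin1_mx (mklin glin); pose N := lin1_mx (mklin hlin).
have gE x : x *m M = g x by rewrite mul_rV_lin1.
have hE x : x *m N = h x by rewrite mul_rV_lin1.
have NM : N *m M = 1%:M.
  apply/row_matrixP => i; rewrite row_mul row1 rowE -mulmxA.
  by rewrite mulmxA hE gE /g /h row_mxKl row_mxKr -surjective_pairing fK.
have [P uP [Q uQ [d _ ME]]] := int_Smith_normal_form M.
set D := \matrix_(i, j) _ in ME.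
have d0 (j : 'I_r) : d`_j != 0.
  apply/eqP => dj.
  have e : N *m P *m D = invmx Q.
    by apply: (can_inj (mulmxK uQ)); rewrite mulVmx // -NM ME !mulmxA.
  have colj i : (invmx Q) i j = 0.
    rewrite -e mxE big1 // => l _; rewrite [D _ _]mxE.
    have [lj|] := eqVneq (l : nat) j; last by rewrite mulr0n mulr0.
    by rewrite lj dj mul0rn mulr0.
  have := mulmxV uQ => /matrixP/(_ j j); rewrite !mxE eqxx big1 //.
  by move=> i _; rewrite colj mulr0.
have DE (y : 'rV[int]_(r + k)) : y *m D = 0 <-> lsubmx y = 0.
  have yD j : (y *m D) 0 j = y 0 (lshift k j) * d`_j.
    rewrite mxE (bigD1 (lshift k j)) //= mxE eqxx mulr1n big1 ?addr0 // => i ij.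
    rewrite mxE; case: eqP => [e|]; last by rewrite mulr0n mulr0.
    by case/eqP: ij; apply: val_inj.
  split=> /rowP h0; apply/rowP => j; have := h0 j.
    by rewrite yD !mxE => /eqP; rewrite mulf_eq0 (negPf (d0 j)) orbF => /eqP.
  by rewrite yD !mxE => ->; rewrite mul0r.
pose w (x : A) : 'rV[int]_(r + k) := row_mx (f (x, 0)).2 (f (x, 0)).1.
have gw x : g (w x) = 0.
  by rewrite /g /w row_mxKl row_mxKr -surjective_pairing fK.
have wD x : w x *m P *m D = 0.
  apply: (can_inj (mulmxK uQ)); rewrite mul0mx.
  have : w x *m M = 0 by rewrite gE gw.
  by rewrite ME !mulmxA.
apply: (@zmod_iso_fun _ _ (fun x => rsubmx (w x *m P))).
- move=> x y; rewrite -raddfB -mulmxBl /w opp_row_mx add_row_mx.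
  have -> : (x - y, 0) = (x, 0) - (y, 0) :> A * 'rV[int]_r by congr pair; rewrite subr0.
  by rewrite raddfB.
- have inj0 x : rsubmx (w x *m P) = 0 -> x = 0.
    move=> r0; have /DE l0 := wD x.
    have wP0 : w x *m P = 0 by rewrite -[LHS]hsubmxK l0 r0 row_mx0.
    have : w x = 0 by apply: (can_inj (mulmxK uP)); rewrite wP0 mul0mx.
    rewrite /w -(row_mx0 _ 1 r k) => /eq_row_mx[e2 e1].
    have : f (x, 0) = 0 by rewrite [LHS]surjective_pairing e1 e2.
    by rewrite -(raddf0 f) => /(can_inj fK) [].
  move=> x y eqxy; apply/eqP; rewrite -subr_eq0; apply/eqP/inj0.
  have -> : w (x - y) = w x - w y.
    rewrite /w opp_row_mx add_row_mx.
    have -> : (x - y, 0) = (x, 0) - (y, 0) :> A * 'rV[int]_r by congr pair; rewrite subr0.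
    by rewrite raddfB.
  by rewrite mulmxBl raddfB /= eqxy subrr.
- move=> v; pose y : 'rV[int]_(r + k) := row_mx 0 v.
  pose x := y *m invmx P.
  have gx : g x = 0.
    rewrite -gE ME /x !mulmxA mulmxKV //.
    have /DE -> : lsubmx y = 0 by rewrite row_mxKl.
    by rewrite mul0mx.
  exists (f' (rsubmx x, lsubmx x)).1.
  have -> : w (f' (rsubmx x, lsubmx x)).1 = x.
    rewrite /w; have -> : ((f' (rsubmx x, lsubmx x)).1, 0) = f' (rsubmx x, lsubmx x).
      by rewrite [RHS]surjective_pairing -/(g x) gx.
    by rewrite fK' hsubmxK.
  by rewrite /x mulmxKV // row_mxKr.
Qed.

(** * Eigenvectors and norms in the image *)

Section Image.
Variables (L : nzRingType) (s : L).
Hypothesis sC : forall x : L, x * s = s * x.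
Local Notation R := (L^c).

Lemma imgS_closed (V : lmodType R) :
  submod_closed [pred x : V | `[< exists y, x = y *> s >]].
Proof.
split=> [|c x y /asboolP[x' ->] /asboolP[y' ->]]; apply/asboolP.
  by exists 0; rewrite ract0.
by exists (c *: x' + y'); have := linearP (rmulS sC V) c x' y' => /= ->.
Qed.

Lemma imgS_nat (U V : lmodType R) (f : {linear U -> V}) x :
  x \in submod_pred (Submodule (imgS_closed U)) ->
  f x \in submod_pred (Submodule (imgS_closed V)).
Proof.
by move=> /asboolP[y ->]; apply/asboolP; exists (f y); rewrite lin_ract.
Qed.

Definition imgS : subfunctor R := Subfunctor imgS_nat.

Lemma imgS_mem (V : lmodType R) (x : V) : x *> s \in submod_pred (imgS V).
Proof. by apply/asboolP; exists x. Qed.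

Definition to_imgS (V : lmodType R) (x : V) : imgS V := SubmodType (imgS_mem x).

Lemma to_imgS_linear (V : lmodType R) : linear (@to_imgS V).
Proof. by move=> c x y; apply: val_inj; exact: (linearP (rmulS sC V) c x y). Qed.

Lemma to_imgS_surj (V : lmodType R) (y : imgS V) : exists x, to_imgS x = y.
Proof.
by have /asboolP[x xE] := valP y; exists x; apply: val_inj; rewrite xE.
Qed.

Lemma to_imgS_ker (V : lmodType R) (x : V) : to_imgS x = 0 <-> x *> s = 0.
Proof.
by split=> [/(congr1 val) //|h]; apply: val_inj.
Qed.

(** The extension of K s by the elements of K killed by s. *)
Lemma annS_imgS_extension (B K Q : lmodType R) :
  lmod_iso B (annS sC K) -> lmod_iso (imgS K) Q ->
  exists (i : {linear B -> K}) (p : {linear K -> Q}), short_exact i p.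
Proof.
move=> [f [f' fK fK']] [g [g' gK gK']].
exists (mklin (linearP (submod_incl (annS sC K) \o f))).
exists (mklin (linearP (g \o mklin (@to_imgS_linear K)))).
split.
- by move=> x y /= /val_inj /(can_inj fK).
- by move=> q; have [x xE] := to_imgS_surj (g' q); exists x; rewrite /= xE gK'.
- move=> y; split=> [gy|[x <-]] /=.
    have /to_imgS_ker ys : to_imgS y = 0.
      by apply: (can_inj gK); rewrite linear0; exact: gy.
    have [z zE] := mem_annS sC ys.
    by exists (f' z); rewrite /= fK' zE.
  by have -> : to_imgS (val (f x)) = 0; [apply/to_imgS_ker; exact: annS_val|exact: linear0].
Qed.

End Image.

Section Eigen.
Variables (G : finGroupType) (chi : zcharacter G).
Local Notation R := ((zgring G)^c).

Lemma eigen_ract (V : lmodType R) (x : V) (l : zgring G) :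
  (forall g, x *> zg g = x *~ chi g) -> x *> l = x *~ zchar_ext chi l.
Proof.
move=> xg; elim/zg_ind: l => [|l l' hl hl'|l hl|g].
- by rewrite ract0r zchar_ext0.
- by rewrite ractDr hl hl' zchar_extD mulrzDr.
- by rewrite ractNr hl zchar_extN mulrNz.
- by rewrite xg zchar_ext_zg.
Qed.

Lemma eigS_closed (V : lmodType R) :
  submod_closed [pred x : V | `[< forall g, x *> zg g = x *~ chi g >]].
Proof.
split=> [|c x y /asboolP xg /asboolP yg]; apply/asboolP => g.
  by rewrite ract0 mul0rz.
by rewrite -[c *: x]/(x *> c) (eigen_ract c xg) ractDl ractMzl xg yg mulrzDl mulrzAC.
Qed.

Lemma eigS_nat (U V : lmodType R) (f : {linear U -> V}) x :
  x \in submod_pred (Submodule (eigS_closed U)) ->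
  f x \in submod_pred (Submodule (eigS_closed V)).
Proof.
by move=> /asboolP xg; apply/asboolP => g; rewrite -lin_ract xg raddfMz.
Qed.

Definition eigS : subfunctor R := Subfunctor eigS_nat.

Lemma eigS_val (V : lmodType R) (x : eigS V) g : val x *> zg g = val x *~ chi g.
Proof. by have /asboolP := valP x; apply. Qed.

Lemma mem_eigS (V : lmodType R) (x : V) : (forall g, x *> zg g = x *~ chi g) ->
  exists y : eigS V, val y = x.
Proof.
move=> xg; have xS : x \in submod_pred (eigS V) by apply/asboolP.
by exists (SubmodType xS).
Qed.

End Eigen.

Section EigenCancellation.
Variables (G : finGroupType) (chi : zcharacter G) (s : zgring G).
Hypothesis sC : forall x : zgring G, x * s = s * x.
Local Notation R := ((zgring G)^c).
Local Notation E V := (eigS chi (imgS sC V)).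

Lemma eigen_img_prod (U V : lmodType R) : lmod_iso (E (U * V)%type) (E U * E V)%type.
Proof. exact: lmod_iso_trans (subf_iso _ (subf_prod _ _ _)) (subf_prod _ _ _). Qed.

Lemma eigen_img_iso (U V : lmodType R) : lmod_iso U V -> lmod_iso (E U) (E V).
Proof. by move=> iso; do 2! apply: subf_iso. Qed.

Hypothesis free_rank1 : zmod_iso (E (R^o)) int.

Lemma eigen_img_row (V : lmodType R) r :
  zmod_iso (E (V * 'rV[R]_r)%type) (E V * 'rV[int]_r)%type.
Proof.
elim: r => [|r IH].
  apply: zmod_iso_trans (zmod_iso_row0 _ _).
  exact/lmod_iso_zmod/eigen_img_iso/lmod_iso_row0.
apply: zmod_iso_trans (lmod_iso_zmod (eigen_img_iso (lmod_iso_rowS _ _))) _.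
apply: zmod_iso_trans (lmod_iso_zmod (eigen_img_prod _ _)) _.
apply: zmod_iso_trans (zmod_iso_prod IH free_rank1) _.
exact/zmod_iso_sym/zmod_iso_rowS.
Qed.

(** The free summands contribute free abelian groups, which cancel. *)
Lemma eigen_img_cancel (K V : lmodType R) k r :
  zmod_iso (E V) 'rV[int]_k ->
  lmod_iso (K * 'rV[R]_r)%type (V * 'rV[R]_r)%type -> zmod_iso (E K) 'rV[int]_k.
Proof.
move=> rV iso; apply: (@zmod_cancel_row _ _ r).
apply: zmod_iso_trans (zmod_iso_sym (eigen_img_row K r)) _.
apply: zmod_iso_trans (lmod_iso_zmod (eigen_img_iso iso)) _.
apply: zmod_iso_trans (eigen_img_row V r) _.
exact: zmod_iso_prod rV (zmod_iso_refl _).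
Qed.

End EigenCancellation.

Section Norms.
Variables (L : nzRingType) (t : L).
Local Notation R := (L^c).

(** The vanishing of a Tate cohomology group of the involution t. *)
Definition fixed_are_norms (V : lmodType R) : Prop :=
  forall x : V, x *> t = x -> exists y, x = y *> (1 + t).

Lemma fixed_are_norms_prod (U V : lmodType R) :
  fixed_are_norms (U * V)%type <-> fixed_are_norms U /\ fixed_are_norms V.
Proof.
split=> [h|[hU hV] [u v] [ut vt]].
  split=> x xt.
    have [|[y1 y2] [yE _]] := h (x, 0); last by exists y1.
    by congr pair; [exact: xt|exact: ract0].
  have [|[y1 y2] [_ yE]] := h (0, x); last by exists y2.
  by congr pair; [exact: ract0|exact: xt].
by have [[y ->] [z ->]] := (hU _ ut, hV _ vt); exists (y, z).
Qed.

Lemma fixed_are_norms_iso (U V : lmodType R) : lmod_iso U V ->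
  fixed_are_norms U -> fixed_are_norms V.
Proof.
move=> [f [g fg gf]] hU x xt.
have [|y yE] := hU (g x).
  by apply: (can_inj fg); rewrite lin_ract gf xt.
by exists (f y); rewrite -lin_ract -yE gf.
Qed.

Lemma fixed_are_norms_row (S : subfunctor R) (V : lmodType R) r :
  fixed_are_norms (S (R^o)) -> fixed_are_norms (S V) ->
  fixed_are_norms (S (V * 'rV[R]_r)%type).
Proof.
move=> hR hV; elim: r => [|r IH].
  exact: fixed_are_norms_iso (lmod_iso_sym (subf_iso S (lmod_iso_row0 V))) hV.
apply: fixed_are_norms_iso (lmod_iso_sym (subf_iso S (lmod_iso_rowS V r))) _.
apply: fixed_are_norms_iso (lmod_iso_sym (subf_prod S _ _)) _.
exact/fixed_are_norms_prod.
Qed.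

Lemma fixed_are_norms_stable (S : subfunctor R) (K V : lmodType R) r :
  fixed_are_norms (S (R^o)) ->
  lmod_iso (K * 'rV[R]_r)%type (V * 'rV[R]_r)%type ->
  fixed_are_norms (S K) -> fixed_are_norms (S V).
Proof.
move=> hR iso hK.
have := fixed_are_norms_iso (subf_iso S iso) (fixed_are_norms_row (r := r) hR hK).
by move=> /(fixed_are_norms_iso (subf_prod S _ _)) /fixed_are_norms_prod[].
Qed.

End Norms.

Lemma intN_eq (x : int) : - x = x -> x = 0. Proof. lia. Qed.

Section Concrete.
Variable n : nat.
Hypothesis n_gt0 : (0 < n)%N.
Local Notation D := (dihedral n).
Local Notation Lam := (Lam n).
Local Notation R := (Lam^c).
Local Notation dr := (dihedral_ring_zgring n_gt0).
Local Notation sC := (dr_sC dr).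
Local Notation a := (zg (da n) : Lam).
Local Notation b := (zg (db n) : Lam).
Local Notation s := (Sig n).
Local Notation Q := (Ztriv n * ZT n * ZT n)%type.

Lemma imgS_J_iso : lmod_iso (imgS sC (J n)) Q.
Proof.
apply: (@same_kernel_iso _ (J n) _ _ (mklin (@to_imgS_linear _ _ sC (J n)))
   (mklin (J_proj_linear n_gt0))).
- exact: to_imgS_surj.
- exact: J_proj_surj.
- move=> x; apply: iff_trans (to_imgS_ker _ x) _.
  exact: iff_sym (J_proj_ker n_gt0 x).
Qed.

(** The characters of D trivial on the rotations. *)
Definition flip_char (chi : zcharacter D) := exists2 e : int,
  e * e = 1 & forall g, chi g = if dih_flip g then e else 1.

Lemma triv_flip_char : flip_char (triv_char D).
Proof. by exists 1 => // g; rewrite if_same. Qed.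

Lemma sign_flip_char : flip_char (sign_char n).
Proof. by exists (-1) => // -[i []]. Qed.

(** Rotations act trivially on K s, which is a module over the quotient by the
    rotations, of order two. *)
Lemma imgS_rot (V : lmodType R) (x : imgS sC V) i : x *> zg (Dihedral i false : D) = x.
Proof.
have /asboolP[y yE] := valP x.
have e : s * zg (Dihedral i false : D) = s.
  by apply/ffunP => g; rewrite zg_mulr !SigE // rotV; case: g => j [].
by apply: val_inj; rewrite sub_ract yE ractA e.
Qed.

Lemma imgS_flip (V : lmodType R) (x : imgS sC V) i : x *> zg (Dihedral i true : D) = x *> b.
Proof.
have -> : (Dihedral i true : D) = (Dihedral i false * db n)%g.
  by rewrite rotfM addr0.
by rewrite zgM -ractA imgS_rot.
Qed.

(** The eigenvectors of Lam s are the integer multiples of the element with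
    coefficients chi. *)
Lemma eigen_regular chi : flip_char chi -> zmod_iso (eigS chi (imgS sC (R^o))) int.
Proof.
move=> [e ee chiE]; apply: zmod_iso_sym.
pose N : Lam := (1 + b *~ e) * s.
have NE g : N g = chi g.
  rewrite /N mulrDl mul1r mulrzAl zgDE zgMzE zg_mull !SigE //.
  by rewrite chiE; case: g => i [] /=; rewrite ?mul1r ?add0r ?mul0r ?addr0.
have NN g : N * zg g = N *~ chi g.
  apply/ffunP => h; rewrite zg_mulr zgMzE !NE !chiE.
  by case: g => i []; case: h => j []; rewrite /= ?mul1r ?mulr1 ?ee.
have [x xE] : exists x : imgS sC (R^o), val x = N.
  by have [] := (to_imgS sC (1 + b *~ e : R^o), erefl N); exists (to_imgS sC (1 + b *~ e : R^o)).
have [z zE] : exists z : eigS chi (imgS sC (R^o)), val z = x.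
  apply: mem_eigS => g; apply: (@submod_incl_inj _ _ (imgS sC (R^o))).
  by rewrite lin_ract raddfMz /= xE; exact: NN.
pose lift (w : eigS chi (imgS sC (R^o))) : Lam := val (val w).
have liftMz w k : lift (w *~ k) = lift w *~ k.
  by rewrite /lift (raddfMz (submod_incl (eigS chi _))) (raddfMz (submod_incl (imgS sC (R^o)))).
have lift_inj w w' : lift w = lift w' -> w = w' by move=> /val_inj/val_inj.
have lz : lift z = N by rewrite /lift zE xE.
apply: (@zmod_iso_fun _ _ (fun k => z *~ k)).
- by move=> k l; rewrite mulrzBr.
- move=> k l /(congr1 lift); rewrite !liftMz lz => /(congr1 (fun u : Lam => u 1%g)).
  by rewrite !zgMzE NE zchar1 !mul1r.
- move=> w; exists (lift w 1%g); apply: lift_inj; rewrite liftMz lz.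
  apply/ffunP => g; rewrite zgMzE NE.
  have wg : lift w * zg g = lift w *~ chi g.
    have := congr1 val (eigS_val w g).
    by rewrite sub_ract (raddfMz (submod_incl (imgS sC (R^o)))).
  have := congr1 (fun u : Lam => u g) wg; rewrite zg_mulr mulgV zgMzE => ->.
  by rewrite mulrCA chiE; case: (dih_flip g); rewrite ?ee !mulr1.
Qed.

Lemma fixed_are_norms_regular : fixed_are_norms b (imgS sC (R^o)).
Proof.
move=> x xb; have [y yE] := to_imgS_surj x.
pose l : Lam := y; pose k : int := csum false l.
have h t : csum t l = k.
  have e : l * s * b = l * s by have := congr1 val xb; rewrite -yE.
  case: t => //; rewrite -(mulSE n_gt0 l (Dihedral 0 true)) -Sig_central //.
  rewrite -e zg_mulr Sig_central // mulSE //.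
exists (to_imgS sC (1 *~ k : R^o)); apply: val_inj; rewrite -yE.
have e : l * s = (1 *~ k) * s * (1 + b).
  apply/ffunP => g; rewrite Sig_central // mulSE // h mulrzAl mul1r.
  rewrite mulrzAl mulrDr mulr1 zgMzE zgDE zg_mulr !SigE //.
  by case: g => i []; rewrite /= ?add0r ?addr0 mul1r.
exact: e.
Qed.

Lemma not_fixed_are_norms_Q : ~ fixed_are_norms b Q.
Proof.
move=> h; have [|[[y1 y2] y3]] := h ((1 : int), (0 : int), (0 : int)).
  rewrite -[LHS]/((((1 : int) : Ztriv n) *> b), (((0 : int) : ZT n) *> b), (((0 : int) : ZT n) *> b)).
  by rewrite !Ztwist_zg.
move=> /(congr1 (fun q : Q => q.1.1)).
rewrite -[RHS]/(y1 *> (1 + b)) ractDr ract1r Ztwist_zg /= mulr1 => e.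
have : (1 : int) = (y1 : int) + (y1 : int) by exact: e.
lia.
Qed.

Lemma Q_zg (q : Q) g :
  q *> zg g = if dih_flip g then (q.1.1, - q.1.2, - q.2) else q.
Proof.
case: q => [[x y] z].
rewrite -[LHS]/((x *> zg g, y *> zg g), z *> zg g) !Ztwist_zg.
case: g => i [] /=; rewrite !mulr1 //.
by rewrite /= expr1 !mulrN1.
Qed.

End Concrete.

(** * The exact sequence *)

Section Concrete.
Variable n : nat.
Hypothesis n_gt0 : (0 < n)%N.
Local Notation D := (dihedral n).
Local Notation Lam := (Lam n).
Local Notation R := (Lam^c).
Local Notation dr := (dihedral_ring_zgring n_gt0).
Local Notation sC := (dr_sC dr).
Local Notation a := (zg (da n) : Lam).
Local Notation b := (zg (db n) : Lam).
Local Notation s := (Sig n).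
Local Notation Q := (Ztriv n * ZT n * ZT n)%type.

Lemma eigen_Q_triv : zmod_iso (eigS (triv_char D) Q) 'rV[int]_1.
Proof.
have v0 (x : eigS (triv_char D) Q) : (val x).1.2 = 0 /\ (val x).2 = 0.
  have := eigS_val x (db n); rewrite Q_zg /= mulr1z; case: (submod_val x) => [[p q] r] [eq er].
  by split; apply: intN_eq.
pose c (q : Q) : 'rV[int]_1 := \row__ (q.1.1 : int).
have cB (p q : Q) : c (p - q) = c p - c q by apply/rowP => i; rewrite !mxE.
have cE (q : Q) : c q 0 0 = q.1.1 by rewrite mxE.
apply: (@zmod_iso_fun _ _ (fun x => c (submod_incl (eigS (triv_char D) Q) x))).
- by move=> x y; rewrite raddfB cB.
- move=> x y /rowP/(_ 0); rewrite !cE => e; apply: val_inj.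
  have [x1 x2] := v0 x; have [y1 y2] := v0 y; move: e x1 x2 y1 y2 => /=.
  case: (submod_val x) => [[p q] r]; case: (submod_val y) => [[p' q'] r'] /=.
  by move=> -> -> -> -> ->.
- move=> w; have [|x xE] := @mem_eigS _ (triv_char D) Q ((w 0 0 : Ztriv n), (0 : ZT n), (0 : ZT n)).
    by move=> g; rewrite Q_zg mulr1z /= !oppr0 if_same.
  by exists x; apply/rowP => i; rewrite /= xE (ord1 i) cE.
Qed.

Lemma eigen_Q_sign : zmod_iso (eigS (sign_char n) Q) 'rV[int]_2.
Proof.
have v0 (x : eigS (sign_char n) Q) : (val x).1.1 = 0.
  have := eigS_val x (db n); rewrite Q_zg /= expr1 mulrN1z.
  case: (submod_val x) => [[p q] r] /(congr1 (fun w : Q => w.1.1)) /= ep.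
  exact: intN_eq (esym ep).
pose c (q : Q) : 'rV[int]_2 := \row_i (if i == 0 then (q.1.2 : int) else (q.2 : int)).
have cB (p q : Q) : c (p - q) = c p - c q by apply/rowP => i; rewrite !mxE; case: ifP.
have c0 (q : Q) : c q 0 0 = q.1.2 by rewrite mxE.
have c1 (q : Q) : c q 0 1 = q.2 by rewrite mxE.
apply: (@zmod_iso_fun _ _ (fun x => c (submod_incl (eigS (sign_char n) Q) x))).
- by move=> x y; rewrite raddfB cB.
- move=> x y /rowP e; have := e 1; have := e 0; rewrite !c0 !c1 => e0 e1.
  apply: val_inj; have := v0 x; have := v0 y; move: e0 e1 => /=.
  case: (submod_val x) => [[p q] r]; case: (submod_val y) => [[p' q'] r'] /=.
  by move=> -> -> -> ->.
- move=> w; have [|x xE] := @mem_eigS _ (sign_char n) Q ((0 : Ztriv n), (w 0 0 : ZT n), (w 0 1 : ZT n)).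
    by move=> g; rewrite Q_zg /=; case: (dih_flip g); rewrite ?expr1 ?mulrN1z ?expr0 ?mulr1z.
  exists x; apply/rowP => i; rewrite /= xE; case: i => -[|[|//]] lt.
    by rewrite (_ : Ordinal lt = 0) ?c0 //; apply: val_inj.
  by rewrite (_ : Ordinal lt = 1) ?c1 //; apply: val_inj.
Qed.

(** A module K s whose fixed points have rank one and antifixed points rank two
    is Q as soon as some fixed point is not a norm.  With u a generator of the
    fixed points, the norm of every y is an even multiple 2 k u, since otherwise
    u would be a norm and all fixed points would be; then y - k u is antifixed,
    so the fixed and the antifixed points together span. *)
Lemma imgS_assemble (K : rmodType Lam) :
  zmod_iso (eigS (triv_char D) (imgS sC K)) 'rV[int]_1 ->
  zmod_iso (eigS (sign_char n) (imgS sC K)) 'rV[int]_2 ->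
  ~ fixed_are_norms b (imgS sC K) -> lmod_iso Q (imgS sC K).
Proof.
set Y := imgS sC K => [[f [f' fK fK']]] [g [g' gK gK']] nfan.
have fixE (y : Y) : y *> b = y -> exists z : eigS (triv_char D) Y, val z = y.
  move=> yb; apply: mem_eigS => -[i []] /=; rewrite mulr1z ?imgS_rot //.
  by rewrite imgS_flip.
have antiE (y : Y) : y *> b = - y -> exists z : eigS (sign_char n) Y, val z = y.
  move=> yb; apply: mem_eigS => -[i []] /=; rewrite ?expr1 ?expr0 ?mulrN1z ?mulr1z ?imgS_rot //.
  by rewrite imgS_flip.
have f'Mz x k : f' (x *~ k) = f' x *~ k by apply: (can_inj fK); rewrite raddfMz !fK'.
have g'Mz x k : g' (x *~ k) = g' x *~ k by apply: (can_inj gK); rewrite raddfMz !gK'.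
have g'D x y : g' (x + y) = g' x + g' y by apply: (can_inj gK); rewrite raddfD !gK'.
(* bases u of the fixed points and v1, v2 of the antifixed points *)
pose u : Y := val (f' (const_mx 1)).
have uP y : y *> b = y -> exists k : int, y = u *~ k.
  move=> /fixE[z <-]; exists (f z 0 0).
  rewrite /u -(raddfMz (submod_incl (eigS (triv_char D) Y))) /= -f'Mz.
  rewrite -[in LHS](fK z); congr (val (f' _)); apply/rowP => i.
  by rewrite (ord1 i) -scaler_int !mxE intz mulr1.
have ub : u *> b = u by have := eigS_val (f' (const_mx 1)) (db n); rewrite mulr1z.
have u_free k : u *~ k = 0 -> k = 0.
  rewrite /u -(raddfMz (submod_incl (eigS (triv_char D) Y))) /= -f'Mz => e.
  have : f' (const_mx 1 *~ k) = 0 by apply: val_inj; exact: e.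
  move=> /(congr1 f); rewrite fK' raddf0 => /rowP/(_ 0).
  by rewrite -scaler_int !mxE intz mulr1.
pose v i : Y := val (g' (delta_mx 0 i)).
pose vv (k l : int) := v 0 *~ k + v 1 *~ l.
have vvE k l : vv k l = val (g' (delta_mx 0 0 *~ k + delta_mx 0 1 *~ l)).
  by rewrite g'D !g'Mz submod_valD !(raddfMz (submod_incl (eigS (sign_char n) Y))).
have vb i : v i *> b = - v i.
  by have := eigS_val (g' (delta_mx 0 i)) (db n); rewrite /= expr1 mulrN1z.
have dE (k l : int) : (delta_mx 0 0 *~ k + delta_mx 0 1 *~ l : 'rV[int]_2) =
    \row_i (if i == 0 then k else l).
  apply/rowP => i; rewrite -!scaler_int !mxE !intz.
  by case: i => -[|[|//]] lt; rewrite /= ?mulr1 ?mulr0 ?addr0 ?add0r.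
have vP y : y *> b = - y -> exists k l : int, y = vv k l.
  move=> /antiE[z <-]; exists (g z 0 0), (g z 0 1); rewrite vvE dE.
  rewrite -[in LHS](gK z); congr (val (g' _)); apply/rowP => i; rewrite mxE.
  by case: i => -[|[|//]] lt /=; congr (g z _ _); apply: val_inj.
have v_free k l : vv k l = 0 -> k = 0 /\ l = 0.
  rewrite vvE dE => e.
  have : g' (\row_i (if i == 0 then k else l)) = 0 by apply: val_inj; exact: e.
  by move=> /(congr1 g); rewrite gK' raddf0 => /rowP h; have := h 0; have := h 1; rewrite !mxE /=.
(* every norm is an even multiple of u *)
have evenP y : exists k : int, y *> (1 + b) = u *~ (2 * k).
  have [|k kE] := uP (y *> (1 + b)).
    by rewrite ractA mulrDl mul1r (dr_bb dr) addrC.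
  have [j [kj|kj]] : exists j : int, k = 2 * j \/ k = 2 * j + 1.
    by exists (k %/ 2)%Z; have := divz_eq k 2; have := modz_ge0 k (isT : 2 != 0 :> int);
       have := ltz_mod k (isT : 2 != 0 :> int); lia.
    by exists j; rewrite kE kj.
  have uu : (y - u *~ j) *> (1 + b) = u.
    rewrite ractDl kE ractNl ractMzl ractDr ract1r ub kj mulrzDr mulr1z mulrzA.
    by rewrite -[u + u]/(u *~ 2) addrAC subrr add0r.
  by case: nfan => x /uP[l ->]; exists ((y - u *~ j) *~ l); rewrite ractMzl uu.
pose h (q : Q) : Y := u *~ (q.1.1 : int) + vv q.1.2 q.2.
have vvD k l k' l' : vv (k - k') (l - l') = vv k l - vv k' l'.
  by rewrite /vv !mulrzBr addrACA -opprD.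
have vvN k l : vv (- k) (- l) = - vv k l by rewrite /vv !mulrNz opprD.
have vvb k l : vv k l *> b = - vv k l.
  by rewrite /vv ractDl !ractMzl !vb !mulNrz opprD.
have hB : zmod_morphism h.
  by move=> p q; rewrite /h vvD mulrzBr addrACA -opprD.
have hg q g0 : h (q *> zg g0) = h q *> zg g0.
  rewrite Q_zg; case: g0 => i []; rewrite ?imgS_rot ?imgS_flip //=.
  by rewrite /h vvN ractDl ractMzl ub vvb.
have h_inj q : h q = 0 -> q = 0.
  case: q => [[x y] z] h0.
  have x0 : (x : int) = 0.
    have : h (x, y, z) + h (x, y, z) *> b = 0 by rewrite h0 ract0 addr0.
    rewrite /h ractDl ractMzl ub vvb addrACA subrr addr0 -mulrzDr => /u_free.
    by rewrite /=; move: (x : int) => k; lia.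
  have [y0 z0] : (y : int) = 0 /\ (z : int) = 0.
    by apply: v_free; move: h0; rewrite /h /= x0 mulr0z add0r.
  by rewrite x0 y0 z0.
apply: (@lmod_iso_fun _ _ _ h (zg_additive_linear hB hg)).
  move=> p q e; apply/eqP; rewrite -subr_eq0; apply/eqP/h_inj.
  by rewrite hB e subrr.
move=> y; have [k kE] := evenP y.
have [|i [j ij]] := vP (y - u *~ k).
  apply/eqP; rewrite -addr_eq0 addrC -[X in X + _]ract1r -ractDr.
  rewrite ractDl kE ractNl ractMzl ractDr ract1r ub mulrzA.
  by rewrite -[u + u]/(u *~ 2) subrr.
by exists (k : Ztriv n, i : ZT n, j : ZT n); rewrite /h /= -ij addrC subrK.
Qed.

(** The two ranks and the existence of a fixed point which is not a norm are
    invariant under stable isomorphism, so they are read off from J. *)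
Lemma imgS_minimal_iso (K : rmodType Lam) :
  stably_equivalent K (J n) -> same_zrank K (J n) -> lmod_iso (imgS sC K) Q.
Proof.
move=> [r [r' iso]] rk; have rr := stable_rank_eq rk iso; subst r'.
have E chi k : flip_char chi -> zmod_iso (eigS chi Q) 'rV[int]_k ->
    zmod_iso (eigS chi (imgS sC K)) 'rV[int]_k.
  move=> fc rQ; apply: (eigen_img_cancel (eigen_regular n_gt0 fc) _ iso).
  exact: zmod_iso_trans (lmod_iso_zmod (subf_iso _ (imgS_J_iso n_gt0))) rQ.
apply: lmod_iso_sym; apply: imgS_assemble.
- exact: E (triv_flip_char n) eigen_Q_triv.
- exact: E (sign_flip_char n) eigen_Q_sign.
- move=> fK.
  have fJ := fixed_are_norms_stable (@fixed_are_norms_regular n n_gt0) iso fK.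
  exact: (@not_fixed_are_norms_Q n) (fixed_are_norms_iso (imgS_J_iso n_gt0) fJ).
Qed.

Theorem minimal_extension (K : rmodType Lam) :
  stably_equivalent K (J n) -> same_zrank K (J n) ->
  exists (i : {linear mul_a_sub1 (W2T n * R^o)%type -> K}) (p : {linear K -> Q}),
    short_exact i p.
Proof.
move=> st rk.
exact: (annS_imgS_extension (annS_minimal_iso n_gt0 st rk) (imgS_minimal_iso st rk)).
Qed.

End Concrete.

(** * Extensions and crossed homomorphisms *)

From mathcomp.multinomials Require Import freeg.
From mathcomp Require Import ring.

Section ExtQuotient.
Variables (R : nzRingType) (A B : lmodType R).

Lemma ext1_iso (T : zmodType) (Phi : Defs.Hom (syzygy A) B -> T) :
  zmod_morphism Phi -> (forall t, exists f, Phi f = t) ->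
  (forall f, Phi f = 0 <-> f \in @extendable R A B) -> zmod_iso (Ext1 A B) T.
Proof.
move=> PB Psurj Pker.
pose pr (f : Defs.Hom (syzygy A) B) : Ext1 A B := \pi_(Ext1 A B)%qT f.
have prE f g : pr f = pr g <-> Phi f = Phi g.
  split=> [/eqP|e].
    rewrite -(Quotient.idealrBE (extendable (A := A) (B := B))) => /Pker.
    by rewrite PB => /subr0_eq.
  apply/eqP; rewrite -(Quotient.idealrBE (extendable (A := A) (B := B))).
  by apply/Pker; rewrite PB e subrr.
have prB f g : pr (f - g) = pr f - pr g.
  exact: (raddfB (\pi_(Ext1 A B)%qT)).
have prR (x : Ext1 A B) : pr (generic_quotient.repr x) = x by exact: generic_quotient.reprK.
apply: (@zmod_iso_fun _ _ (fun x : Ext1 A B => Phi (generic_quotient.repr x))).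
- by move=> x y; rewrite -PB; apply/prE; rewrite prB !prR.
- by move=> x y /prE; rewrite !prR.
- by move=> t; have [f <-] := Psurj t; exists (pr f); apply/prE; rewrite prR.
Qed.

Lemma freegZ (k : R) (x : A) : k *: << x >> = << k *g x >> :> {freeg A / R}.
Proof. by apply/eqP/freeg_eqP => y; rewrite coeffZ !coeffU mulrA mulr1. Qed.

Definition basis (x : A) : free_cover A := << x >>.

Lemma cover_basis x : free_cover_map (basis x) = x.
Proof. by rewrite /free_cover_map liftU scale1r. Qed.

Lemma free_lift_linear (V : lmodType R) (t : A -> V) :
  linear (fglift t : free_cover A -> V).
Proof.
pose F := mkadd (@lift_is_additive R A V t).
have FE u : fglift t u = F u by [].
have FZ c (u : free_cover A) : F (c *: u) = c *: F u.
  rewrite -[in LHS](freeg_sumE u) scaler_sumr (raddf_sum F).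
  rewrite -[in RHS](freeg_sumE u) (raddf_sum F) scaler_sumr.
  apply: eq_bigr => x _; rewrite -freegZ scalerA freegZ -!FE freegZ.
  by rewrite !liftU scalerA.
by move=> c u v; rewrite !FE (raddfD F) FZ.
Qed.

Definition free_lift (V : lmodType R) (t : A -> V) : {linear free_cover A -> V} :=
  mklin (free_lift_linear t).

Lemma free_lift_basis (V : lmodType R) (t : A -> V) x : free_lift t (basis x) = t x.
Proof. by rewrite /= liftU scale1r. Qed.

Lemma free_lift_ext (V : lmodType R) (f g : {linear free_cover A -> V}) :
  (forall x, f (basis x) = g (basis x)) -> forall u, f u = g u.
Proof.
move=> fg u; rewrite -[u]freeg_sumE !linear_sum; apply: eq_bigr => x _.
by rewrite -freegZ !linearZ /=; congr (_ *: _); exact: fg.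
Qed.

Lemma mem_syzygy (u : free_cover A) : free_cover_map u = 0 ->
  exists z : syzygy A, val z = u.
Proof.
move=> u0; have uS : u \in submod_pred (syzygy A) by rewrite inE; apply/eqP.
by exists (SubmodType uS).
Qed.

Lemma syzygyP (z : syzygy A) : free_cover_map (val z) = 0.
Proof. by apply/eqP; have := valP z; rewrite inE. Qed.

Lemma Hom_linear (U : lmodType R) (f : Defs.Hom U B) : linear f.
Proof. by apply/asboolP; exact: (valP f). Qed.

Lemma mkHom (U : lmodType R) (f : U -> B) : linear f -> exists h : Defs.Hom U B, forall x, h x = f x.
Proof.
move=> lf; have fH : f \in hom_pred (U := U) (V := B) by apply/asboolP.
by exists (MkHom fH).
Qed.

End ExtQuotient.

Section CrossedHoms.
Variables (G : finGroupType).
Local Notation L := (zgring G).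
Implicit Types (chi : zcharacter G).

(** These are the derivations of G into Hom(Z_chi, B), written without the
    identification of that group with B. *)
Definition crossed chi (B : rmodType L) (E : G -> B) : Prop :=
  forall g h, E (g * h)%g = E g *> zg h + E h *~ chi g.

Definition principal chi (B : rmodType L) (E : G -> B) : Prop :=
  exists m : B, forall g, E g = m *> zg g - m *~ chi g.

(** The group of crossed homomorphisms modulo principal ones is V, through an
    additive invariant defined on all maps G -> B. *)
Definition H1_iso chi (B : rmodType L) (V : zmodType) : Prop :=
  exists Th : (G -> B) -> V,
    [/\ forall E E', Th (fun g => E g - E' g) = Th E - Th E',
        forall E, crossed chi E -> (Th E = 0 <-> principal chi E)
      & forall v, exists2 E, crossed chi E & Th E = v].

Lemma H1_iso_prod chi (B B' : rmodType L) (V V' : zmodType) :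
  H1_iso chi B V -> H1_iso chi B' V' ->
  H1_iso chi (B * B')%type (V * V')%type.
Proof.
move=> [Th [ThB Thker Thsurj]] [Th' [Th'B Th'ker Th'surj]].
exists (fun E => (Th (fst \o E), Th' (snd \o E))); split.
- by move=> E E'; congr pair; [exact: ThB|exact: Th'B].
- move=> E cE.
  have c1 : crossed chi (fst \o E).
    by move=> g h; rewrite /= cE [(_ + _).1]/= ; congr (_ + _); exact: (raddfMz fst).
  have c2 : crossed chi (snd \o E).
    by move=> g h; rewrite /= cE [(_ + _).2]/= ; congr (_ + _); exact: (raddfMz snd).
  split=> [[/(Thker _ c1)[m mE] /(Th'ker _ c2)[m' m'E]]|[[m m'] mE]].
    exists (m, m') => g; rewrite [LHS]surjective_pairing.
    rewrite -[(E g).1]/((fst \o E) g) -[(E g).2]/((snd \o E) g) mE m'E.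
    by congr pair => /=; congr (_ - _); [rewrite (raddfMz fst)|rewrite (raddfMz snd)].
  congr pair.
    by apply/(Thker _ c1); exists m => g; rewrite /= mE /= (raddfMz fst).
  by apply/(Th'ker _ c2); exists m' => g; rewrite /= mE /= (raddfMz snd).
- move=> [v v']; have [E cE <-] := Thsurj v; have [E' cE' <-] := Th'surj v'.
  exists (fun g => (E g, E' g)) => // g h; rewrite cE cE'.
  by congr pair; rewrite /= ?(raddfMz fst) ?(raddfMz snd).
Qed.

Lemma H1_iso_lmod chi (B B' : rmodType L) V : lmod_iso B B' ->
  H1_iso chi B' V -> H1_iso chi B V.
Proof.
move=> [f [f' fK fK']] [Th [ThB Thker Thsurj]].
have lf' : linear f' by move=> c x y; apply: (can_inj fK); rewrite linearP !fK'.
pose f'' := mklin lf'.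
exists (fun E => Th (f \o E)); split.
- move=> E E'; rewrite -ThB; congr Th; apply: funext => g /=; exact: linearB.
- move=> E cE.
  have cf : crossed chi (f \o E) by move=> g h; rewrite /= cE linearD lin_ract raddfMz.
  apply: iff_trans (Thker _ cf) _; split=> [[m mE]|[m mE]].
    exists (f' m) => g; apply: (can_inj fK).
    rewrite [RHS](linearB f) (lin_ract f) (raddfMz f).
    by have := mE g; rewrite -{1 2}(fK' m).
  by exists (f m) => g; rewrite /= mE (linearB f) (lin_ract f) (raddfMz f).
- move=> v; have [E cE <-] := Thsurj v; exists (f'' \o E).
    by move=> g h; rewrite -[LHS]/(f'' (E (g * h)%g)) cE (linearD f'') (lin_ract f'') (raddfMz f'').
  by congr Th; apply: funext => g /=; rewrite fK'.
Qed.

End CrossedHoms.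

(** * Extensions of a module with a basis of eigenvectors *)

Lemma zg_morph_eq (G : finGroupType) (V : zmodType) (f f' : zgring G -> V) :
  zmod_morphism f -> zmod_morphism f' -> (forall g, f (zg g) = f' (zg g)) ->
  forall l, f l = f' l.
Proof.
move=> fB f'B ff' l; rewrite (zg_sum l) (morph_sum fB) (morph_sum f'B).
by apply: eq_bigr => g _; rewrite (morph_Mz fB) (morph_Mz f'B) ff'.
Qed.

Section CrossedExtension.
Variables (G : finGroupType) (chi : zcharacter G).
Local Notation L := (zgring G).
Variable B : rmodType L.
Implicit Types (E : G -> B) (l : L).

(** The additive extension of E to the group ring. *)
Definition zg_ext E l : B := \sum_g E g *~ l g.

Lemma zg_extD E l l' : zg_ext E (l + l') = zg_ext E l + zg_ext E l'.
Proof. by rewrite -big_split; apply: eq_bigr => g _; rewrite zgDE mulrzDr. Qed.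

Lemma zg_extN E l : zg_ext E (- l) = - zg_ext E l.
Proof. by rewrite -sumrN; apply: eq_bigr => g _; rewrite zgNE mulrNz. Qed.

Lemma zg_extB E l l' : zg_ext E (l - l') = zg_ext E l - zg_ext E l'.
Proof. by rewrite zg_extD zg_extN. Qed.

Lemma zg_ext_zg E g : zg_ext E (zg g) = E g.
Proof.
rewrite /zg_ext (bigD1 g) //= big1 => [|h /negPf hg]; rewrite zgE ?hg ?mulr0z //.
by rewrite eqxx mulr1z addr0.
Qed.

Lemma zg_ext_crossed E l h : crossed chi E ->
  zg_ext E (l * zg h) = zg_ext E l *> zg h + E h *~ zchar_ext chi l.
Proof.
move=> cE; elim/zg_ind: l => [|l l' hl hl'|l hl|g].
- have e0 : zg_ext E 0 = 0 by rewrite -(subrr (0 : L)) zg_extB subrr.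
  by rewrite mul0r e0 ract0 zchar_ext0 mulr0z addr0.
- by rewrite mulrDl !zg_extD hl hl' zchar_extD mulrzDr ractDl addrACA.
- by rewrite mulNr !zg_extN hl zchar_extN mulrNz ractNl opprD.
- by rewrite -zgM !zg_ext_zg cE zchar_ext_zg.
Qed.

Lemma crossed1 E : crossed chi E -> E 1%g = 0.
Proof.
move=> /(_ 1%g 1%g); rewrite mulg1 zchar1 mulr1z ract1r => e.
by apply: (addrI (E 1%g)); rewrite -e addr0.
Qed.

End CrossedExtension.

Section ExtCharacters.
Variables (G : finGroupType) (I : finType) (chi : I -> zcharacter G).
Local Notation L := (zgring G).
Variables (A B : rmodType L).
(* A is free over Z on the eigenvectors q k, with coordinates c k *)
Variables (q : I -> A) (c : I -> A -> int).
Hypothesis q_eigen : forall k g, q k *> zg g = q k *~ chi k g.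
Hypothesis c_additive : forall k, zmod_morphism (c k).
Hypothesis qK : forall x, x = \sum_k q k *~ c k x.
Hypothesis c_q : forall k j, c k (q j) = (k == j)%:R.

Local Notation F := (free_cover A).
Local Notation chx k := (zchar_ext (chi k)).

Let cov : {linear F -> A} := @free_cover_map L^c A.
Let lift_c k : {linear F -> L^c^o} := free_lift (fun x : A => (1 *~ c k x : L^c^o)).

Let c0 k : c k 0 = 0.
Proof. by rewrite -(subrr (0 : A)) c_additive subrr. Qed.

Lemma lift_c_basis k x : lift_c k (basis x) = 1 *~ c k x :> L.
Proof.
exact: (@free_lift_basis L^c A L^c^o (fun x : A => (1 *~ c k x : L^c^o)) x).
Qed.

Lemma cov_lift_c u : cov u = \sum_k q k *> lift_c k u.
Proof.
have lS : linear (fun u : F => \sum_k q k *> lift_c k u).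
  move=> d x y; rewrite scaler_sumr -big_split; apply: eq_bigr => k _.
  by rewrite linearP ractDr; congr (_ + _); rewrite -[RHS]/((_ *> _) *> _) ractA.
apply: (free_lift_ext (g := mklin lS)) => x; rewrite -[LHS]/(free_cover_map (basis x)).
rewrite cover_basis [LHS]qK; apply: eq_bigr => k _.
by rewrite lift_c_basis ract1Mz.
Qed.

Lemma c_cov k u : c k (cov u) = chx k (lift_c k u).
Proof.
rewrite cov_lift_c (morph_sum (c_additive k)) (bigD1 k) //=.
rewrite (eigen_ract _ (q_eigen k)) (morph_Mz (c_additive k)) c_q eqxx.
rewrite big1 ?addr0 => [|j jk]; first by rewrite intz.
rewrite (eigen_ract _ (q_eigen j)) (morph_Mz (c_additive k)) c_q.
by rewrite eq_sym (negPf jk) mul0rz.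
Qed.

(** For u in the syzygy, u is the sum of this element and of elements
    [q k] (l - chi k l), because the lifts of its coordinates have zero
    augmentation. *)
Lemma split_closed u :
  cov (u - \sum_k basis (q k) *> lift_c k u) = 0.
Proof.
rewrite linearB linear_sum {1}cov_lift_c; apply/eqP; rewrite subr_eq0; apply/eqP.
by apply: eq_bigr => k _; rewrite lin_ract; congr (_ *> _); rewrite [RHS]cover_basis.
Qed.

Lemma gen_closed k l : cov (basis (q k) *> (l - 1 *~ chx k l)) = 0.
Proof.
rewrite lin_ract [X in X *> _]cover_basis ractDr ractNr ract1Mz.
by rewrite (eigen_ract _ (q_eigen k)) subrr.
Qed.

Let sp u : syzygy A := projT1 (cid (mem_syzygy (split_closed u))).
Let spE u : val (sp u) = u - \sum_k basis (q k) *> lift_c k u.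
Proof. exact: projT2 (cid (mem_syzygy (split_closed u))). Qed.
Let zt k l : syzygy A := projT1 (cid (mem_syzygy (gen_closed k l))).
Let ztE k l : val (zt k l) = basis (q k) *> (l - 1 *~ chx k l).
Proof. exact: projT2 (cid (mem_syzygy (gen_closed k l))). Qed.

Lemma sp_linear : linear sp.
Proof.
move=> d x y; apply: val_inj; rewrite submod_valD submod_valZ !spE.
rewrite scalerBr addrACA -opprD; congr (_ - _).
rewrite scaler_sumr -big_split; apply: eq_bigr => k _.
by rewrite linearP ractDr; congr (_ + _); rewrite -[RHS]/((_ *> _) *> _) ractA.
Qed.

Lemma ztB k l l' : zt k (l - l') = zt k l - zt k l'.
Proof.
apply: val_inj; rewrite [RHS](linearB (submod_incl (syzygy A))).
rewrite -[RHS]/(val (zt k l) - val (zt k l')) !ztE zchar_extD zchar_extN mulrzBr.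
by rewrite -[RHS]ractBr; congr (_ *> _); rewrite !opprB addrACA [RHS]addrACA (addrC (- l')).
Qed.

Lemma syz_split (z : syzygy A) : z = sp (val z) + \sum_k zt k (lift_c k (val z)).
Proof.
apply: val_inj; rewrite submod_valD (linear_sum (submod_incl (syzygy A))) /=.
rewrite [X in _ = X + _]spE -addrA -[LHS]addr0; congr (_ + _); apply/esym/eqP.
rewrite addrC subr_eq0; apply/eqP; apply: eq_bigr => k _.
by rewrite [LHS]ztE -c_cov [cov _]syzygyP c0 mulr0z subr0.
Qed.

Lemma zt_crossed k g h :
  zt k (zg (g * h)%g) = zt k (zg g) *> zg h + zt k (zg h) *~ chi k g.
Proof.
apply: val_inj; rewrite submod_valD (raddfMz (submod_incl (syzygy A))).
rewrite -[X in _ = _ + X]/(val (zt k (zg h)) *~ _) sub_ract !ztE ractA -ract1Mz ractA -ractDr.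
congr (_ *> _); rewrite !zchar_ext_zg zgM zcharM mulrBl mulrBl.
by rewrite !mulrzAl !mulrzAr !mul1r !mulr1 addrA subrK mulrzA.
Qed.

(** When A is free over Z on eigenvectors q k, a homomorphism f on the syzygy is
    determined, up to one which extends, by the values f ([q k] (g - chi k g)):
    these are crossed homomorphisms in g, arbitrary ones occur, and f extends
    exactly when they are principal, the elements m k being the values of the
    extension on the basis elements [q k]. *)
Theorem ext1_characters (T : zmodType) (Th : (I -> G -> B) -> T) :
  (forall E E', Th (fun k g => E k g - E' k g) = Th E - Th E') ->
  (forall E, (forall k, crossed (chi k) (E k)) ->
     (Th E = 0 <-> forall k, principal (chi k) (E k))) ->
  (forall t, exists2 E, (forall k, crossed (chi k) (E k)) & Th E = t) ->
  zmod_iso (Ext1 A B) T.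
Proof.
move=> ThB Thker Thsurj.
pose De (f : Defs.Hom (syzygy A) B) k g := f (zt k (zg g)).
have Dec f k : crossed (chi k) (De f k).
  move=> g h; rewrite /De zt_crossed; have lf := Hom_linear f.
  apply: etrans (linearD (mklin lf) _ _) _; congr (_ + _).
    exact: (lin_ract (mklin lf)).
  exact: (raddfMz (mklin lf)).
apply: (@ext1_iso _ _ _ _ (fun f => Th (De f))).
- by move=> f f'; rewrite -ThB; congr Th.
- move=> t; have [E cE <-] := Thsurj t.
  pose phi (z : syzygy A) : B := \sum_k zg_ext (E k) (lift_c k (val z)).
  have phiB : zmod_morphism phi.
    move=> x y; rewrite /phi -sumrB; apply: eq_bigr => k _.
    by rewrite (linearB (submod_incl (syzygy A))) linearB zg_extB.
  have phig x g : phi (x *> zg g) = phi x *> zg g.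
    rewrite /phi [RHS]scaler_sumr; apply: eq_bigr => k _.
    rewrite sub_ract lin_ract [LHS](zg_ext_crossed _ _ (cE k)).
    by rewrite -c_cov [cov _]syzygyP c0 mulr0z addr0.
  have [f fE] := mkHom (zg_additive_linear phiB phig).
  exists f; congr Th; apply: funext => k; apply: funext => g.
  rewrite /De fE /phi (bigD1 k) // big1 ?addr0 => [|j jk]; rewrite ztE lin_ract lift_c_basis c_q.
    rewrite eqxx mulr1z regular_ract mul1r zchar_ext_zg.
    have zB : zmod_morphism (zg_ext (E k)) by move=> x y; exact: zg_extB.
    have z1 : zg_ext (E k) 1 = 0 by rewrite -(crossed1 (cE k)) -[RHS]zg_ext_zg.
    by rewrite zg_extB (morph_Mz zB) zg_ext_zg z1 mul0rz subr0 [LHS]addr0.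
  by rewrite (negPf jk) mulr0z regular_ract mul0r -(subrr (0 : L)) zg_extB subrr.
- move=> f; apply: iff_trans (Thker _ (Dec f)) _; split.
    move=> /choice[m mE]; apply/asboolP.
    have lf := Hom_linear f.
    have fzt k l : f (zt k l) = m k *> l - m k *~ chx k l.
      apply: (@zg_morph_eq _ _ (fun l => f (zt k l)) (fun l => m k *> l - m k *~ chx k l)).
      - by move=> x y; rewrite ztB; exact: (linearB (mklin lf)).
      - move=> x y; rewrite ractBr zchar_extD zchar_extN mulrzBr.
        by rewrite !opprB addrACA [RHS]addrACA (addrC (- (m k *> y))).
      - by move=> g; rewrite -[LHS]/(De f k g) mE zchar_ext_zg.
    pose h (u : F) : B := f (sp u) + \sum_k m k *> lift_c k u.
    have lh : linear h.
      move=> d x y; rewrite /h sp_linear lf scalerDr addrACA; congr (_ + _).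
      rewrite scaler_sumr -big_split; apply: eq_bigr => k _.
      by rewrite linearP ractDr; congr (_ + _); rewrite -[RHS]/((_ *> _) *> _) ractA.
    have [h' h'E] := mkHom lh; exists h' => z; rewrite h'E /h.
    rewrite {1}(syz_split z) [LHS](linearD (mklin lf)); congr (_ + _).
    rewrite (linear_sum (mklin lf)); apply: eq_bigr => k _.
    by rewrite [LHS]fzt -c_cov [cov _]syzygyP c0 mulr0z subr0.
  move=> /asboolP[h hE] k; exists (h (basis (q k))) => g.
  have lh := Hom_linear h.
  rewrite /De hE ztE [LHS](lin_ract (mklin lh)) ractBr.
  by rewrite ract1Mz zchar_ext_zg.
Qed.

End ExtCharacters.

(** * Crossed homomorphisms into submodules of the group ring *)

Lemma intr_Zp_surj (p : nat) (v : 'Z_p) : exists k : int, k%:~R = v.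
Proof. by exists (v : nat)%:Z; rewrite -pmulrn natr_Zp. Qed.

Lemma intr_Zp_eq0 (p : nat) (k : int) : (1 < p)%N ->
  (k%:~R = 0 :> 'Z_p) <-> exists l, k = p%:Z * l.
Proof.
move=> p1; have nat0 (j : nat) : (j%:R = 0 :> 'Z_p) <-> (p %| j)%N.
  rewrite Zp_nat; split=> [/(congr1 val) /= /eqP|pj].
    by rewrite Zp_cast.
  by apply: val_inj; rewrite /= Zp_cast //; apply/eqP.
split=> [|[l ->]]; last first.
  by rewrite intrM -pmulrn (nat0 p).2 ?mul0r.
case: k => j.
  by rewrite -pmulrn => /nat0/dvdnP[q ->]; exists q%:Z; rewrite mulrC PoszM.
rewrite NegzE mulrNz -pmulrn => /eqP; rewrite oppr_eq0 => /eqP/nat0/dvdnP[q ->].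
by exists (- q%:Z); rewrite mulrN PoszM mulrC.
Qed.

Section RegularCocycles.
Variables (G : finGroupType) (chi : zcharacter G).
Local Notation L := (zgring G).
Hypothesis chi2 : forall g, chi g * chi g = 1.
Implicit Types m : L.

Definition char_sum : L := [ffun g => chi g].
Local Notation N := char_sum.

Lemma zcharV g : chi g^-1%g = chi g.
Proof.
have := zcharM chi g^-1%g g; rewrite mulVg zchar1 => e.
by rewrite -[LHS]mulr1 -(chi2 g) mulrA -e mul1r.
Qed.

Lemma char_sum_mulr g : N * zg g = N *~ chi g.
Proof. by apply/ffunP => k; rewrite zg_mulr zgMzE !ffunE zcharM zcharV. Qed.

Lemma char_sum_mull g : zg g * N = N *~ chi g.
Proof. by apply/ffunP => k; rewrite zg_mull zgMzE !ffunE zcharM zcharV mulrC. Qed.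

Lemma char_sumP m : (forall g, m * zg g = m *~ chi g) -> m = N *~ m 1%g.
Proof.
move=> h; apply/ffunP => g; rewrite zgMzE ffunE.
have := congr1 (fun u : L => u g) (h g); rewrite zg_mulr zgMzE mulgV => ->.
by rewrite mulrCA chi2 mulr1.
Qed.

Lemma coboundaryB (x y : L) g : (x - y) * zg g - (x - y) *~ chi g =
  (x * zg g - x *~ chi g) - (y * zg g - y *~ chi g).
Proof.
rewrite mulrBl mulrzBl !opprB [LHS]addrACA [RHS]addrACA.
by congr (_ + _); rewrite addrC.
Qed.

Lemma same_coboundary (x y : L) :
  (forall g, x * zg g - x *~ chi g = y * zg g - y *~ chi g) ->
  exists l : int, y = x - N *~ l.
Proof.
move=> xy; exists ((x - y) 1%g); rewrite -char_sumP => [|g].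
  by rewrite opprB addrC subrK.
by apply/eqP; rewrite -subr_eq0 coboundaryB xy subrr.
Qed.

Variable S : submodule (L^c^o).

Lemma val_ract_Mz (x y : S) (l : L) (k : int) :
  (val (x *> l + y *~ k) : L) = (val x : L) * l + (val y : L) *~ k.
Proof.
apply: etrans (linearD (submod_incl S) _ _) _; apply: congr2.
  exact: (@sub_regular_ract L S x l).
exact: (raddfMz (submod_incl S)).
Qed.

(** The element m with E g = m g - chi g m: comparing the coefficients at g gives
    (E g) g = m 1 - chi g (m g), and m 1 = 0 is a normalisation. *)
Definition char_diag (E : G -> S) : L := [ffun h => - (chi h * (val (E h) : L) h)].

(** Every crossed homomorphism with values in the group ring is principal: the
    coefficients of E at g and at h g are linked by the crossed relation. *)
Lemma char_diagP (E : G -> S) : crossed chi E -> forall g,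
  (val (E g) : L) = char_diag E * zg g - char_diag E *~ chi g.
Proof.
move=> cE; have cE' g h : (val (E (g * h)%g) : L) = (val (E g) : L) * zg h + (val (E h) : L) *~ chi g.
  by rewrite cE; exact: val_ract_Mz.
move=> g; apply/ffunP => k; rewrite zgDE zgNE zgMzE zg_mulr !ffunE.
have := congr1 (fun u : L => u k) (cE' (k * g^-1)%g g).
rewrite mulgKV zgDE zgMzE zg_mulr => ->.
move: ((val (E (k * g^-1)%g) : L) _) ((val (E g) : L) k) => x y.
rewrite zcharM zcharV; have := chi2 g; have := chi2 k.
move: (chi g) (chi k) => u v vv uu.
have -> : - (v * u * x) - - (v * (x + y * (v * u))) * u = y * (v * v) * (u * u) by ring.
by rewrite vv uu !mulr1.
Qed.

Lemma char_diagB (E E' : G -> S) :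
  char_diag (fun g => E g - E' g) = char_diag E - char_diag E'.
Proof.
apply/ffunP => h; rewrite zgDE zgNE !ffunE.
by rewrite mulrBr opprB opprK addrC.
Qed.

(* inS is membership in S, given apart so as not to handle elements of S *)
Variable inS : L -> Prop.
Hypothesis inSP : forall x, inS x <-> exists y : S, (val y : L) = x.

Definition coboundary_in m := forall g, inS (m * zg g - m *~ chi g).

(** For a submodule S of the group ring, crossed homomorphisms into S are the
    coboundaries m g - chi g m with values in S, and m is unique up to integer
    multiples of N; the class is that of m modulo S and these multiples. *)
Lemma H1_regular_submodule (V : zmodType) (th : L -> V) :
  zmod_morphism th -> th N = 0 ->
  (forall m, coboundary_in m -> (th m = 0 <-> exists l : int, inS (m - N *~ l))) ->
  (forall v, exists2 m, coboundary_in m & th m = v) -> H1_iso chi S V.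
Proof.
move=> thB thN thker thsurj; exists (fun E => th (char_diag E)); split.
- by move=> E E'; rewrite -thB char_diagB.
- move=> E cE; have dE := char_diagP cE.
  have cv : coboundary_in (char_diag E).
    by move=> g; apply/inSP; exists (E g); exact: dE.
  apply: iff_trans (thker _ cv) _.
  have valB (y : S) g : (val (y *> zg g - y *~ chi g) : L) = (val y : L) * zg g - (val y : L) *~ chi g.
    by rewrite -!mulrNz; exact: val_ract_Mz.
  have NB l g : N *~ l * zg g - N *~ l *~ chi g = 0.
    by rewrite mulrzAl char_sum_mulr mulrzAC subrr.
  split=> [[l /inSP[y yE]]|[y yE]].
    exists y => g; apply: val_inj; apply: etrans (dE g) _.
    by apply: etrans _ (esym (valB y g)); rewrite yE coboundaryB NB subr0.
  have [|l lE] := @same_coboundary (char_diag E) (val y : L).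
    by move=> g; rewrite -(dE g) -(valB y g) (yE g).
  by exists l; apply/inSP; exists y.
- move=> v; have [m cm <-] := thsurj v; have [E EP] := choice (fun g => (inSP _).1 (cm g)).
  exists E.
    move=> g h; apply: val_inj; apply: etrans (EP _) _.
    apply: etrans _ (esym (val_ract_Mz _ _ _ _)); rewrite !EP.
    rewrite zgM zcharM mulrBl mulrzBl mulrzAl mulrA addrA subrK.
    by rewrite mulrC mulrzA.
  have -> : char_diag E = m - N *~ m 1%g.
    apply/ffunP => h; rewrite zgDE zgNE zgMzE !ffunE EP zgDE zgNE zgMzE zg_mulr mulgV.
    by rewrite mulrBr opprB mulrCA chi2 mulr1.
  by rewrite thB (morph_Mz thB) thN mul0rz subr0.
Qed.

End RegularCocycles.

(** * Crossed homomorphisms into the dihedral group ring *)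

Section DihedralCocycles.
Variable n : nat.
Hypothesis n_gt0 : (0 < n)%N.
Local Notation D := (dihedral n).
Local Notation Lam := (Lam n).
Local Notation R := (Lam^c).
Local Notation dr := (dihedral_ring_zgring n_gt0).
Local Notation sC := (dr_sC dr).
Local Notation a := (zg (da n) : Lam).
Local Notation b := (zg (db n) : Lam).
Local Notation s := (Sig n).
Implicit Types m x y : Lam.

Section FlipChar.
Variables (chi : zcharacter D) (e : int).
Hypothesis ee : e * e = 1.
Hypothesis chiE : forall g, chi g = if dih_flip g then e else 1.
Local Notation N := (char_sum chi).

Lemma flip_char2 g : chi g * chi g = 1.
Proof. by rewrite chiE; case: ifP. Qed.

Lemma csum_char_sum t : csum t N = (if t then e else 1) * (2 * n)%:Z.
Proof.
rewrite /csum; under eq_bigr do rewrite ffunE chiE /=.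
by rewrite sumr_const card_ord Zp_cast ?two_n_gt1 // -mulr_natr natz.
Qed.

Lemma coboundary_annS m : (forall g, (m * zg g - m *~ chi g) * s = 0) <->
  csum true m = e * csum false m.
Proof.
have cE t g : csum t (m * zg g - m *~ chi g) = csum (t (+) dih_flip g) m - csum t m * chi g.
  by rewrite csumD csumN csumMz csum_mulr.
split=> [/(_ (db n))/(mulS_eq0 n_gt0)/(_ false)|me g].
  by rewrite cE chiE /= mulrC; move/eqP; rewrite subr_eq0 => /eqP.
apply/(mulS_eq0 n_gt0) => t; rewrite cE chiE.
case: (dih_flip g); rewrite ?addbF ?addbT ?mulr1 ?subrr //.
by case: t; rewrite /= me ?(mulrC (csum false m)) ?subrr // mulrAC ee mul1r subrr.
Qed.

Lemma shift_annS m l : csum true m = e * csum false m ->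
  ((m - N *~ l) * s = 0) <-> csum false m = (2 * n)%:Z * l.
Proof.
move=> me; have cE t : csum t (m - N *~ l) = (if t then e else 1) * (csum false m - (2 * n)%:Z * l).
  rewrite csumD csumN csumMz csum_char_sum.
  by case: t; rewrite ?me ?mul1r // mulrBr mulrA.
split=> [/(mulS_eq0 n_gt0)/(_ false)|me0]; first by rewrite cE mul1r => /eqP; rewrite subr_eq0 => /eqP.
by apply/(mulS_eq0 n_gt0) => t; rewrite cE me0 subrr mulr0.
Qed.

Definition csum_mod m : 'Z_(2 * n) := (csum false m)%:~R.

Lemma csum_mod_additive : zmod_morphism csum_mod.
Proof. by move=> x y; rewrite /csum_mod csumD csumN intrB. Qed.

Lemma csum_modP m : csum_mod m = 0 <-> exists l, csum false m = (2 * n)%:Z * l.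
Proof. exact: intr_Zp_eq0 (two_n_gt1 n_gt0). Qed.

Lemma csum_mod_char_sum : csum_mod N = 0.
Proof. by apply/csum_modP; exists 1; rewrite csum_char_sum mul1r mulr1. Qed.

(** The invariant is the sum over the rotations modulo 2n: the other sum is e
    times this one, and N shifts it by 2n. *)
Lemma H1_annihilator (S : submodule (R^o)) :
  (forall x, x * s = 0 <-> exists z : S, (val z : Lam) = x) -> H1_iso chi S 'Z_(2 * n).
Proof.
move=> inS.
apply: (H1_regular_submodule flip_char2 inS csum_mod_additive csum_mod_char_sum).
- move=> m /coboundary_annS me; apply: iff_trans (csum_modP m) _.
  by split=> -[l lE]; exists l; apply/(shift_annS l me).
- move=> v; have [k <-] := intr_Zp_surj v; exists ((1 + b *~ e) *~ k); last first.
    by rewrite /csum_mod csumMz csumD csumMz csum1 -[b]mulr1 csum_mull csum1 mul0r addr0 mul1r.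
  by apply/coboundary_annS; rewrite !csumMz !csumD !csumMz !csum1 -[b]mulr1 !csum_mull !csum1 /= !mul0r add0r addr0 mul1r mul1r.
Qed.

Lemma H1_annS : H1_iso chi (annS sC (R^o)) 'Z_(2 * n).
Proof.
apply: H1_annihilator => x.
split=> [|[z <-]].
  exact: (@mem_annS _ _ _ (R^o)).
exact: (@Gam_val _ _ sC z).
Qed.

Section Antifixed.
Variable t : D.
Hypothesis t_flip : dih_flip t.

Definition antifixed_by x := x * s = 0 /\ (1 + zg t) * x = 0.

(** The coboundaries of m are antifixed by t exactly when (1 + t) m is an
    eigenvector, hence a multiple of N. *)
Lemma coboundary_antifixed m : coboundary_in chi antifixed_by m <->
  csum true m = e * csum false m /\ exists k : int, (1 + zg t) * m = N *~ k.
Proof.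
have mE g : (1 + zg t) * (m * zg g - m *~ chi g) = (1 + zg t) * m * zg g - (1 + zg t) * m *~ chi g.
  by rewrite mulrBr mulrA mulrzAr.
split=> [h|[me [k kE]] g].
  split; first by apply/coboundary_annS => g; exact: (h g).1.
  exists (((1 + zg t) * m) 1%g); apply: (char_sumP flip_char2) => g.
  apply/eqP; rewrite -subr_eq0 -mE; apply/eqP; exact: (h g).2.
split; first exact: (coboundary_annS m).2 me g.
by rewrite mE kE mulrzAl (char_sum_mulr flip_char2) mulrzAC subrr.
Qed.

End Antifixed.
End FlipChar.

Section AntifixedExt.
Variable t : D.
Hypothesis t_flip : dih_flip t.
Local Notation P := (antifixed sC (zg t)).

Let tt : zg t * zg t = 1 :> Lam. Proof. exact: flip_sqr. Qed.

Let inP x : antifixed_by t x <-> exists z : P, (val z : Lam) = x.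
Proof.
by split=> [[]|[z <-]]; [exact: mem_antifixed|exact: (@antifixedP _ _ sC)].
Qed.

Lemma csum_flip r : csum r (zg t) = r%:R.
Proof. by rewrite -[zg t]mulr1 csum_mull t_flip addbT csum1 negbK. Qed.

(** For the sign character t N = - N, so (1 + t) m is a multiple of N only if it
    vanishes, and the invariant is that of the annihilator. *)
Lemma H1_antifixed_sign : H1_iso (sign_char n) P 'Z_(2 * n).
Proof.
have ee : -1 * -1 = 1 :> int by [].
have chiE (g : D) : sign_char n g = if dih_flip g then -1 else 1 by case: g => i [].
have chi2 := flip_char2 ee chiE; set N := char_sum (sign_char n).
have tN : (1 + zg t) * N = 0.
  by rewrite mulrDl mul1r (char_sum_mull chi2) chiE t_flip mulrN1z subrr.
have cvP m : coboundary_in (sign_char n) (antifixed_by t) m <->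
    csum true m = -1 * csum false m /\ (1 + zg t) * m = 0.
  apply: iff_trans (coboundary_antifixed ee chiE t m) _.
  split=> -[me]; last by move=> m0; split=> //; exists 0; rewrite mulr0z.
  move=> [k kE]; split=> //.
  have e1 : zg t * ((1 + zg t) * m) = (1 + zg t) * m.
    by rewrite mulrA mulrDr mulr1 tt addrC.
  have : zg t * ((1 + zg t) * m) = - ((1 + zg t) * m).
    by rewrite kE mulrzAr (char_sum_mull chi2) chiE t_flip mulrN1z mulNrz.
  rewrite e1; move: (_ * m) => w wN; apply/ffunP => g.
  by have := congr1 (fun u : Lam => u g) wN; rewrite zgNE zg0E; move/esym/intN_eq.
apply: (@H1_regular_submodule _ _ chi2 P _ inP _ _ csum_mod_additive (csum_mod_char_sum chiE)).
- move=> m cm; have [me mt] := (cvP m).1 cm; apply: iff_trans (csum_modP m) _; split=> -[l lE]; exists l.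
    split; first exact: (shift_annS chiE l me).2 lE.
    by rewrite mulrBr mt mulrzAr tN mul0rz subrr.
  exact: (shift_annS chiE l me).1 lE.1.
- move=> v; have [k <-] := intr_Zp_surj v; exists ((1 - zg t) *~ k).
    apply/cvP; split.
      by rewrite !csumMz !csumD !csumN !csum_flip !csum1 /= add0r subr0 !mulNr !mul1r.
    by rewrite mulrzAr -[1 - zg t]mulr1 (antifixed_mul _ tt) mul0rz.
  by rewrite /csum_mod csumMz csumD csumN csum_flip csum1 subr0 mul1r.
Qed.

(** For the trivial character (1 + t) m = k N determines the sum of m over the
    rotations as n k, and N itself has k = 2: the invariant is k modulo 2. *)
Lemma H1_antifixed_triv : H1_iso (triv_char D) P 'Z_2.
Proof.
have ee : 1 * 1 = 1 :> int by [].
have chiE (g : D) : triv_char D g = if dih_flip g then 1 else 1 by rewrite if_same.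
have chi2 := flip_char2 ee chiE; set N := char_sum (triv_char D).
have N1 g : N g = 1 by rewrite ffunE.
have tN : (1 + zg t) * N = N *~ 2.
  by rewrite mulrDl mul1r (char_sum_mull chi2) mulr1z.
have N_free (k l : int) : N *~ k = N *~ l -> k = l.
  by move=> /(congr1 (fun u : Lam => u 1%g)); rewrite !zgMzE N1 !mul1r.
pose c m : int := ((1 + zg t) * m) 1%g.
have cB x y : c (x - y) = c x - c y by rewrite /c mulrBr zgDE zgNE.
have cN : c N = 2 by rewrite /c tN zgMzE N1 mul1r.
(* the multiple k of the norm which is (1 + t) m determines the sums of m *)
have cvP m : coboundary_in (triv_char D) (antifixed_by t) m <->
    [/\ csum true m = csum false m, (1 + zg t) * m = N *~ c m & csum false m = n%:Z * c m].
  apply: iff_trans (coboundary_antifixed ee chiE t m) _; rewrite mul1r.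
  split=> [[me [k kE]]|[me mt mc]]; last by split=> //; exists (c m).
  have ck : c m = k by rewrite /c kE zgMzE N1 mul1r.
  split=> //; first by rewrite ck.
  have := congr1 (csum false) kE; rewrite csum_1flip // me ck csumMz (csum_char_sum chiE) mul1r.
  by rewrite PoszM; lia.
pose th m : 'Z_2 := (c m)%:~R.
have thB : zmod_morphism th by move=> x y; rewrite /th cB intrB.
apply: (@H1_regular_submodule _ _ chi2 P _ inP _ _ thB).
- by apply/(intr_Zp_eq0 _ (isT : 1 < 2)%N); exists 1; rewrite cN.
- move=> m cm; have [me mt mc] := (cvP m).1 cm; apply: iff_trans (intr_Zp_eq0 _ (isT : 1 < 2)%N) _.
  have me' : csum true m = 1 * csum false m by rewrite mul1r.
  split=> -[l lE]; exists l.
    split.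
      by apply: (shift_annS chiE l me').2; rewrite mc lE PoszM; lia.
    by rewrite mulrBr mt mulrzAr tN lE -mulrzA subrr.
  have := lE.2; rewrite mulrBr mt mulrzAr tN -mulrzA => /eqP.
  by rewrite subr_eq0 => /eqP/N_free.
- move=> v; have [k <-] := intr_Zp_surj v.
  (* an element with k = 1 *)
  pose w := s - (1 - zg t) *~ n%:Z.
  have wN : (1 + zg t) * w = N.
    rewrite mulrBr mulrzAr -[1 - zg t]mulr1 (antifixed_mul _ tt) mul0rz subr0.
    apply/ffunP => g; rewrite mulrDl mul1r zgDE zg_mull !SigE // [RHS]ffunE.
    by case: (t) t_flip => i [] // _; case: g => j []; rewrite flpV ?flpM ?flprM.
  have ws r : csum r w = n%:Z.
    rewrite csumD csumN csumMz csumD csumN csum_flip csum1 -[s]mulr1 csum_mulS // csum1.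
    by rewrite PoszM; case: r => /=; lia.
  have cw : c (w *~ k) = k by rewrite /c mulrzAr wN zgMzE N1 mul1r.
  exists (w *~ k); last by rewrite /th cw.
  by apply/cvP; rewrite !csumMz !ws cw mulrzAr wN.
Qed.

End AntifixedExt.
End DihedralCocycles.

(** * The group of extensions *)

Lemma ord_lt k i (l l' : (i < k)%N) : Ordinal l = Ordinal l'.
Proof. exact: val_inj. Qed.

Section Bookkeeping.
Variables V W : zmodType.
Local Notation o k := (Ordinal (isT : (k < 7)%N)).

Lemma row_mul_iso :
  zmod_iso ((V * (W * W)) * (V * (V * V)) * (V * (V * V)))%type ('rV[V]_7 * 'rV[W]_2)%type.
Proof.
apply: zmod_iso_sym.
pose f (x : 'rV[V]_7 * 'rV[W]_2) : (V * (W * W)) * (V * (V * V)) * (V * (V * V)) :=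
  ((x.1 0 (o 0), (x.2 0 0, x.2 0 1)), (x.1 0 (o 1), (x.1 0 (o 2), x.1 0 (o 3))),
   (x.1 0 (o 4), (x.1 0 (o 5), x.1 0 (o 6)))).
apply: (@zmod_iso_fun _ _ f).
- by move=> x y; rewrite /f !mxE.
- move=> [x y] [x' y'] [/= e0 d0 d1 e1 e2 e3 e4 e5 e6]; congr pair; apply/rowP.
    by case=> -[|[|[|[|[|[|[|//]]]]]]] lt; rewrite (ord_lt lt isT).
  case=> -[|[|//]] lt.
    by rewrite (_ : Ordinal lt = 0) //; apply: val_inj.
  by rewrite (_ : Ordinal lt = 1) //; apply: val_inj.
- move=> [[[v0 [w0 w1]] [v1 [v2 v3]]] [v4 [v5 v6]]].
  exists (\row_i nth 0 [:: v0; v1; v2; v3; v4; v5; v6] i, \row_i nth 0 [:: w0; w1] i).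
  by rewrite /f !mxE.
Qed.

End Bookkeeping.

Section ExtComputation.
Variable n : nat.
Hypothesis n_gt0 : (0 < n)%N.
Local Notation D := (dihedral n).
Local Notation Lam := (Lam n).
Local Notation R := (Lam^c).
Local Notation dr := (dihedral_ring_zgring n_gt0).
Local Notation sC := (dr_sC dr).
Local Notation b := (zg (db n) : Lam).
Local Notation Q := (Ztriv n * ZT n * ZT n)%type.
Local Notation M := (W2T n * R^o)%type.
Local Notation Z2n := 'Z_(2 * n).

Lemma H1_M chi V : H1_iso chi (annS sC (R^o)) Z2n ->
  (forall t : D, dih_flip t -> H1_iso chi (antifixed sC (zg t)) V) ->
  H1_iso chi (mul_a_sub1 M) (Z2n * (V * V))%type.
Proof.
move=> hG hP; apply: H1_iso_lmod (mul_a_sub1_M_iso n_gt0) _.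
apply: H1_iso_prod hG _; apply: H1_iso_prod; first exact: hP.
by rewrite -zgM; exact: hP.
Qed.

Lemma H1_M_triv : H1_iso (triv_char D) (mul_a_sub1 M) (Z2n * ('Z_2 * 'Z_2))%type.
Proof.
apply: H1_M => [|t tf]; last exact: H1_antifixed_triv.
by apply: (@H1_annS n n_gt0 _ 1) => // g; rewrite if_same.
Qed.

Lemma H1_M_sign : H1_iso (sign_char n) (mul_a_sub1 M) (Z2n * (Z2n * Z2n))%type.
Proof.
apply: H1_M => [|t tf]; last exact: H1_antifixed_sign.
by apply: (@H1_annS n n_gt0 _ (-1)) => // -[i []].
Qed.

Definition Q_char (k : 'I_3) : zcharacter D := if k == 0 then triv_char D else sign_char n.

Definition Q_coord (k : 'I_3) (x : Q) : int := tnth [tuple x.1.1 : int; x.1.2; x.2] k.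

Definition Q_basis (k : 'I_3) : Q := ((k == 0)%:R, (k == 1)%:R, (k == 2%:R)%:R).

Lemma Q_basisMz k (z : int) : Q_basis k *~ z =
  ((k == 0)%:R * z, (k == 1)%:R * z, (k == 2%:R)%:R * z).
Proof.
have pairMz (U V : zmodType) (u : U) (v : V) : (u, v) *~ z = (u *~ z, v *~ z).
  by rewrite [LHS]surjective_pairing (raddfMz fst) (raddfMz snd).
rewrite /Q_basis !pairMz; congr (_, _, _).
- exact: mulrzz.
- exact: mulrzz.
- exact: mulrzz.
Qed.

Lemma ord3_ind (P : 'I_3 -> Prop) : P 0 -> P 1 -> P 2%:R -> forall k, P k.
Proof.
by move=> P0 P1 P2; case=> -[|[|[|//]]] lt;
  [move: P0|move: P1|move: P2]; congr P; apply: val_inj.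
Qed.

Lemma ext1_Q_iso (B : rmodType Lam) (V V' : zmodType) :
  H1_iso (triv_char D) B V -> H1_iso (sign_char n) B V' ->
  zmod_iso (Ext1 Q B) (V * V' * V')%type.
Proof.
move=> [Th [ThB Thk Ths]] [Th' [Th'B Th'k Th's]].
apply: (@ext1_characters _ 'I_3 Q_char Q B Q_basis Q_coord _ _ _ _ _
  (fun E => (Th (E 0), Th' (E 1), Th' (E 2%:R)))).
- move=> k g; rewrite Q_zg /Q_char; elim/ord3_ind: k.
  - by rewrite mulr1z !oppr0 if_same.
  - by rewrite /=; case: (dih_flip g); rewrite ?expr1 ?mulrN1z ?expr0 ?mulr1z.
  - by rewrite /=; case: (dih_flip g); rewrite ?expr1 ?mulrN1z ?expr0 ?mulr1z.
- by move=> k; elim/ord3_ind: k => x y.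
- move=> [[x y] z]; rewrite !big_ord_recl big_ord0 !Q_basisMz.
  by congr (_, _, _); rewrite /Q_coord /= ?mul0r ?mul1r ?addr0 ?add0r.
- by move=> k j; elim/ord3_ind: k; elim/ord3_ind: j.
- by move=> E E'; rewrite ThB !Th'B.
- move=> E cE; split.
    move=> [] /(Thk _ (cE 0)) p0 /(Th'k _ (cE 1)) p1 /(Th'k _ (cE 2%:R)) p2.
    exact: ord3_ind.
  move=> pE; congr (_, _, _).
  - exact: (Thk _ (cE 0)).2 (pE 0).
  - exact: (Th'k _ (cE 1)).2 (pE 1).
  - exact: (Th'k _ (cE 2%:R)).2 (pE 2%:R).
- move=> [[v v'] v'']; have [E0 c0 <-] := Ths v; have [E1 c1 <-] := Th's v'.
  have [E2 c2 <-] := Th's v''.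
  exists (fun k => if k == 0 then E0 else if k == 1 then E1 else E2) => //.
  exact: ord3_ind.
Qed.

Lemma ext1_iso_row : zmod_iso (Ext1 Q (mul_a_sub1 M)) ('rV[Z2n]_7 * 'rV['Z_2]_2)%type.
Proof.
apply: zmod_iso_trans (ext1_Q_iso H1_M_triv H1_M_sign) _; exact: row_mul_iso.
Qed.

End ExtComputation.

(** * Counting the middle terms of extensions *)

Section ExtensionClasses.
Variables (R : nzRingType) (A B : lmodType R).
Local Notation F := (free_cover A).
Local Notation syzHom := (Defs.Hom (syzygy A) B).
Implicit Types K : lmodType R.

(** f represents the class of an extension K: it is the restriction to the syzygy of a lift t
    of the free cover of A to K. *)
Definition realizes K (f : syzHom) : Prop :=
  exists (i : {linear B -> K}) (p : {linear K -> A}) (t : {linear F -> K}),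
  [/\ short_exact i p, forall u, p (t u) = free_cover_map u
    & forall z, i (f z) = t (val z)].

Lemma extension_realizes K (i : {linear B -> K}) (p : {linear K -> A}) :
  short_exact i p -> exists f, realizes K f.
Proof.
move=> ex; have [i_inj p_surj ker] := ex; have [s sE] := choice p_surj.
pose t := free_lift s.
have pt u : p (t u) = free_cover_map u.
  apply: (@free_lift_ext _ _ _ (mklin (linearP (p \o t))) (@free_cover_map R A)) => x.
  by rewrite [RHS]cover_basis -[RHS]sE; congr (p _); exact: free_lift_basis.
have /choice[h hE] : forall z : syzygy A, exists y, i y = t (val z).
  by move=> z; apply/ker; rewrite pt syzygyP.
have lh : linear h.
  by move=> c x y; apply: i_inj; rewrite linearP !hE submod_valD submod_valZ linearP.
have [f fE] := mkHom lh; exists f, i, p, t; split=> // z.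
by rewrite fE hE.
Qed.

(** K is the pushout of B and the free cover along the syzygy.  When f - f' is the
    restriction of g, shifting the first factor of B + F by g matches the
    kernels of the two projections onto K and K'. *)
Lemma realizes_iso K K' f f' : realizes K f -> realizes K' f' ->
  f - f' \in @extendable R A B -> lmod_iso K K'.
Proof.
move=> [i [p [t [[i_inj p_surj ker] pt tf]]]] [i' [p' [t' [[i'_inj p'_surj ker'] pt' tf']]]].
move=> /asboolP[g0 g0E]; pose g := mklin (Hom_linear g0).
have gE (z : syzygy A) : f z = f' z + g (val z).
  have e : f z - f' z = g (val z) by exact: g0E.
  by rewrite -e addrC subrK.
have l1 : linear (fun x : B * F => i x.1 + t x.2).
  by move=> c x y; rewrite !linearP scalerDr addrACA.
have l2 : linear (fun x : B * F => i' (x.1 + g x.2) + t' x.2).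
  move=> c x y; have -> : (c *: x + y).1 + g (c *: x + y).2 =
      c *: (x.1 + g x.2) + (y.1 + g y.2).
    by rewrite (linearP g) scalerDr addrACA.
  by rewrite !linearP scalerDr addrACA.
apply: (@same_kernel_iso _ (B * F)%type K K' (mklin l1) (mklin l2)).
- move=> k; have [|y yE] := (ker (k - t (basis (p k)))).1.
    by rewrite linearB pt cover_basis subrr.
  by exists (y, basis (p k)); rewrite /= yE subrK.
- move=> k; have [|y yE] := (ker' (k - t' (basis (p' k)))).1.
    by rewrite linearB pt' cover_basis subrr.
  by exists (y - g (basis (p' k)), basis (p' k)); rewrite /= subrK yE subrK.
- have pi y : p (i y) = 0 by apply/ker; exists y.
  have p'i' y : p' (i' y) = 0 by apply/ker'; exists y.
  move=> [y u]; rewrite -[mklin l1 _]/(i y + t u) -[mklin l2 _]/(i' (y + g u) + t' u).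
  split=> e.
    have /mem_syzygy[z zE] : free_cover_map u = 0.
      by rewrite -pt -[LHS]add0r -(pi y) -linearD e linear0.
    move: e; rewrite -zE -tf -tf' -linearD -(linear0 i) => /i_inj e.
    by rewrite -linearD -addrA [X in i' (_ + X)]addrC -gE e linear0.
  have /mem_syzygy[z zE] : free_cover_map u = 0.
    by rewrite -pt' -[LHS]add0r -(p'i' (y + g u)) -linearD e linear0.
  move: e; rewrite -zE -tf -tf' -linearD -(linear0 i') => /i'_inj e.
  by rewrite -linearD gE [X in i (_ + X)]addrC addrA e linear0.
Qed.

(** The middle term of an extension is determined up to isomorphism by its class.
    Classes which do not occur get an arbitrary module. *)
Lemma extension_count (T : zmodType) (N : nat) (code : T -> 'I_N) : injective code ->
  zmod_iso (Ext1 A B) T -> exists F : 'I_N -> lmodType R,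
    forall K (i : {linear B -> K}) (p : {linear K -> A}), short_exact i p ->
      exists j, lmod_iso K (F j).
Proof.
move=> code_inj [phi phib].
pose cls (f : syzHom) : 'I_N := code (phi (\pi_(Ext1 A B)%qT f)).
have clsE f f' : cls f = cls f' -> f - f' \in @extendable R A B.
  move=> /code_inj/(bij_inj phib) e.
  by rewrite Quotient.idealrBE e.
have /choice[G GP] : forall j : 'I_N, exists K, forall K' f, cls f = j ->
    realizes K' f -> lmod_iso K' K.
  move=> j; have [[K [f [fj rf]]]|no] := pselect (exists K f, cls f = j /\ realizes K f).
    by exists K => K' f' f'j rf'; apply: realizes_iso rf' rf _; apply: clsE; rewrite f'j.
  by exists A => K' f' f'j rf'; case: no; exists K', f'.
exists G => K i p /extension_realizes[f rf].
by exists (cls f); exact: GP rf.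
Qed.

End ExtensionClasses.

Lemma card_ext_group n : (0 < n)%N ->
  #|{: 'rV['Z_(2 * n)]_7 * 'rV['Z_2]_2}| = (512 * n ^ 7)%N.
Proof.
move=> n_gt0; rewrite card_prod !card_mx !card_ord !Zp_cast ?two_n_gt1 //.
by rewrite !mul1n expnMn mulnAC.
Qed.

Theorem mainTheorem7 (n : nat) (n_ge1 : (1 <= n)%N) :
  let M : rmodType (Lam n) := (W2T n * ((Lam n)^c)^o)%type in
  let Q : rmodType (Lam n) := (Ztriv n * ZT n * ZT n)%type in
  [/\ (forall K : rmodType (Lam n),
         stably_equivalent K (J n) -> same_zrank K (J n) ->
         exists (i : {linear mul_a_sub1 M -> K}) (p : {linear K -> Q}),
           short_exact i p),
      zmod_iso (Ext1 Q (mul_a_sub1 M))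
               ('rV['Z_(2 * n)]_7 * 'rV['Z_2]_2)%type
    & exists F : 'I_(512 * n ^ 7) -> rmodType (Lam n),
        forall K : rmodType (Lam n),
          stably_equivalent K (J n) -> same_zrank K (J n) ->
          exists j, lmod_iso K (F j)].
Proof.
move=> M Q; have ext := ext1_iso_row n_ge1; split=> //.
- exact: minimal_extension.
- rewrite -(card_ext_group n_ge1); have [F FP] := extension_count (T := ('rV['Z_(2 * n)]_7 * 'rV['Z_2]_2)%type) enum_rank_inj ext.
  exists F => K st rk; have [i [p ex]] := minimal_extension n_ge1 st rk.
  exact: FP ex.
Qed.
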